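(* Let $W$ be a non-empty bounded open subset of the Heisenberg group $\mathbf{H}$, let $\lambda$ be the Lebesgue measure on $\mathbf{H}=\mathbf{R}^3$, let $\lambda_W=\lambda(W)^{-1}\lambda|_W$, and let $(\Omega,\mathbf{P})$ be the probability space $\Omega=\mathbf{H}^{\mathbf{N}}$, $\mathbf{P}=\lambda_W^{\mathbf{N}}$ (infinite product measure). Let $\underline{r}=(r_n)$ be a bounded sequence of pairs $r_n=(r_{n,1},r_{n,2})$ of positive real numbers, and for $\omega=(\omega_n)\in\Omega$ define $$E_{\underline r}(\omega)=\limsup_n \overline{R}(\omega_n,r_n)=\bigcap_{n=1}^\infty\bigcup_{k=n}^\infty \overline{R}(\omega_k,r_k).$$ Then for $\mathbf{P}$-almost every $\omega$, $$\dim_{\mathrm H} E_{\underline r}(\omega)=\min\Bigl(\inf\Bigl\{t\in[0,4];\ \sum_n\Phi^t(r_n)<\infty\Bigr\},\,4\Bigr),$$ where $\inf\emptyset=+\infty$ and $\dim_{\mathrm H}$ is the Hausdorff dimension with respect to the metric $d_{\mathbf H}$.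
   Context: The Heisenberg group $\mathbf{H}$ is the set $\mathbf{R}^3$ with group operation $pp'=(x+x',\,y+y',\,z+z'+2(xy'-yx'))$ for $p=(x,y,z)$, $p'=(x',y',z')$. It carries the left-invariant metric $d_{\mathbf H}(p,p')=\|p^{-1}p'\|$, where $\|(x,y,z)\|=((x^2+y^2)^2+z^2)^{1/4}$ and $p^{-1}=(-x,-y,-z)$. For $p=(x,y,z)\in\mathbf{H}$ and a pair $r=(r_1,r_2)$ of positive numbers, the closed rectangle centred at $p$ is $$\overline R(p,r)=\{(x',y',z');\ (x'-x)^2+(y'-y)^2\le r_1^2,\ |z'-z-2(xy'-yx')|\le r_2^2\},$$ which equals $p\,\overline R(0,r)$. The directed singular value function $\Phi^t(r)$, for $t\in[0,4]$ and $r=(r_1,r_2)$ with $r_1,r_2>0$, is defined as follows. If $r_1\le r_2$: $\Phi^t(r)=r_2^t$ for $t\in[0,2]$ and $\Phi^t(r)=r_1^{t-2}r_2^2$ for $t\in[2,4]$. If $r_1\ge r_2$: $\Phi^t(r)=r_1^t$ for $t\in[0,3]$ and $\Phi^t(r)=r_1^{6-t}r_2^{2(t-3)}$ for $t\in[3,4]$. *)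

(* Defs.v *)
From HB Require Import structures.
From mathcomp Require Import all_boot all_order all_algebra.
From mathcomp Require Import all_classical all_reals all_analysis.
Import Order.TTheory GRing.Theory Num.Theory.
Import numFieldNormedType.Exports.

Set Implicit Arguments.
Unset Strict Implicit.
Unset Printing Implicit Defensive.

Local Open Scope classical_set_scope.
Local Open Scope ring_scope.

Section metric.
Context {R : realType} {T : Type} (d : T -> T -> R).

Definition dist_open (A : set T) : Prop :=
  forall x, A x -> exists2 e, 0 < e & forall y, d x y < e -> A y.

Definition dist_bounded (A : set T) : Prop :=
  exists M, forall x y, A x -> A y -> d x y <= M.

(* For d >= 0, the maximum with 0 only matters for the empty set, whose
   supremum would be -oo. *)
Definition diameter (A : set T) : \bar R :=
  maxe 0%E (ereal_sup [set (d p.1 p.2)%:E | p in A `*` A]).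

(* Since 0 `^ 0 = 1, the empty set needs its own case: it contributes nothing
   to a cover, so that countable covers include the finite ones even if s = 0. *)
Definition hausdorff_gauge (s : R) (A : set T) : \bar R :=
  if A == set0 then 0%E else poweR (diameter A) s.

Definition hausdorff_content (delta s : R) (A : set T) : \bar R :=
  ereal_inf [set \sum_(0 <= i <oo) hausdorff_gauge s (U i) | U in
    [set U : nat -> set T | A `<=` \bigcup_i U i /\
                            forall i, (diameter (U i) <= delta%:E)%E]]%E.

Definition hausdorff_measure (s : R) (A : set T) : \bar R :=
  ereal_sup [set hausdorff_content delta s A | delta in [set e : R | 0 < e]].

Definition hausdorff_dim (A : set T) : \bar R :=
  ereal_inf [set s%:E | s in
    [set s : R | 0 <= s /\ hausdorff_measure s A = 0%E]].

End metric.

Section product_measure.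
Context {disp : measure_display} (T : measurableType disp).

Definition coordinate_cylinders : set (set (nat -> T)) :=
  [set C | exists (i : nat) (A : set T),
     measurable A /\ C = [set w | A (w i)]].

Definition seq_space := g_sigma_algebraType coordinate_cylinders.

(* The sets below form a pi-system that generates the sigma-algebra of
   seq_space, so that at most one probability measure P satisfies this. *)
Definition is_infinite_product {R : realType} (mu : set T -> \bar R)
    (P : set seq_space -> \bar R) : Prop :=
  forall (n : nat) (A : nat -> set T), (forall i, measurable (A i)) ->
    P [set w | forall i, (i < n)%N -> A i (w i)] = (\prod_(i < n) mu (A i))%E.

End product_measure.
HB.instance Definition _ disp (T : measurableType disp) :=
  Measurable.on (seq_space T).

Notation heis R := (R * R * R)%type.

Section heisenberg.
Context {R : realType}.

Definition hmul (p q : heis R) : heis R :=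
  let: (x, y, z) := p in let: (x', y', z') := q in
  (x + x', y + y', z + z' + 2 * (x * y' - y * x')).

Definition hinv (p : heis R) : heis R :=
  let: (x, y, z) := p in (- x, - y, - z).

Definition hnorm (p : heis R) : R :=
  let: (x, y, z) := p in ((x ^+ 2 + y ^+ 2) ^+ 2 + z ^+ 2) `^ (4^-1).

Definition hdist (p q : heis R) : R := hnorm (hmul (hinv p) q).

Definition hrectangle (p : heis R) (r : R * R) : set (heis R) :=
  let: (x, y, z) := p in
  [set q | let: (x', y', z') := q in
     (x' - x) ^+ 2 + (y' - y) ^+ 2 <= r.1 ^+ 2 /\
     `|z' - z - 2 * (x * y' - y * x')| <= r.2 ^+ 2].

Definition hlebesgue : set (heis R) -> \bar R :=
  (@lebesgue_measure R \x @lebesgue_measure R \x @lebesgue_measure R)%E.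

Definition hlebesgue_on (W A : set (heis R)) : \bar R :=
  (((fine (hlebesgue W))^-1)%:E * hlebesgue (A `&` W))%E.

Definition Phi (t : R) (r : R * R) : R :=
  if r.1 <= r.2 then
    if t <= 2 then r.2 `^ t else r.1 `^ (t - 2) * r.2 ^+ 2
  else
    if t <= 3 then r.1 `^ t else r.1 `^ (6 - t) * r.2 `^ (2 * (t - 3)).

Definition limsup_rectangles (r : nat -> R * R) (w : nat -> heis R) :
    set (heis R) :=
  lim_sup_set (fun n => hrectangle (w n) (r n)).

End heisenberg.

(* Main.v *)
(** For the upper bound, a rectangle is covered by left translates of small
    tiles; the four cases of [Phi] correspond to the tile sizes [r2], [r1], [r1]
    and [r2^2 / r1], and the cost of the cover is then at most a constant times
    [Phi t r].  This works for every sequence of centres.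

    For the lower bound let [q < t] with [sum_n Phi t (r_n) = oo].  Shrink the
    rectangles by a constant factor, so that all centres that matter for some
    fixed tile lie in [W].  Each rectangle contains an off-centre core with the
    Frostman bound
    [vol (core r `&` T) <= C rho^t / Phi t r * vol (core r)] for all tiles [T] of
    size [rho].  Cut the sequence into blocks on which the sum of the [Phi]
    exceeds [2^k].  The random density obtained by giving each core of a block
    the mass [Phi] approximates Lebesgue measure: by the Frostman bound, the
    variance of the mass of [T] is [O (rho^t vol T / 2^k)], which is summable
    over all dyadic tiles even with the weight [rho^-q].  Hence almost surely the
    weighted square sum of the deviations tends to 0 as [k] grows.  For such a
    realisation, replacing Lebesgue measure on tiles by the densities of later and
    later blocks produces measures on nested compact sets, inside ever later
    rectangles, whose mass stays bounded below and whose dyadic energies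
    [sum_T rho^-q mu(T)^2] stay bounded above.  By Cauchy-Schwarz such measures
    exclude covers with small [q]-dimensional content. *)
Require Import Defs.
From HB Require Import structures.
From mathcomp Require Import all_boot all_order all_algebra.
From mathcomp Require Import all_classical all_reals all_analysis.
From mathcomp Require Import measurable_realfun.
From mathcomp Require Import ring lra zify.
Import Order.TTheory GRing.Theory Num.Theory.
Import numFieldNormedType.Exports.

Set Implicit Arguments.
Unset Strict Implicit.
Unset Printing Implicit Defensive.

Local Open Scope classical_set_scope.
Local Open Scope ring_scope.

(** * Lebesgue measure of sheared boxes *)

(** Tiles of one size partition the space, but tiles of different sizes have different slopes and
    are not nested. There is thus no tree of cubes on which to build a measure: energies are taken
    over all tiles of all sizes at once, and open sets are approximated by tiles of a single size.

    The tiles used in a refinement depend on the realisation, so independence cannot be invoked step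
    by step. All probability is spent beforehand: one null set is removed, outside which the
    deviations on each of the countably many tiles free of boundary effects tend to 0. What follows
    is deterministic.

    Each refinement may lose some mass and gain some energy. Strict bounds on both leave a margin,
    and a late enough block uses up only a part of it. No limit measure is formed: compactness
    reduces a cover of the limit set to a finite cover of one stage, to which the energy bound of
    that stage applies.

    Near the boundary of [W] a point may be hit with smaller probability. Because the radii are
    bounded, one contraction factor removes this effect on a tile inside [W], and it only multiplies
    [Phi t] by a constant. *)

Section Cavalieri.
Context d1 d2 (T1 : measurableType d1) (T2 : measurableType d2) (R : realType).
Context (m1 : {measure set T1 -> \bar R})
        (m2 : {sigma_finite_measure set T2 -> \bar R}).
Context (S : set (T1 * T2)) (D : set T1) (c : \bar R).
Hypothesis mS : measurable S.
Hypothesis mD : measurable D.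
Hypothesis c0 : (0 <= c)%E.
Hypothesis SD : forall p, S p -> D p.1.

Let integral_cD : (\int[m1]_u (c * (\1_D u)%:E) = c * m1 D)%E.
Proof.
have m1D : measurable_fun setT (fun u => (\1_D u)%:E : \bar R).
  by apply/measurable_EFinP/measurable_indic.
by rewrite ge0_integralZl// integral_indic// setIT.
Qed.

Let section0 u : u \notin D -> m2 (xsection S u) = 0%E.
Proof.
rewrite notin_setE => uD; rewrite (_ : xsection _ _ = set0) ?measure0//.
by apply/seteqP; split => v //; rewrite /xsection /= inE => /SD.
Qed.

Lemma product_measure1_eq_sections :
  (forall u, D u -> m2 (xsection S u) = c) -> (m1 \x m2)%E S = (c * m1 D)%E.
Proof.
move=> h; rewrite /product_measure1 -integral_cD; apply: eq_integral => u _ /=.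
rewrite indicE; have [uD|uD] := boolP (u \in D); last by rewrite mule0 section0.
by rewrite mule1 h //; rewrite inE in uD.
Qed.

Lemma product_measure1_le_sections :
  (forall u, D u -> m2 (xsection S u) <= c)%E -> ((m1 \x m2) S <= c * m1 D)%E.
Proof.
move=> h; rewrite /product_measure1 -integral_cD; apply: ge0_le_integral => //.
- exact: measurable_fun_xsection.
- by apply: emeasurable_funM => //; apply/measurable_EFinP/measurable_indic.
- move=> u _ /=.
  rewrite indicE; have [uD|uD] := boolP (u \in D); last by rewrite mule0 section0.
  by rewrite mule1 h //; rewrite inE in uD.
Qed.

End Cavalieri.

Section HeisenbergLebesgue.
Context {R : realType}.

Local Notation mR := (measurableTypeR R).
Local Notation leb2 := (@lebesgue_measure R \x @lebesgue_measure R)%E.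

Definition leb3 : set (heis R) -> \bar R := @hlebesgue R.

Let leb3_0 : leb3 set0 = 0%E.
Proof. exact: (@measure0 _ _ _ (leb2 \x @lebesgue_measure R)%E). Qed.
Let leb3_ge0 A : (0 <= leb3 A)%E.
Proof. exact: (@measure_ge0 _ _ _ (leb2 \x @lebesgue_measure R)%E). Qed.
Let leb3_sigma_additive : semi_sigma_additive leb3.
Proof.
exact: (@measure_semi_sigma_additive _ _ _ (leb2 \x @lebesgue_measure R)%E).
Qed.

(* The library's Lebesgue measure lives on the alias [measurableTypeR R] of [R],
   whose measurable structure is not convertible to the one of [R]. *)
HB.instance Definition _ :=
  isMeasure.Build _ (heis R) R leb3 leb3_0 leb3_ge0 leb3_sigma_additive.

Let leb3_sigma_finite : sigma_finite setT leb3.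
Proof.
pose F (n : nat) : set mR := [set` `[- n%:R, n%:R]].
exists (fun n => F n `*` F n `*` F n).
  apply/esym; apply/seteqP; split => // -[[x y] z] _.
  have [n nP] : exists n : nat, `|x| + `|y| + `|z| <= n%:R.
    by exists (Num.truncn (`|x| + `|y| + `|z|)).+1; apply/ltW/truncnS_gt.
  have h (u : R) : `|u| <= n%:R -> F n u.
    by rewrite ler_norml /F /= in_itv /=.
  exists n => //; split; [split|]; apply: h => /=; apply: le_trans nP.
  - by rewrite -addrA lerDl addr_ge0.
  - by rewrite -addrA addrCA lerDl addr_ge0.
  - by rewrite lerDr addr_ge0.
move=> n.
have mF : measurable (F n) by exact: measurable_itv.
have lF : lebesgue_measure (F n) = (n%:R + n%:R)%:E.
  rewrite lebesgue_measure_itv /= lte_fin.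
  case: ltP => [_|]; first by rewrite opprK.
  rewrite -subr_ge0 => h; have n0 : n%:R = 0 :> R.
    by apply/eqP; rewrite eq_le ler0n andbT; lra.
  by rewrite n0 addr0.
split; first by do 2 apply: measurableX => //.
have mFF : measurable (F n `*` F n) by exact: measurableX.
have E3 := product_measure1E leb2 (@lebesgue_measure R) mFF mF.
have E2 := product_measure1E (@lebesgue_measure R) (@lebesgue_measure R) mF mF.
apply: (@le_lt_trans _ _ (lebesgue_measure (F n) * lebesgue_measure (F n) * lebesgue_measure (F
  n))%E).
  by rewrite -E2 -E3.
by rewrite lF -!EFinM ltry.
Qed.
HB.instance Definition _ :=
  Measure_isSigmaFinite.Build _ _ _ leb3 leb3_sigma_finite.

End HeisenbergLebesgue.

Section ShearedBoxes.
Context {R : realType}.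
Implicit Types (a b c x y z : R).

(** The pairs of booleans in use: [false true] is open, [true true] is closed on the left and open
    on the right, [true false] is closed. *)
Definition itvb (o o' : bool) (x x' : R) : interval R :=
  Interval (BSide o x) (BSide o' x').

(** The height of $(a,b,0)^{-1}p$. Thus [sbox] is a left translate of a coordinate box by a point
    over $(a,b)$. *)
Definition shear a b (p : heis R) : R := p.2 - 2 * (a * p.1.2 - b * p.1.1).

Definition sbox (o o' : bool) a b (x x' y y' z z' : R) : set (heis R) :=
  [set p | [/\ p.1.1 \in itvb o o' x x', p.1.2 \in itvb o o' y y' &
            shear a b p \in itvb o o' z z']].

Lemma measurable_shear a b : measurable_fun setT (shear a b).
Proof.
rewrite /shear.
apply: measurable_funB; first exact: measurable_snd.
apply: measurable_funM; first exact: measurable_cst.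
apply: measurable_funB; apply: measurable_funM; first exact: measurable_cst.
- exact: (measurableT_comp measurable_snd measurable_fst).
- exact: measurable_cst.
- exact: (measurableT_comp measurable_fst measurable_fst).
Qed.

Lemma continuous_shear a b : continuous (shear a b).
Proof.
move=> p; rewrite /shear; apply: continuousB; first exact: cvg_snd.
apply: continuousM; first exact: cvg_cst.
have c1 : {for p, continuous (fun q : heis R => q.1.1)}.
  by apply: continuous_comp; exact: cvg_fst.
have c2 : {for p, continuous (fun q : heis R => q.1.2)}.
  by apply: continuous_comp; [exact: cvg_fst|exact: cvg_snd].
by apply: continuousB; apply: continuousM => //; exact: cvg_cst.
Qed.

Lemma sboxE o o' a b x x' y y' z z' : sbox o o' a b x x' y y' z z' =
  ((fun p : heis R => p.1.1) @^-1` [set` itvb o o' x x']) `&`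
  ((fun p : heis R => p.1.2) @^-1` [set` itvb o o' y y']) `&`
  (shear a b @^-1` [set` itvb o o' z z']).
Proof. by apply/seteqP; split => p [] //= []. Qed.

Lemma measurable_sbox o o' a b x x' y y' z z' :
  measurable (sbox o o' a b x x' y y' z z').
Proof.
rewrite sboxE; apply: measurableI; first apply: measurableI.
- rewrite -[X in measurable X]setTI.
  exact: (measurableT_comp measurable_fst measurable_fst).
- rewrite -[X in measurable X]setTI.
  exact: (measurableT_comp measurable_snd measurable_fst).
- by rewrite -[X in measurable X]setTI; apply: measurable_shear.
Qed.

Lemma open_sbox a b x x' y y' z z' : open (sbox false true a b x x' y y' z z').
Proof.
rewrite sboxE; apply: openI; first apply: openI;
  (apply: open_comp; last exact: interval_open) => p _.
- by apply: continuous_comp; exact: cvg_fst.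
- by apply: continuous_comp; [exact: cvg_fst|exact: cvg_snd].
- exact: continuous_shear.
Qed.

Lemma closed_sbox a b x x' y y' z z' : closed (sbox true false a b x x' y y' z z').
Proof.
rewrite sboxE; apply: closedI; first apply: closedI;
  (apply: closed_comp; last exact: interval_closed) => p _.
- by apply: continuous_comp; exact: cvg_fst.
- by apply: continuous_comp; [exact: cvg_fst|exact: cvg_snd].
- exact: continuous_shear.
Qed.

Lemma leb_itvb o o' x x' : x <= x' ->
  lebesgue_measure [set` itvb o o' x x'] = (x' - x)%:E.
Proof.
move=> xx'; rewrite lebesgue_measure_itv /= lte_fin lt_neqAle xx' andbT.
by case: eqP => //= ->; rewrite subrr.
Qed.

(** Shearing preserves volume: over each point of the base the fibre is an interval of length
    [z' - z], and only its position depends on the slope. *)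
Lemma leb3_sbox o o' a b x x' y y' z z' : x <= x' -> y <= y' -> z <= z' ->
  leb3 (sbox o o' a b x x' y y' z z') =
  ((x' - x) * (y' - y) * (z' - z))%:E.
Proof.
move=> xx' yy' zz'.
pose mR := measurableTypeR R.
pose D : set (mR * mR) := [set` itvb o o' x x'] `*` [set` itvb o o' y y'].
have mD : measurable D by apply: measurableX; exact: measurable_itv.
rewrite /leb3 /hlebesgue (@product_measure1_eq_sections _ _ _ _ _ _ _ _ D (z' - z)%:E)//.
- have E : ((@lebesgue_measure R \x @lebesgue_measure R) D =
      ((x' - x) * (y' - y))%:E)%E.
    by rewrite EFinM -(@leb_itvb o o')// -(@leb_itvb o o' y)//; apply: product_measure1E.
  by apply: etrans (congr1 _ E) _; rewrite -EFinM mulrC.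
- by rewrite lee_fin subr_ge0.
- by move=> p [].
move=> u [] /= ux uy.
rewrite -(_ : (z' + 2 * (a * u.2 - b * u.1) -
     (z + 2 * (a * u.2 - b * u.1)))%:E = (z' - z)%:E); last by congr EFin; ring.
rewrite -(@leb_itvb o o'); last by rewrite lerD2r.
congr (lebesgue_measure _); apply/seteqP; split => q;
  rewrite /xsection /= inE /sbox/= /shear/= !in_itv /=.
  by case=> _ _; case: (o) (o') => -[] /=;
    rewrite ?lerBrDr ?lerBlDr ?ltrBlDr ?ltrBrDr.
move=> h3; split => //; move: h3.
by case: (o) (o') => -[] /=; rewrite ?lerBrDr ?lerBlDr ?ltrBlDr ?ltrBrDr.
Qed.

(** Fubini in the order z, y, x, for windows that slide with the outer coordinates. The choice of
    the constraint that supplies each window gives the different volume bounds for a core inside a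
    tile. *)
Lemma leb3_le_fibres (S : set (heis R)) (x x' : R) (J : R -> R)
    (L : R -> R -> R) (Y Z : R) :
  measurable S -> 0 <= Y -> 0 <= Z -> x <= x' -> measurable_fun setT J ->
  (forall p, S p -> [/\ x <= p.1.1 <= x', J p.1.1 <= p.1.2 <= J p.1.1 + Y &
     L p.1.1 p.1.2 <= p.2 <= L p.1.1 p.1.2 + Z]) ->
  (leb3 S <= ((x' - x) * Y * Z)%:E)%E.
Proof.
move=> mS Y0 Z0 xx' mJ SP.
pose mR := measurableTypeR R.
pose D : set (mR * mR) := [set p | x <= p.1 <= x' /\ J p.1 <= p.2 <= J p.1 + Y].
have mD : measurable D.
  have -> : D = (fst @^-1` [set` itvb true false x x']) `&`
      ((fun p : R * R => p.2 - J p.1) @^-1` [set` itvb true false 0 Y]).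
    apply/seteqP; split => p; rewrite /D /= !in_itv /= subr_ge0 lerBlDr [Y + _]addrC;
      by case.
  apply: measurableI; rewrite -[X in measurable X]setTI.
    exact: (@measurable_fst _ _ mR mR).
  have : measurable_fun setT (fun p : R * R => p.2 - J p.1).
    by apply: measurable_funB => //; exact: (measurableT_comp mJ measurable_fst).
  exact.
have leD : ((@lebesgue_measure R \x @lebesgue_measure R) D <= ((x' - x) * Y)%:E)%E.
  rewrite mulrC EFinM -(@leb_itvb true false)//.
  apply: (@product_measure1_le_sections _ _ mR mR) => //.
  - by move=> p [].
  - move=> u _ /=; rewrite -[X in (_ <= X%:E)%E](_ : J u + Y - J u = Y); last by ring.
    rewrite -(@leb_itvb true false); last by rewrite lerDl.
    apply: le_measure; rewrite ?inE //=.
      exact: measurable_xsection.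
    by move=> v; rewrite /xsection /= inE /D /= in_itv /= => -[].
rewrite mulrC EFinM; apply: le_trans (_ : (Z%:E * (@lebesgue_measure R \x @lebesgue_measure R)
  D <= _)%E); last first.
  exact: lee_wpmul2l.
rewrite /leb3 /hlebesgue.
apply: (@product_measure1_le_sections _ _ (mR * mR)%type mR) => //.
- by move=> p /SP[].
- move=> u _ /=; rewrite -[X in (_ <= X%:E)%E](_ : L u.1 u.2 + Z - L u.1 u.2 = Z); last by ring.
  rewrite -(@leb_itvb true false); last by rewrite lerDl.
  apply: le_measure; rewrite ?inE //=.
    exact: (@measurable_xsection _ _ (mR * mR)%type mR).
  by move=> v; rewrite /xsection /= inE /= in_itv /= => /SP [].
Qed.

End ShearedBoxes.

(** * Heisenberg tiles *)

Section Distance.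
Context {R : realType}.
Implicit Types (u v p q w : heis R) (rho : R).

(** The fourth power of [hdist u v]: a polynomial, so that distance estimates need no roots. *)
Definition hnorm4 u v : R :=
  ((v.1.1 - u.1.1) ^+ 2 + (v.1.2 - u.1.2) ^+ 2) ^+ 2 +
  (v.2 - u.2 - 2 * (u.1.1 * v.1.2 - u.1.2 * v.1.1)) ^+ 2.

Lemma hnorm4_ge0 u v : 0 <= hnorm4 u v.
Proof. by rewrite /hnorm4 addr_ge0 ?sqr_ge0. Qed.

Lemma hdist_ge0 u v : 0 <= hdist u v.
Proof. by case: u v => [[x y] z] [[x' y'] z']; rewrite /hdist /= powR_ge0. Qed.

Lemma hdist4E u v : hdist u v ^+ 4 = hnorm4 u v.
Proof.
rewrite -powR_mulrn ?hdist_ge0//.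
suff -> : hdist u v = hnorm4 u v `^ 4^-1.
  by rewrite -powRrM mulVf ?pnatr_eq0// powRr1// hnorm4_ge0.
case: u v => [[x y] z] [[x' y'] z']; rewrite /hdist /hnorm4 /=.
by congr (_ `^ _); ring.
Qed.

Lemma hdist_ltE u v rho : 0 < rho -> (hdist u v < rho) = (hnorm4 u v < rho ^+ 4).
Proof. by move=> r0; rewrite -hdist4E ltr_pXn2r// nnegrE ?hdist_ge0// ltW. Qed.

Lemma hdist_leE u v rho : 0 <= rho -> (hdist u v <= rho) = (hnorm4 u v <= rho ^+ 4).
Proof. by move=> r0; rewrite -hdist4E ler_pXn2r// nnegrE ?hdist_ge0. Qed.

(** The left translate by [u] of an open coordinate box. It contains the ball of radius [rho] about
    [u] and lies in the one of radius [2 * rho]. *)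
Definition hbox u rho : set (heis R) :=
  sbox false true u.1.1 u.1.2 (u.1.1 - rho) (u.1.1 + rho)
    (u.1.2 - rho) (u.1.2 + rho) (u.2 - rho ^+ 2) (u.2 + rho ^+ 2).

Lemma hboxE u rho v : 0 < rho -> hbox u rho v <->
  [/\ `|v.1.1 - u.1.1| < rho, `|v.1.2 - u.1.2| < rho &
      `|v.2 - u.2 - 2 * (u.1.1 * v.1.2 - u.1.2 * v.1.1)| < rho ^+ 2].
Proof.
move=> r0; rewrite /hbox /sbox /shear /= !in_itv /= !ltr_norml.
by split => -[] /andP[? ?] /andP[? ?] /andP[? ?]; split; apply/andP; split; lra.
Qed.

Lemma hdist_hbox u v rho : hdist u v < rho -> hbox u rho v.
Proof.
move=> h; have r0 : 0 < rho by apply: le_lt_trans h; exact: hdist_ge0.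
move: h; rewrite hdist_ltE// hboxE// /hnorm4.
set X := v.1.1 - _; set Y := v.1.2 - _; set Z := (v.2 - _ - _) => h.
have r2 : 0 < rho ^+ 2 by rewrite exprn_gt0.
have hZ : Z ^+ 2 < (rho ^+ 2) ^+ 2.
  by rewrite -exprM; apply: le_lt_trans h; rewrite lerDr sqr_ge0.
have hXY : X ^+ 2 + Y ^+ 2 < rho ^+ 2.
  rewrite -(@ltr_pXn2r _ 2)// ?nnegrE ?addr_ge0 ?sqr_ge0 ?(ltW r2)//.
  by rewrite -exprM; apply: le_lt_trans h; rewrite lerDl sqr_ge0.
have hX : X ^+ 2 < rho ^+ 2 by apply: le_lt_trans hXY; rewrite lerDl sqr_ge0.
have hY : Y ^+ 2 < rho ^+ 2 by apply: le_lt_trans hXY; rewrite lerDr sqr_ge0.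
have g (x y : R) : 0 < y -> x ^+ 2 < y ^+ 2 -> `|x| < y.
  move=> y0 xy; rewrite -(@ltr_pXn2r _ 2)// ?nnegrE ?(ltW y0)//.
  by rewrite real_normK// num_real.
by split; apply: g.
Qed.

End Distance.

Section TileArithmetic.

Let trichotomy (i : int) : -2 < i < 2 -> [\/ i = -1, i = 0 | i = 1].
Proof.
by move=> ?; have : i = -1 \/ i = 0 \/ i = 1 by [lia|]; case=> [|[|]]; constructor.
Qed.

Variable R : realType.

Let frac (s : R) (a : int) : a%:~R <= s < (a + 1)%:~R -> 0 <= s - a%:~R <= 1.
Proof. by rewrite intrD => /andP[? ?]; apply/andP; split; lra. Qed.

Lemma floor_near (s s' : R) (a a' : int) : `|s' - s| < 1 -> a%:~R <= s < (a + 1)%:~R ->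
  a'%:~R <= s' < (a' + 1)%:~R -> -2 < a' - a < 2.
Proof.
rewrite ltr_norml -!(ltr_int R) !(intrD, rmorphN) /=.
by move=> /andP[? ?] /andP[? ?] /andP[? ?]; apply/andP; split; lra.
Qed.

Let mul01 (s t : R) : 0 <= s <= 1 -> 0 <= t <= 1 -> 0 <= s * t <= 1.
Proof. by move=> /andP[? ?] /andP[? ?]; rewrite mulr_ge0//= mulr_ile1. Qed.

Let shift_bound (al be : int) (th ph th' ph' : R) : -2 < al < 2 -> -2 < be < 2 ->
  0 <= th <= 1 -> 0 <= ph <= 1 -> 0 <= th' <= 1 -> 0 <= ph' <= 1 ->
  `|- al%:~R * (ph + ph') + be%:~R * (th + th') + (th * ph' - ph * th')| <= 5.
Proof.
move=> al1 be1 h1 h2 h3 h4.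
have /andP[m1 m2] := mul01 h1 h4; have /andP[m3 m4] := mul01 h2 h3.
move: m1 m2 m3 m4; set U := th * ph'; set V := ph * th' => m1 m2 m3 m4.
have W1 : -1 <= U - V <= 1 by apply/andP; split; lra.
move: W1; set W := U - V => /andP[W1 W2].
clearbody W; clear - trichotomy al1 be1 h1 h2 h3 h4 W1 W2.
move: h1 h2 h3 h4 => /andP[? ?] /andP[? ?] /andP[? ?] /andP[? ?].
rewrite ler_norml.
by case: (trichotomy al1) => ->; case: (trichotomy be1) => ->;
  rewrite ?rmorphN /= ?rmorph0 ?rmorph1; apply/andP; split; lra.
Qed.

(** Coordinates are measured in units of the tile size. Replacing both points by their corners
    changes the group correction by [2 * E], where [E] involves only index differences and
    fractional parts, and $|E| \le 2 + 2 + 1$. With the invariant height difference, below 1, this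
    gives 11; the two floors cost 1 more. *)
Lemma floor_shear_near (X Y Z X' Y' Z' : R) (a b c a' b' c' : int) :
  a%:~R <= X < (a + 1)%:~R -> b%:~R <= Y < (b + 1)%:~R ->
  a'%:~R <= X' < (a' + 1)%:~R -> b'%:~R <= Y' < (b' + 1)%:~R ->
  c%:~R <= Z - 2 * (a%:~R * Y - b%:~R * X) < (c + 1)%:~R ->
  c'%:~R <= Z' - 2 * (a'%:~R * Y' - b'%:~R * X') < (c' + 1)%:~R ->
  `|X' - X| < 1 -> `|Y' - Y| < 1 -> `|Z' - Z - 2 * (X * Y' - Y * X')| < 1 ->
  -12 < c' - c + 2 * ((a' - a) * b - (b' - b) * a) < 12.
Proof.
move=> ha hb ha' hb' hc hc' dX dY dZ.
have := shift_bound (floor_near dX ha ha') (floor_near dY hb hb')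
  (frac ha) (frac hb) (frac ha') (frac hb').
set E := (X in `|X|) => hE.
have key : (Z' - 2 * (a'%:~R * Y' - b'%:~R * X')) - (Z - 2 * (a%:~R * Y - b%:~R * X))
   + 2 * ((a' - a)%:~R * b%:~R - (b' - b)%:~R * a%:~R)
 = (Z' - Z - 2 * (X * Y' - Y * X')) + 2 * E.
  by rewrite /E !(intrD, rmorphN) /=; ring.
set g := 2 * (_ - _).
have gE : 2 * ((a' - a)%:~R * b%:~R - (b' - b)%:~R * a%:~R) = g%:~R :> R.
  by rewrite /g !(rmorphM, rmorphB).
have e12 : 12%:~R = 12 :> R by rewrite rmorph_nat.
rewrite -!(ltr_int R) [(-12)%:~R]rmorphN e12 [(c' - c + g)%:~R]rmorphD /= [(c' - c)%:~R]rmorphB /=.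
move: key hc hc' dZ hE; rewrite gE [(c + 1)%:~R]rmorphD /= [(c' + 1)%:~R]rmorphD /= rmorph1.
set D := Z' - Z - _; set z := Z - _; set z' := Z' - _.
clearbody g D z z' E; clear - R; rewrite ltr_norml ler_norml.
move=> key /andP[? ?] /andP[? ?] /andP[? ?] /andP[? ?].
by apply/andP; split; lra.
Qed.

End TileArithmetic.

Section Tiles.
Context {R : realType}.
Implicit Types (u v p q w : heis R) (rho : R) (k : int * int * int).

(** Freezing the slope at the corner makes membership a matter of three successive floors, which is
    why the half-open tiles of one size partition the space. *)
Definition tile (o o' : bool) rho k : set (heis R) :=
  sbox o o' (k.1.1%:~R * rho) (k.1.2%:~R * rho)
    (k.1.1%:~R * rho) ((k.1.1 + 1)%:~R * rho)
    (k.1.2%:~R * rho) ((k.1.2 + 1)%:~R * rho)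
    (k.2%:~R * rho ^+ 2) ((k.2 + 1)%:~R * rho ^+ 2).

Notation otile := (tile false true).
Notation htile := (tile true true).
Notation ctile := (tile true false).

Lemma otile_htile rho k : otile rho k `<=` htile rho k.
Proof.
move=> p []; rewrite !in_itv /= => /andP[/ltW a1 a2] /andP[/ltW b1 b2] /andP[/ltW c1 c2].
by split; rewrite in_itv /= ?a1 ?b1 ?c1.
Qed.

Lemma htile_ctile rho k : htile rho k `<=` ctile rho k.
Proof.
move=> p []; rewrite !in_itv /= => /andP[a1 /ltW a2] /andP[b1 /ltW b2] /andP[c1 /ltW c2].
by split; rewrite in_itv /= ?a1 ?b1 ?c1.
Qed.

Lemma leb3_tile o o' rho k : 0 <= rho -> leb3 (tile o o' rho k) = (rho ^+ 4)%:E.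
Proof.
move=> r0; rewrite leb3_sbox; last 3 first.
- by rewrite ler_wpM2r// ler_int lerDl.
- by rewrite ler_wpM2r// ler_int lerDl.
- by rewrite ler_wpM2r ?exprn_ge0// ler_int lerDl.
by congr EFin; rewrite !intrD; ring.
Qed.

Lemma measurable_tile o o' rho k : measurable (tile o o' rho k).
Proof. exact: measurable_sbox. Qed.

Definition tile_index rho p : int * int * int :=
  let a := Num.floor (p.1.1 / rho) in let b := Num.floor (p.1.2 / rho) in
  (a, b, Num.floor (shear (a%:~R * rho) (b%:~R * rho) p / rho ^+ 2)).

Lemma htile_index rho p : 0 < rho -> htile rho (tile_index rho p) p.
Proof.
move=> r0; have r2 : 0 < rho ^+ 2 by rewrite exprn_gt0.
rewrite /tile /tile_index /=; split; rewrite in_itv /=.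
- by rewrite -ler_pdivlMr// -ltr_pdivrMr// floor_itv.
- by rewrite -ler_pdivlMr// -ltr_pdivrMr// floor_itv.
- by rewrite -ler_pdivlMr// -ltr_pdivrMr// floor_itv.
Qed.

Lemma htile_uniq rho k p : 0 < rho -> htile rho k p -> k = tile_index rho p.
Proof.
move=> r0; have r2 : 0 < rho ^+ 2 by rewrite exprn_gt0.
case: k => [[a b] c]; rewrite /tile /tile_index => -[] /=.
rewrite !in_itv /= -!(ler_pdivlMr _ _ r0) -!(ltr_pdivrMr _ _ r0).
rewrite -(ler_pdivlMr _ _ r2) -(ltr_pdivrMr _ _ r2).
by move=> /floor_def -> /floor_def -> /floor_def ->.
Qed.

Definition irange (n : nat) : seq int := [seq i%:Z - n%:Z | i <- iota 0 (2 * n + 1)].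

Lemma mem_irange (n : nat) (c : int) : - n.+1%:Z < c < n.+1%:Z -> c \in irange n.
Proof.
move=> /andP[h1 h2]; apply/mapP; exists (absz (c + n%:Z)); last by lia.
by rewrite mem_iota; lia.
Qed.

Lemma size_irange n : size (irange n) = (2 * n + 1)%N.
Proof. by rewrite size_map size_iota. Qed.

(* The tiles of size [rho] that can meet [hbox u rho]: the third index is corrected
   for the different slopes of the boxes. *)
Definition near_tiles rho u : seq (int * int * int) :=
  let: (a, b, c) := tile_index rho u in
  [seq (a + al.1, b + al.2, c - 2 * (al.1 * b - al.2 * a) + ga) |
     al <- [seq (al, be) | al <- irange 1, be <- irange 1], ga <- irange 11].

(** $207 = 3 \cdot 3 \cdot 23$: two horizontal index differences in $\{-1,0,1\}$ and a corrected
    vertical one between $-11$ and $11$. *)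
Lemma size_near_tiles rho u : size (near_tiles rho u) = 207%N.
Proof. by rewrite /near_tiles; case: tile_index => [[a b] c]; rewrite !size_allpairs
  !size_irange. Qed.

Lemma hbox_near_tiles rho u v : 0 < rho -> hbox u rho v ->
  tile_index rho v \in near_tiles rho u.
Proof.
move=> r0; have r2 : 0 < rho ^+ 2 by rewrite exprn_gt0.
have rn0 : rho != 0 by rewrite gt_eqF.
move=> /(hboxE _ _ r0); case: u v => [[x y] z] [[x' y'] z'] /= [hx hy hz].
rewrite /near_tiles /tile_index; cbv beta zeta iota delta [fst snd].
set a := Num.floor (x / rho); set b := Num.floor (y / rho).
set c := Num.floor (shear _ _ (x, y, z) / _).
set a' := Num.floor (x' / rho); set b' := Num.floor (y' / rho).
set c' := Num.floor (shear _ _ (x', y', z') / _).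
pose X := x / rho; pose Y := y / rho; pose X' := x' / rho; pose Y' := y' / rho.
pose Z := z / rho ^+ 2; pose Z' := z' / rho ^+ 2.
have xE : x = X * rho by rewrite /X divfK.
have yE : y = Y * rho by rewrite /Y divfK.
have x'E : x' = X' * rho by rewrite /X' divfK.
have y'E : y' = Y' * rho by rewrite /Y' divfK.
have zE : z = Z * rho ^+ 2 by rewrite /Z divfK ?expf_neq0.
have z'E : z' = Z' * rho ^+ 2 by rewrite /Z' divfK ?expf_neq0.
have ha : a%:~R <= X < (a + 1)%:~R by exact: floor_itv.
have hb : b%:~R <= Y < (b + 1)%:~R by exact: floor_itv.
have ha' : a'%:~R <= X' < (a' + 1)%:~R by exact: floor_itv.
have hb' : b'%:~R <= Y' < (b' + 1)%:~R by exact: floor_itv.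
have hc : c%:~R <= Z - 2 * (a%:~R * Y - b%:~R * X) < (c + 1)%:~R.
  rewrite (_ : Z - _ = shear (a%:~R * rho) (b%:~R * rho) (x, y, z) / rho ^+ 2).
    exact: floor_itv.
  by rewrite /shear /= xE yE zE; field.
have hc' : c'%:~R <= Z' - 2 * (a'%:~R * Y' - b'%:~R * X') < (c' + 1)%:~R.
  rewrite (_ : Z' - _ = shear (a'%:~R * rho) (b'%:~R * rho) (x', y', z') / rho ^+ 2).
    exact: floor_itv.
  by rewrite /shear /= x'E y'E z'E; field.
have dX : `|X' - X| < 1.
  by rewrite -(ltr_pM2r r0) mul1r -{1}(gtr0_norm r0) -normrM mulrBl -x'E -xE.
have dY : `|Y' - Y| < 1.
  by rewrite -(ltr_pM2r r0) mul1r -{1}(gtr0_norm r0) -normrM mulrBl -y'E -yE.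
have dZ : `|Z' - Z - 2 * (X * Y' - Y * X')| < 1.
  rewrite -(ltr_pM2r r2) mul1r -{1}(gtr0_norm r2) -normrM.
  rewrite (_ : _ * rho ^+ 2 = z' - z - 2 * (x * y' - y * x'))//.
  by rewrite xE yE zE x'E y'E z'E; ring.
have al1 := floor_near dX ha ha'; have be1 := floor_near dY hb hb'.
have ga1 := floor_shear_near ha hb ha' hb' hc hc' dX dY dZ.
apply/allpairsPdep; exists (a' - a, b' - b), (c' - c + 2 * ((a' - a) * b - (b' - b) * a)).
split.
- by apply/allpairsPdep; exists (a' - a), (b' - b); split => //; exact: mem_irange.
- exact: mem_irange.
- by congr (_, _, _); ring.
Qed.

Lemma ctile_diam rho k u v : 0 <= rho -> ctile rho k u -> ctile rho k v ->
  hdist u v <= 3 * rho.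
Proof.
move=> r0; case: k => [[a b] c]; case: u v => [[x y] z] [[x' y'] z'].
have mD (i : int) (s : R) : (i + 1)%:~R * s = i%:~R * s + s.
  by rewrite intrD mulrDl mul1r.
rewrite hdist_leE ?mulr_ge0// /hnorm4 /tile /sbox /shear /=.
rewrite !in_itv /= !mD.
set A := a%:~R * rho; set B := b%:~R * rho; set C := c%:~R * rho ^+ 2.
move=> [/andP[a1 a2] /andP[b1 b2] /andP[c1 c2]] [/andP[a3 a4] /andP[b3 b4] /andP[c3 c4]].
have hX : `|x' - x| <= rho by rewrite ler_norml; apply/andP; split; lra.
have hY : `|y' - y| <= rho by rewrite ler_norml; apply/andP; split; lra.
have hA : `|A - x| <= rho by rewrite ler_norml; apply/andP; split; lra.
have hB : `|B - y| <= rho by rewrite ler_norml; apply/andP; split; lra.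
have mm (s t : R) : `|s| <= rho -> `|t| <= rho -> `|s * t| <= rho ^+ 2.
  by move=> ? ?; rewrite normrM expr2 ler_pM.
have hAY := mm _ _ hA hY; have hBX := mm _ _ hB hX.
have h1 : (x' - x) ^+ 2 + (y' - y) ^+ 2 <= 2 * rho ^+ 2.
  have := mm _ _ hX hX; have := mm _ _ hY hY.
  rewrite -!expr2 !ger0_norm ?sqr_ge0//; lra.
(* One unit comes from the window of the sheared height, the other four from exchanging the slope of
   the corner for that of [u]. Then $2^2 + 5^2 = 29 \le 3^4$. *)
have h2 : `|z' - z - 2 * (x * y' - y * x')| <= 5 * rho ^+ 2.
  have -> : z' - z - 2 * (x * y' - y * x') = (z' - 2 * (A * y' - B * x')) - (z - 2 * (A * y - B
    * x))
     + 2 * ((A - x) * (y' - y) - (B - y) * (x' - x)) by ring.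
  move: hAY hBX c1 c2 c3 c4; clear.
  set P := (A - x) * _; set Q := (B - y) * _; clearbody P Q.
  rewrite !ler_norml => /andP[? ?] /andP[? ?] *; apply/andP; split; lra.
have r2 : 0 <= rho ^+ 2 by rewrite exprn_ge0.
have h3 : ((x' - x) ^+ 2 + (y' - y) ^+ 2) ^+ 2 <= (2 * rho ^+ 2) ^+ 2.
  by rewrite ler_pXn2r// nnegrE ?addr_ge0 ?sqr_ge0// mulr_ge0.
have h4 : (z' - z - 2 * (x * y' - y * x')) ^+ 2 <= (5 * rho ^+ 2) ^+ 2.
  by rewrite -[X in X <= _]real_normK ?num_real// ler_pXn2r// nnegrE ?mulr_ge0.
change (((x' - x) ^+ 2 + (y' - y) ^+ 2) ^+ 2 + (z' - z - 2 * (x * y' - y * x')) ^+ 2 <= (3 *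
  rho) ^+ 4).
apply: (le_trans (lerD h3 h4)).
have -> : (2 * rho ^+ 2) ^+ 2 + (5 * rho ^+ 2) ^+ 2 = 29 * rho ^+ 4 by ring.
have -> : (3 * rho) ^+ 4 = 81 * rho ^+ 4 by ring.
by rewrite ler_wpM2r ?exprn_ge0// ler_nat.
Qed.

Lemma compact_ctile rho k : compact (ctile rho k : set (R * R * R)%type).
Proof.
pose M : R := `|k.2%:~R * rho ^+ 2| + `|(k.2 + 1)%:~R * rho ^+ 2| +
 2 * (`|k.1.1%:~R * rho| * (`|k.1.2%:~R * rho| + `|(k.1.2 + 1)%:~R * rho|) +
  `|k.1.2%:~R * rho| * (`|k.1.1%:~R * rho| + `|(k.1.1 + 1)%:~R * rho|)).
apply: (@subclosed_compact _ _ (`[k.1.1%:~R * rho, (k.1.1 + 1)%:~R * rho] `*`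
  `[k.1.2%:~R * rho, (k.1.2 + 1)%:~R * rho] `*` `[- M, M])).
- exact: closed_sbox.
- by apply: compact_setX; [apply: compact_setX|]; exact: segment_compact.
move=> [[x y] z] []; rewrite /shear /= !in_itv /= => a1 b1 c1.
split; [by split; rewrite /= ?in_itv|rewrite /= ?in_itv /=].
have bd (s t t' : R) : t <= s <= t' -> `|s| <= `|t| + `|t'|.
  move=> /andP[h1 h2]; rewrite ler_norml; apply/andP; split.
    by apply: le_trans h1; rewrite opprD ler_wnDr ?oppr_le0// lerNl ler_normr lexx orbT.
  by apply: (le_trans h2); rewrite ler_wpDl// ler_norm.
rewrite -ler_norml -[z](subrK (2 * (k.1.1%:~R * rho * y - k.1.2%:~R * rho * x))).
apply: (le_trans (ler_normD _ _)); rewrite /M lerD ?bd//.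
rewrite normrM ger0_norm// ler_wpM2l//.
apply: (le_trans (ler_normB _ _)).
rewrite [`|_ * y|]normrM [`|_ * x|]normrM.
by rewrite lerD// ler_wpM2l ?bd.
Qed.

End Tiles.

Notation otile := (tile false true).
Notation htile := (tile true true).
Notation ctile := (tile true false).

Section Approximation.
Context {R : realType}.
Implicit Types (A B T : set (heis R)) (rho : R) (k : int * int * int).

Definition scale (m : nat) : R := 2 ^- m.

Lemma scale_gt0 m : 0 < scale m. Proof. by rewrite invr_gt0 exprn_gt0. Qed.

Lemma scale_le1 m : scale m <= 1.
Proof. by rewrite invf_le1 ?exprn_gt0// exprn_ege1// ler1n. Qed.

Lemma scale_small (e : R) : 0 < e -> exists M, forall m, (M <= m)%N -> scale m < e.
Proof.
move=> e0; exists (Num.truncn e^-1).+1 => m Mm.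
rewrite -[X in _ < X]invrK ltf_pV2 ?posrE ?exprn_gt0 ?invr_gt0//.
apply: (lt_le_trans (truncnS_gt _)).
by rewrite -natrX ler_nat (leq_trans Mm)// ltnW// ltn_expl.
Qed.

Lemma ctile_sub_ball (x : heis R) (e : R) : 0 < e -> exists2 d, 0 < d &
  forall rho k v, 0 < rho < d -> ctile rho k x -> ctile rho k v ->
   [/\ `|v.1.1 - x.1.1| < e, `|v.1.2 - x.1.2| < e & `|v.2 - x.2| < e].
Proof.
(* The height varies by at most [rho] within the sheared window and by $2\rho(|A|+|B|)$ through the
   slope. Since $|A| \le |x|+1$ and $|B| \le |y|+1$ for the corner, the sum is at most [rho * K]. *)
case: x => [[x y] z] e0 /=; pose K := 5 + 2 * (`|x| + `|y|).
have K5 : 5 <= K by rewrite lerDl mulr_ge0// addr_ge0.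
have K0 : 0 < K by apply: lt_le_trans K5.
exists (Num.min 1 (e / K)); first by rewrite lt_min ltr01 divr_gt0.
move=> rho [[a b] c] [[x' y'] z'] /andP[r0]; rewrite lt_min ltr_pdivlMr// => /andP[r1 rK].
have mD (i : int) (s : R) : (i + 1)%:~R * s = i%:~R * s + s.
  by rewrite intrD mulrDl mul1r.
rewrite /tile /sbox /shear /= !in_itv /= !mD.
set A := a%:~R * rho; set B := b%:~R * rho; set C := c%:~R * rho ^+ 2.
move=> [/andP[a1 a2] /andP[b1 b2] /andP[c1 c2]] [/andP[a3 a4] /andP[b3 b4] /andP[c3 c4]].
have hX : `|x' - x| <= rho by rewrite ler_norml; apply/andP; split; lra.
have hY : `|y' - y| <= rho by rewrite ler_norml; apply/andP; split; lra.
have hA : `|A| <= `|x| + 1.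
  have : `|A - x| <= rho by rewrite ler_norml; apply/andP; split; lra.
  have := ler_normD x (A - x); rewrite addrC subrK; lra.
have hB : `|B| <= `|y| + 1.
  have : `|B - y| <= rho by rewrite ler_norml; apply/andP; split; lra.
  have := ler_normD y (B - y); rewrite addrC subrK; lra.
have re : rho < e.
  by apply: le_lt_trans rK; rewrite ler_peMr ?(ltW r0)//; lra.
split; [exact: le_lt_trans re|exact: le_lt_trans re|].
apply: le_lt_trans rK.
have -> : z' - z = (z' - 2 * (A * y' - B * x') - (z - 2 * (A * y - B * x))) +
   2 * (A * (y' - y) - B * (x' - x)) by ring.
have h1 : `|z' - 2 * (A * y' - B * x') - (z - 2 * (A * y - B * x))| <= rho * 1.
  apply: (@le_trans _ _ (rho ^+ 2)); last by rewrite expr2 ler_pM2l// ltW.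
  by rewrite ler_norml; apply/andP; split; lra.
have h2 : `|2 * (A * (y' - y) - B * (x' - x))| <= rho * (2 * (`|x| + 1 + (`|y| + 1))).
  have h3 : `|A * (y' - y)| <= rho * (`|x| + 1) by rewrite normrM mulrC ler_pM.
  have h4 : `|B * (x' - x)| <= rho * (`|y| + 1) by rewrite normrM mulrC ler_pM.
  rewrite normrM ger0_norm//; have := ler_normB (A * (y' - y)) (B * (x' - x)).
  lra.
apply: (le_trans (ler_normD _ _)); apply: (le_trans (lerD h1 h2)).
by rewrite -mulrDr ler_pM2l// /K; lra.
Qed.

Lemma open_ctile A (x : heis R) : open (A : set (R * R * R)%type) -> A x ->
  exists M, forall m, (M <= m)%N -> ctile (scale m) (tile_index (scale m) x) `<=` A.
Proof.
move=> oA Ax; have /nbhs_ballP [e /= e0 eA] := open_nbhs_nbhs (conj oA Ax).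
have [d d0 dP] := ctile_sub_ball x e0; have [M MP] := scale_small d0.
exists M => m Mm v vT.
have xT := htile_ctile (htile_index x (scale_gt0 m)).
have [] := dP (scale m) _ _ _ xT vT; first by rewrite scale_gt0 MP.
move=> h1 h2 h3; apply: eA.
by split; [split|]; rewrite /= /ball /= distrC.
Qed.

Lemma sum_leb3_tiles A rho s : measurable A -> 0 < rho -> uniq s ->
  (\sum_(k <- s) leb3 (A `&` htile rho k) <= leb3 A)%E.
Proof.
move=> mA r0; elim: s A mA => [|k s IH] A mA /=; first by rewrite big_nil measure_ge0.
move=> /andP[ks us]; rewrite big_cons (measureDI leb3 mA (measurable_tile true true rho k)).
rewrite addeC leeD2r//.
have mD : measurable (A `\` htile rho k) by apply: measurableD => //; exact: measurable_tile.
apply: le_trans (IH _ mD us).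
rewrite big_seq [leRHS]big_seq; apply: lee_sum => l ls.
apply: le_measure; rewrite ?inE.
- by apply: measurableI => //; exact: measurable_tile.
- by apply: measurableI => //; exact: measurable_tile.
move=> p [Ap Tp]; split=> //; split=> // Tk.
by move: ks; rewrite (htile_uniq r0 Tk) -(htile_uniq r0 Tp) ls.
Qed.

Lemma cvg_ereal_gt (u : nat -> \bar R) (l a : \bar R) : u @ \oo --> l -> (a < l)%E ->
  exists M, (a < u M)%E.
Proof.
move=> ul al.
have : nbhs l [set y | (a < y)%E].
  by apply: open_nbhs_nbhs; split => //; exact: open_ereal_gt_ereal.
by move=> /ul [M _ /(_ M (leqnn M))] h; exists M.
Qed.

(** The union [U m] of the tiles of size [scale m] inside [A] need not increase with [m]. The sets
    [V M] of points that are covered at every scale from [M] on do increase to [A]. Continuity of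
    the measure then selects one scale, and a second time finitely many tiles of it. *)
Lemma open_inner_tiles A (e : R) : open (A : set (R * R * R)%type) -> measurable A ->
  (leb3 A < +oo)%E -> 0 < e -> exists m s,
  [/\ uniq s, forall k, k \in s -> ctile (scale m) k `<=` A &
      fine (leb3 A) - e <= \sum_(k <- s) scale m ^+ 4].
Proof.
move=> oA mA Aoo e0.
pose good m k := `[<ctile (scale m) k `<=` A>].
pose F m i : set (heis R) := if pickle_inv i is Some k then
  (if good m k then htile (scale m) k else set0) else set0.
have mF m i : measurable (F m i).
  by rewrite /F; case: pickle_inv => [k|//]; case: ifP => // _; exact: measurable_tile.
pose U m := \bigcup_i F m i.
have mU m : measurable (U m) by exact: bigcup_measurable.
have UA m : U m `<=` A.
  move=> x [i _]; rewrite /F; case: pickle_inv => [k|//].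
  by case: ifP => // /asboolP h /htile_ctile /h.
pose V M := \bigcap_(m in [set m | (M <= m)%N]) U m.
have mV M : measurable (V M) by apply: bigcap_measurableType => // k _; exact: mU.
have VA : \bigcup_M V M = A.
  apply/seteqP; split => [x [M _ /(_ M (leqnn M)) h]|x Ax]; first exact: (UA M).
  have [M MP] := open_ctile oA Ax; exists M => // m /= Mm.
  exists (pickle (tile_index (scale m) x)); first exact: I.
  rewrite /F pickleK_inv.
  by rewrite ifT; [exact: (htile_index _ (scale_gt0 m))|exact/asboolP/MP].
have e20 : 0 < e / 2 by rewrite divr_gt0.
have Afin : leb3 A \is a fin_num by rewrite ge0_fin_numE.
have ltA : ((fine (leb3 A) - e / 2)%:E < leb3 A)%E.
  by rewrite -{2}(fineK Afin) lte_fin ltrBlDr ltrDl.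
have [M MP] : exists M, ((fine (leb3 A) - e / 2)%:E < leb3 (V M))%E.
  have cv : leb3 \o V @ \oo --> leb3 A.
    rewrite -VA; apply: nondecreasing_cvg_mu => //; first by rewrite VA.
    move=> i j ij; apply/subsetPset => x Vx m /= jm; apply: Vx => /=.
    exact: leq_trans jm.
  exact: cvg_ereal_gt cv ltA.
have VU : (leb3 (V M) <= leb3 (U M))%E.
  by apply: le_measure; rewrite ?inE //; move=> x; apply => /=.
pose G n := \big[setU/set0]_(i < n) F M i.
have mG n : measurable (G n) by apply: bigsetU_measurable => i _; exact: mF.
have GU : \bigcup_n G n = U M.
  apply/seteqP; split => x [i _]; rewrite /G.
    by rewrite -bigcup_mkord => -[j /= _ Fx]; exists j; first exact: I.
  move=> Fx; exists i.+1; first exact: I.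
  by rewrite -bigcup_mkord; exists i => /=.
have Ufin : leb3 (U M) \is a fin_num.
  rewrite ge0_fin_numE//; apply: le_lt_trans Aoo.
  by apply: le_measure; rewrite ?inE.
have [n nP] : exists n, ((fine (leb3 A) - e)%:E < leb3 (G n))%E.
  have cv : leb3 \o G @ \oo --> leb3 (U M).
    rewrite -GU; apply: nondecreasing_cvg_mu => //; first by rewrite GU.
    move=> i j ij; apply/subsetPset; exact: subset_bigsetU.
  apply: cvg_ereal_gt cv _; apply: lt_le_trans VU; apply: le_lt_trans MP.
  by rewrite lee_fin lerD2l lerN2; lra.
exists M, [seq k <- pmap (@pickle_inv (int * int * int)%type) (iota 0 n) | good M k].
split.
- by rewrite filter_uniq// (pmap_uniq (@pickle_invK _))// iota_uniq.
- by move=> k; rewrite mem_filter => /andP[/asboolP].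
rewrite -lee_fin; apply: (le_trans (ltW nP)).
rewrite /G -(big_mkord xpredT (F M)) /index_iota subn0.
elim: (iota 0 n) => [|i l IH]; first by rewrite !big_nil measure0.
rewrite big_cons; apply: (le_trans (measureU2 _ _ _)) => //.
  by apply: bigsetU_measurable => j _; exact: mF.
apply: (le_trans (leeD2l _ IH)); rewrite /F /=.
case: pickle_inv => [k|] /=; last by rewrite measure0 add0e.
case: ifP => _; last by rewrite measure0 add0e.
by rewrite big_cons leb3_tile ?(ltW (scale_gt0 _)).
Qed.

End Approximation.

(** * Cores of rectangles and their Frostman bound *)

Section PowR.
Context {R : realType}.
Implicit Types (a s t u : R).

Lemma powR_gt0D u s t : 0 < u -> u `^ (s + t) = u `^ s * u `^ t.
Proof. by move=> u0; rewrite powRD//; apply/implyP => _; rewrite gt_eqF. Qed.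

Lemma powR_splitn (n : nat) u t : 0 < u -> u `^ t = u ^+ n * u `^ (t - n%:R).
Proof.
by move=> u0; rewrite -powR_mulrn ?ltW// -powR_gt0D//; congr (_ `^ _); ring.
Qed.

Lemma powR_div u a s : 0 < u -> 0 < a -> (u / a) `^ s = u `^ s / a `^ s.
Proof.
move=> u0 a0; rewrite powRM ?invr_ge0 ?ltW//; congr (_ * _).
by rewrite -powR_inv1 ?ltW// -powRrM mulN1r powRN.
Qed.

Lemma powR_ge1 u s : 1 <= u -> 0 <= s -> 1 <= u `^ s.
Proof. by move=> u1 s0; rewrite -(powRr0 u); exact: ler_powR. Qed.

Lemma expr_le_powR u s (n : nat) : 0 < u <= 1 -> s <= n%:R -> u ^+ n <= u `^ s.
Proof.
move=> u01 sn; rewrite -powR_mulrn; last by case/andP: u01 => /ltW.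
exact: ger_powR.
Qed.

End PowR.

Section SingularValue.
Context {R : realType}.
Implicit Types (t rho c : R) (r : R * R).

(** Every case becomes a product of powers of dilation-invariant ratios. The scaling law, the
    Frostman bound and the covering estimate are all read off from this form. *)
Lemma Phi_ratio t r rho : 0 < r.1 -> 0 < r.2 -> 0 < rho ->
  rho `^ t / Phi t r =
  if r.1 <= r.2 then
    if t <= 2 then (rho / r.2) `^ t else (rho / r.2) ^+ 2 * (rho / r.1) `^ (t - 2)
  else
    if t <= 3 then (rho / r.1) `^ t
    else (rho / r.1) ^+ 3 * (rho * r.1 / r.2 ^+ 2) `^ (t - 3).
Proof.
move=> r10 r20 h0; have r22 : 0 < r.2 ^+ 2 by rewrite exprn_gt0.
have n1 : r.1 != 0 by rewrite gt_eqF.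
have n2 : r.2 != 0 by rewrite gt_eqF.
rewrite /Phi; case: ifP => _; case: ifP => _.
- by rewrite powR_div.
- rewrite powR_div// (powR_splitn 2 t h0).
  have := powR_gt0 (t - 2) r10; move: (r.1 `^ _) (rho `^ _) => a b a0.
  by field; rewrite n2 gt_eqF.
- by rewrite powR_div.
- rewrite powR_div ?mulr_gt0// powRM ?ltW// (powR_splitn 3 t h0).
  rewrite (_ : 6 - t = 3 - (t - 3)); last by ring.
  rewrite (@powRB _ r.1); last by apply/implyP => _; exact: n1.
  rewrite (powR_mulrn 3) ?ltW// powRrM (powR_mulrn 2) ?ltW//.
  have := powR_gt0 (t - 3) r10; have := powR_gt0 (t - 3) r22.
  move: (r.1 `^ _) (rho `^ _) ((r.2 ^+ 2) `^ _) => a b d d0 a0.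
  by field; rewrite n1 !gt_eqF.
Qed.

Lemma Phi_gt0 t r : 0 < r.1 -> 0 < r.2 -> 0 < Phi t r.
Proof.
by move=> r10 r20; rewrite /Phi; do 2 case: ifP => _; rewrite ?mulr_gt0 ?powR_gt0 ?exprn_gt0.
Qed.

Lemma Phi_scale t c r : 0 < c -> 0 < r.1 -> 0 < r.2 ->
  Phi t (c * r.1, c * r.2) = c `^ t * Phi t r.
Proof.
(* Size [c] against the dilated pair and size 1 against the original pair give the same ratios. *)
move=> c0 r10 r20; have := @Phi_ratio t (c * r.1, c * r.2) c.
have := @Phi_ratio t r 1 r10 r20 ltr01 => /= E1.
rewrite !mulr_gt0// => /(_ isT isT c0); rewrite ler_pM2l//.
have -> : c / (c * r.2) = 1 / r.2 by field; rewrite !gt_eqF.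
have -> : c / (c * r.1) = 1 / r.1 by field; rewrite !gt_eqF.
have -> : c * (c * r.1) / (c * r.2) ^+ 2 = 1 * r.1 / r.2 ^+ 2.
  by field; rewrite !gt_eqF.
rewrite -E1 powR1 mul1r => E2.
have P1 := Phi_gt0 t r10 r20.
have P2 : 0 < Phi t (c * r.1, c * r.2) by apply: Phi_gt0; rewrite mulr_gt0.
have nP1 : Phi t r != 0 by rewrite gt_eqF.
have nP2 : Phi t (c * r.1, c * r.2) != 0 by rewrite gt_eqF.
by rewrite -(divfK nP2 (c `^ t)) E2 mulrAC mulVf// mul1r.
Qed.

(** [V] stands for the volume of a core inside a tile, bounded in four ways. A ratio that is at
    least 1 has powers at least 1; for a ratio at most 1 the exponent is raised to the end of its
    range (total degree 2, 3 or 4), where one of the four bounds applies. The constant 64 is $4^3$: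
    if [rho] exceeds [r.1 / 4], the third power of [rho / r.1] is at least $1/64$ and the volume of
    the core itself suffices. *)
Lemma Phi_frostman t r rho (V : R) : 0 < r.1 -> 0 < r.2 -> 0 < rho ->
  0 <= t <= 4 ->
  V <= r.1 ^+ 2 * r.2 ^+ 2 / 2 -> V <= rho ^+ 4 -> V <= r.1 ^+ 2 * rho ^+ 2 / 4 ->
  (rho <= r.1 / 4 -> V <= 8 * rho ^+ 3 * r.2 ^+ 2 / r.1) ->
  V <= 64 * (rho `^ t / Phi t r) * (r.1 ^+ 2 * r.2 ^+ 2 / 2).
Proof.
case: r => r1 r2 /= r10 r20 h0 /andP[t0 t4] V0 V1 V2 V3.
have n1 : r1 != 0 by rewrite gt_eqF.
have n2 : r2 != 0 by rewrite gt_eqF.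
rewrite Phi_ratio//=.
set Q := r1 ^+ 2 * r2 ^+ 2 / 2 in V0 *.
have Q0 : 0 < Q by rewrite /Q divr_gt0// mulr_gt0 ?exprn_gt0.
have use (a b : R) : V <= 64 * a * Q -> a <= b -> V <= 64 * b * Q.
  by move=> h ab; apply: (le_trans h); rewrite ler_pM2r// ler_pM2l.
have big b : 1 / 64 <= b -> V <= 64 * b * Q.
  by apply: use; rewrite mul1r divff ?mul1r// pnatr_eq0.
have div_gt1 (r : R) : 0 < r -> r <= rho -> 1 <= rho / r by move=> ? ?; rewrite ler_pdivlMr// mul1r.
have div_lt1 (r : R) : 0 < r -> rho <= r -> 0 < rho / r <= 1.
  by move=> ? ?; rewrite divr_gt0//= ler_pdivrMr// mul1r.
have q1 : rho / r1 <= 1 -> 64 * (rho / r1) ^+ 3 * Q >= V.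
  move=> u1; have [h|h] := leP rho (r1 / 4).
    apply: (le_trans (V3 h)).
    have -> : 64 * (rho / r1) ^+ 3 * Q = 32 * rho ^+ 3 * r2 ^+ 2 / r1.
      by rewrite /Q; field.
    have : 0 < rho ^+ 3 * r2 ^+ 2 / r1 by rewrite divr_gt0 ?mulr_gt0 ?exprn_gt0.
    lra.
  apply: big.
  have : 1 / 4 <= rho / r1 by rewrite ler_pdivlMr//; move: h; rewrite mul1r mulrC => /ltW.
  move=> /(@lerXn2r _ 3); rewrite !nnegrE => /(_ _ _) h3.
  by apply: le_trans (h3 _ _); [lra| |rewrite divr_ge0 ?ltW].
have q3 : 64 * ((rho / r1) ^+ 3 * (rho * r1 / r2 ^+ 2)) * Q >= V.
  have -> : 64 * ((rho / r1) ^+ 3 * (rho * r1 / r2 ^+ 2)) * Q = 32 * rho ^+ 4.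
    by rewrite /Q; field; rewrite n1 n2.
  have : 0 < rho ^+ 4 by rewrite exprn_gt0.
  lra.
case: ifPn => [r12|_]; case: ifPn => t2; rewrite -?ltNge in t2.
- have [h|/ltW h] := leP r2 rho.
    by apply: big; have := powR_ge1 (div_gt1 _ r20 h) t0; lra.
  apply: use (expr_le_powR (div_lt1 _ r20 h) t2).
  have -> : 64 * (rho / r2) ^+ 2 * Q = 32 * (r1 ^+ 2 * rho ^+ 2) by rewrite /Q; field.
  have : 0 < r1 ^+ 2 * rho ^+ 2 by rewrite mulr_gt0 ?exprn_gt0.
  lra.
- have s2 : t - 2 <= 2%:R by lra.
  have s0 : 0 <= t - 2 by lra.
  have p2 : 0 <= (rho / r2) ^+ 2 by rewrite sqr_ge0.
  have [h|/ltW h] := leP r1 rho.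
    apply: use (ler_wpM2l p2 (powR_ge1 (div_gt1 _ r10 h) s0)).
    have -> : 64 * ((rho / r2) ^+ 2 * 1) * Q = 32 * (r1 ^+ 2 * rho ^+ 2) by rewrite /Q; field.
    have : 0 < r1 ^+ 2 * rho ^+ 2 by rewrite mulr_gt0 ?exprn_gt0.
    lra.
  apply: use (ler_wpM2l p2 (expr_le_powR (div_lt1 _ r10 h) s2)).
  have -> : 64 * ((rho / r2) ^+ 2 * (rho / r1) ^+ 2) * Q = 32 * rho ^+ 4.
    by rewrite /Q; field; rewrite n1 n2.
  have : 0 < rho ^+ 4 by rewrite exprn_gt0.
  lra.
- have [h|/ltW h] := leP r1 rho.
    by apply: big; have := powR_ge1 (div_gt1 _ r10 h) t0; lra.
  have u1 := div_lt1 _ r10 h.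
  by apply: use (expr_le_powR u1 t2); apply: q1; case/andP: u1.
- have s1 : t - 3 <= 1%:R by lra.
  have s0 : 0 <= t - 3 by lra.
  have p3 : 0 <= (rho / r1) ^+ 3 by rewrite exprn_ge0// divr_ge0 ?ltW.
  have [h|/ltW h] := leP 1 (rho * r1 / r2 ^+ 2).
    have u := powR_ge1 h s0.
    have [h1|/ltW h1] := leP r1 rho.
      apply: big; have := mulr_ege1 (exprn_ege1 3 (div_gt1 _ r10 h1)) u; lra.
    have /andP[_ u1] := div_lt1 _ r10 h1.
    by apply: use (ler_wpM2l p3 u); rewrite mulr1; exact: q1.
  have u01 : 0 < rho * r1 / r2 ^+ 2 <= 1 by rewrite h divr_gt0 ?mulr_gt0 ?exprn_gt0.
  by apply: use (ler_wpM2l p3 (expr_le_powR u01 s1)).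
Qed.

End SingularValue.

Section Core.
Context {R : realType}.
Implicit Types (p w : heis R) (r : R * R) (rho : R) (k : int * int * int).

(* An off-centre part of the open rectangle: near the vertical axis through [w]
   the set is too horizontal for the [rho^3] bound of [core_frostman]. *)
Definition core w r : set (heis R) :=
  sbox false true w.1.1 w.1.2 (w.1.1 + r.1 / 2) (w.1.1 + 3 * r.1 / 4)
    (w.1.2 - r.1 / 2) (w.1.2 + r.1 / 2) (w.2 - r.2 ^+ 2) (w.2 + r.2 ^+ 2).

Lemma core_hrectangle w r : core w r `<=` hrectangle w r.
Proof.
case: w => [[x y] z] [[x' y'] z'] []; rewrite /shear /= !in_itv /=.
move=> /andP[x1 x2] /andP[y1 y2] /andP[z1 z2]; split; last first.
  by rewrite ler_norml; apply/andP; split; lra.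
have r0 : 0 < r.1 by lra.
have hX : (x' - x) ^+ 2 <= (3 * r.1 / 4) ^+ 2.
  by rewrite ler_pXn2r// ?nnegrE; lra.
have hY : (y' - y) ^+ 2 <= (r.1 / 2) ^+ 2.
  have hy : `|y' - y| <= r.1 / 2 by rewrite ler_norml; apply/andP; split; lra.
  by rewrite -[X in X <= _]real_normK ?num_real// ler_pXn2r// nnegrE; lra.
apply: (le_trans (lerD hX hY)); rewrite -subr_ge0.
rewrite (_ : _ - _ = 3 / 16 * r.1 ^+ 2); last by field.
by rewrite mulr_ge0 ?sqr_ge0// divr_ge0.
Qed.

Definition core_volume r : R := r.1 ^+ 2 * r.2 ^+ 2 / 2.

Lemma core_volume_gt0 r : 0 < r.1 -> 0 < r.2 -> 0 < core_volume r.
Proof. by move=> ? ?; rewrite divr_gt0// mulr_gt0// exprn_gt0. Qed.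

Lemma leb3_core w r : 0 < r.1 -> 0 < r.2 -> leb3 (core w r) = (core_volume r)%:E.
Proof.
move=> r10 r20; have := exprn_gt0 2 r20 => r2.
rewrite leb3_sbox; [|lra..].
by rewrite /core_volume; congr EFin; field.
Qed.

(** Whether [w] lies in [core p r] depends only on $p^{-1}w$. Inversion negates the coordinates, so
    the admissible centres fill the reflected box at [w], which has the volume of a core. This makes
    the probability of hitting a point independent of the point. *)
Lemma coreC w r : [set p | core p r w] =
  sbox false true w.1.1 w.1.2 (w.1.1 - 3 * r.1 / 4) (w.1.1 - r.1 / 2)
    (w.1.2 - r.1 / 2) (w.1.2 + r.1 / 2) (w.2 - r.2 ^+ 2) (w.2 + r.2 ^+ 2).
Proof.
apply/seteqP; split => -[[x y] z]; case: w => [[x' y'] z'] [];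
  rewrite /shear /= !in_itv /= => /andP[x1 x2] /andP[y1 y2] /andP[z1 z2];
  by split; rewrite /shear /= in_itv /=; apply/andP; split; lra.
Qed.

Lemma leb3_coreC w r : 0 < r.1 -> 0 < r.2 ->
  leb3 [set p | core p r w] = (core_volume r)%:E.
Proof.
move=> r10 r20; have := exprn_gt0 2 r20 => r2.
rewrite coreC leb3_sbox; [|lra..].
by rewrite /core_volume; congr EFin; field.
Qed.

Lemma measurable_core w r : measurable (core w r).
Proof. exact: measurable_sbox. Qed.

Lemma measurable_coreC w r : measurable [set p | core p r w].
Proof. by rewrite coreC; exact: measurable_sbox. Qed.

Lemma measurable_core_tile w r rho k : measurable (core w r `&` htile rho k).
Proof. by apply: measurableI; [exact: measurable_core|exact: measurable_tile]. Qed.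

Lemma measurable_affine (a b : R) : measurable_fun setT (fun x : R => a * x + b).
Proof.
apply: measurable_funD; last exact: measurable_cst.
by apply: measurable_funM; [exact: measurable_cst|exact: measurable_id].
Qed.

(** The horizontal extent, [r.1 / 4] by [r.1], comes from the core and the height window from the
    tile. *)
Lemma core_tile_le2 w r rho k : 0 < r.1 -> 0 < rho ->
  (leb3 (core w r `&` htile rho k) <= (r.1 ^+ 2 * rho ^+ 2 / 4)%:E)%E.
Proof.
move=> r10 r0.
have -> : r.1 ^+ 2 * rho ^+ 2 / 4 =
  ((w.1.1 + 3 * r.1 / 4) - (w.1.1 + r.1 / 2)) * r.1 * rho ^+ 2 by field.
case: w => [[x y] z]; case: k => [[a b] c].
apply: (@leb3_le_fibres _ _ _ _ (fun=> y - r.1 / 2)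
  (fun x y => c%:~R * rho ^+ 2 + 2 * (a%:~R * rho * y - b%:~R * rho * x))) => //.
- exact: measurable_core_tile.
- exact: ltW.
- by rewrite exprn_ge0// ltW.
- rewrite /=; lra.
have mD (i : int) (s : R) : (i + 1)%:~R * s = i%:~R * s + s.
  by rewrite intrD mulrDl mul1r.
move=> [[x' y'] z'] [[]]; rewrite /shear /= !in_itv /=.
move=> /andP[x1 x2] /andP[y1 y2] _ [_ _]; rewrite /shear /= in_itv /= mD => /andP[z1 z2].
by split; apply/andP; split; lra.
Qed.

(** This is where the core must be off-centre. Subtracting the two sheared height constraints leaves
    a linear condition on the horizontal coordinates, in which [y] has the coefficient [be], twice
    the x-offset of the tile corner from the axis of the rectangle. As [be] is at least [r.1 / 2],
    this confines [y] to a window of length [Y] for each fixed [x]. The height window is the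
    narrower of the two available ones. *)
Lemma core_tile_le3 w r rho k : 0 < r.1 -> 0 < r.2 -> 0 < rho -> rho <= r.1 / 4 ->
  (leb3 (core w r `&` htile rho k) <= (8 * rho ^+ 3 * r.2 ^+ 2 / r.1)%:E)%E.
Proof.
move=> r10 r20 r0 rr.
have [->|/set0P[p0 p0S]] := eqVneq (core w r `&` htile rho k) set0.
  by rewrite measure0 lee_fin divr_ge0 ?mulr_ge0 ?exprn_ge0 ?ltW.
have n1 : r.1 != 0 by rewrite gt_eqF.
have mD (i : int) (s : R) : (i + 1)%:~R * s = i%:~R * s + s.
  by rewrite intrD mulrDl mul1r.
case: w p0S => [[x y] z]; case: k => [[a b] c] p0S.
pose A := a%:~R * rho; pose B := b%:~R * rho; pose C := c%:~R * rho ^+ 2.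
pose be := 2 * (A - x).
(* A common point is more than [r.1 / 2] to the right of the axis, and the corner is at most
   [rho <= r.1 / 4] to the left of that point. *)
have be_ge : r.1 / 2 <= be.
  case: p0 p0S => [[x' y'] z'] [[]]; rewrite /shear /= !in_itv /= => /andP[x1 x2] _ _.
  by case; rewrite /shear /= !in_itv /= mD => /andP[x3 x4] _ _; rewrite /be /A; lra.
have be0 : 0 < be by lra.
have nbe : be != 0 by rewrite gt_eqF.
have h2 : 0 < rho ^+ 2 by rewrite exprn_gt0.
have r22 : 0 < r.2 ^+ 2 by rewrite exprn_gt0.
pose Y := (rho ^+ 2 + 2 * r.2 ^+ 2) / be.
have Y0 : 0 <= Y by rewrite divr_ge0 ?ltW//; lra.
pose J x1 : R := ((2 * (B - y)) / be) * x1 + (z - C - rho ^+ 2 - r.2 ^+ 2) / be.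
have JE x1 : J x1 = (z + 2 * (B - y) * x1 - C - rho ^+ 2 - r.2 ^+ 2) / be.
  by rewrite /J; field.
have JYE x1 : J x1 + Y = (z + 2 * (B - y) * x1 - C + r.2 ^+ 2) / be.
  by rewrite JE /Y; field.
have S_J p : (core (x, y, z) r `&` htile rho (a, b, c)) p ->
    A <= p.1.1 <= A + rho /\ J p.1.1 <= p.1.2 <= J p.1.1 + Y.
  case: p => [[x' y'] z'] [[]]; rewrite /shear /= !in_itv /= => _ _ /andP[z1 z2].
  case; rewrite /shear /= !in_itv /= !mD => /andP[x3 x4] _ /andP[z3 z4].
  split; first by apply/andP; split; [|exact: ltW].
  rewrite JYE JE ler_pdivlMr// ler_pdivrMr//; apply/andP; split; rewrite /be /A /B /C; lra.
have bound m : 0 <= m -> m <= rho ^+ 2 -> m <= 2 * r.2 ^+ 2 ->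
    (m = rho ^+ 2 \/ m = 2 * r.2 ^+ 2) ->
    (((A + rho - A) * Y * m)%:E <= (8 * rho ^+ 3 * r.2 ^+ 2 / r.1)%:E)%E.
  move=> m0 m1 m2 me; rewrite lee_fin.
  (* The smaller of the two window lengths times their sum is at most twice their product. *)
  have h : m * (rho ^+ 2 + 2 * r.2 ^+ 2) <= 4 * rho ^+ 2 * r.2 ^+ 2.
    have : 0 <= rho ^+ 2 * r.2 ^+ 2 by rewrite mulr_ge0 ?ltW.
    have hh (s t : R) : 0 <= s -> s <= t -> s * s <= s * t by move=> ? ?; exact: ler_wpM2l.
    by case: me => em; [have := hh _ _ m0 m2|have := hh _ _ m0 m1]; rewrite em; lra.
  have -> : (A + rho - A) * Y * m = rho * (m * (rho ^+ 2 + 2 * r.2 ^+ 2)) / be.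
    by rewrite /Y; field.
  rewrite ler_pdivrMr//.
  have -> : 8 * rho ^+ 3 * r.2 ^+ 2 / r.1 * be = rho * (4 * rho ^+ 2 * r.2 ^+ 2 * (be / (r.1 / 2))).
    by field.
  rewrite ler_pM2l//; apply: (le_trans h); rewrite ler_peMr//.
    by rewrite !mulr_ge0 ?ltW.
  by rewrite ler_pdivlMr ?mul1r// divr_gt0.
have [hm|/ltW hm] := leP (rho ^+ 2) (2 * r.2 ^+ 2).
  apply: le_trans (bound (rho ^+ 2) _ _ _ _) => //; [|exact: ltW|by left].
  apply: (@leb3_le_fibres _ _ _ _ J
    (fun x y => c%:~R * rho ^+ 2 + 2 * (a%:~R * rho * y - b%:~R * rho * x))) => //.
  - exact: measurable_core_tile.
  - exact: ltW.
  - by rewrite lerDl ltW.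
  - exact: measurable_affine.
  move=> p pS; have [h1 h3] := S_J _ pS; split=> //.
  case: p {h1 h3} pS => [[x' y'] z'] [_ []]; rewrite /shear /= !in_itv /= !mD => _ _ /andP[z3 z4].
  by apply/andP; split; lra.
apply: le_trans (bound (2 * r.2 ^+ 2) _ _ _ _) => //; [|lra|by right].
apply: (@leb3_le_fibres _ _ _ _ J
    (fun x' y' => z - r.2 ^+ 2 + 2 * (x * y' - y * x'))) => //.
- exact: measurable_core_tile.
- lra.
- by rewrite lerDl ltW.
- exact: measurable_affine.
move=> p pS; have [h1 h3] := S_J _ pS; split=> //.
case: p {h1 h3} pS => [[x' y'] z'] [[]]; rewrite /shear /= !in_itv /= => _ _ /andP[z3 z4] _.
by apply/andP; split; lra.
Qed.

Lemma core_frostman t w r rho k : 0 < r.1 -> 0 < r.2 -> 0 < rho -> 0 <= t <= 4 ->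
  (leb3 (core w r `&` htile rho k) <=
   (64 * (rho `^ t / Phi t r) * core_volume r)%:E)%E.
Proof.
move=> r10 r20 r0 t04.
have mc := measurable_core_tile w r rho k.
have le1 : (leb3 (core w r `&` htile rho k) <= (core_volume r)%:E)%E.
  rewrite -(leb3_core w r10 r20); apply: le_measure; rewrite ?inE//.
  exact: measurable_core.
have fin : leb3 (core w r `&` htile rho k) \is a fin_num.
  by rewrite ge0_fin_numE//; apply: le_lt_trans le1 _; exact: ltry.
rewrite -(fineK fin) lee_fin; apply: Phi_frostman => //.
- by rewrite -lee_fin fineK.
- rewrite -lee_fin fineK// -(leb3_tile true true k (ltW r0)); apply: le_measure; rewrite ?inE//.
  exact: measurable_tile.
- by rewrite -lee_fin fineK//; exact: core_tile_le2.
- by move=> h; rewrite -lee_fin fineK//; exact: core_tile_le3.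
Qed.

End Core.

(** * Second moments of random densities *)

Section Tonelli.
Context d1 d2 (T1 : measurableType d1) (T2 : measurableType d2) (R : realType).
Context (m1 : {sigma_finite_measure set T1 -> \bar R})
        (m2 : {sigma_finite_measure set T2 -> \bar R}).

(** The mean size of a random set is computed point by point: every [y] in [D] is captured with the
    same measure [c]. *)
Lemma integral_xsection_const (Z : set (T1 * T2)) (D : set T2) (c : \bar R) :
  measurable Z -> measurable D -> (0 <= c)%E -> (forall p, Z p -> D p.2) ->
  (forall y, D y -> m1 (ysection Z y) = c) ->
  (\int[m1]_x m2 (xsection Z x) = c * m2 D)%E.
Proof.
move=> mZ mD c0 ZD h.
transitivity ((m1 \x m2) Z)%E; first by [].
transitivity ((m1 \x^ m2) Z)%E.
  have H A B : measurable A -> measurable B -> (m1 \x^ m2)%E (A `*` B) = (m1 A * m2 B)%E.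
    by move=> mA mB; rewrite product_measure2E.
  exact: (@product_measure_unique _ _ _ _ _ m1 m2 (m1 \x^ m2)%E H Z mZ).
rewrite /product_measure2.
have m1D : measurable_fun setT (fun u => (\1_D u)%:E : \bar R).
  by apply/measurable_EFinP/measurable_indic.
transitivity (\int[m2]_u (c * (\1_D u)%:E))%E; last first.
  by rewrite ge0_integralZl// integral_indic// setIT.
apply: eq_integral => u _ /=; rewrite indicE.
have [uD|uD] := boolP (u \in D); first by rewrite mule1 h //; rewrite inE in uD.
rewrite mule0 (_ : ysection _ _ = set0) ?measure0//.
apply/seteqP; split => v //; rewrite /ysection /= inE => /ZD /= Du.
by move: uD; rewrite notin_setE; apply.
Qed.

End Tonelli.

Section SecondMoment.
Context d (T : measurableType d) (R : realType) (P : probability T R).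
Context (U : nat -> T -> R) (alpha b : nat -> R) (p : R) (N : nat).
Hypothesis mU : forall n, measurable_fun setT (U n).
Hypothesis U0 : forall n x, 0 <= U n x.
Hypothesis alpha0 : forall n, 0 <= alpha n.
Hypothesis p0 : 0 <= p.
Hypothesis Ub : forall n x, alpha n != 0 -> U n x <= b n.
Hypothesis EU : forall n, alpha n != 0 -> (\int[P]_x (U n x)%:E = p%:E)%E.
Hypothesis EUU : forall n m, alpha n != 0 -> alpha m != 0 -> n != m ->
  (\int[P]_x (U n x * U m x)%:E = (p ^+ 2)%:E)%E.

Let S x := \sum_(n < N) alpha n * U n x.
Let s := p * \sum_(n < N) alpha n.
Let V := \sum_(n < N) alpha n ^+ 2 * b n * p.

Let mS : measurable_fun setT S.
Proof. by apply: measurable_sum => n; apply: measurable_funM. Qed.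

Let S0 x : 0 <= S x.
Proof. by apply: sumr_ge0 => n _; rewrite mulr_ge0. Qed.

Let s0 : 0 <= s.
Proof. by rewrite mulr_ge0// sumr_ge0. Qed.

Let ES : (\int[P]_x (S x)%:E = s%:E)%E.
Proof.
rewrite (eq_integral (fun x => \sum_(n < N) (alpha n * U n x)%:E)%E); last first.
  by move=> x _; rewrite sumEFin.
rewrite ge0_integral_sum//; last 2 first.
- by move=> n; apply/measurable_EFinP; apply: measurable_funM.
- by move=> n x _; rewrite lee_fin mulr_ge0.
rewrite /s mulr_sumr -sumEFin; apply: eq_bigr => n _.
have [->|a0] := eqVneq (alpha n) 0.
  rewrite mulr0; apply: integral0_eq => x _; by rewrite mul0r.
under eq_integral do rewrite EFinM.
rewrite ge0_integralZl_EFin//; last 2 first.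
- by move=> x _; rewrite lee_fin.
- exact/measurable_EFinP.
by rewrite EU// -EFinM mulrC.
Qed.

Let EUU_le n m : (\int[P]_x (alpha n * U n x * (alpha m * U m x))%:E <=
  (alpha n * alpha m * p ^+ 2 + (n == m)%:R * (alpha n ^+ 2 * b n * p))%:E)%E.
Proof.
have [a0|a0] := eqVneq (alpha n) 0.
  rewrite (integral0_eq _) ?a0 ?expr0n /= ?mul0r ?mulr0 ?addr0// => x _.
  by rewrite !mul0r.
have [c0|c0] := eqVneq (alpha m) 0.
  rewrite (integral0_eq _); last by move=> x _; rewrite c0 mul0r mulr0.
  rewrite c0 mulr0 mul0r add0r lee_fin.
  by have [nm|_] := eqVneq n m; rewrite ?mul0r// -c0 nm c0 expr0n /= !mul0r mulr0.
rewrite (eq_integral (fun x => (alpha n * alpha m)%:E * (U n x * U m x)%:E)%E); last first.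
  by move=> x _; rewrite -EFinM; congr EFin; ring.
rewrite ge0_integralZl_EFin ?mulr_ge0//; last 2 first.
- by move=> x _; rewrite lee_fin mulr_ge0.
- by apply/measurable_EFinP; apply: measurable_funM.
have [nm|nm] := eqVneq n m; last by rewrite EUU// mul0r addr0 -EFinM.
rewrite -nm mul1r; apply: (@le_trans _ _ ((alpha n * alpha n)%:E * (b n * p)%:E))%E; last first.
  rewrite -EFinM lee_fin; have := mulr_ge0 (mulr_ge0 (alpha0 n) (alpha0 n)) (sqr_ge0 p).
  by rewrite (expr2 (alpha n)); lra.
apply: lee_wpmul2l; first by rewrite lee_fin mulr_ge0.
have b0 : 0 <= b n by apply: le_trans (U0 n point) (Ub _ a0).
rewrite EFinM -(EU a0) -ge0_integralZl_EFin//; last 2 first.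
- by move=> x _; rewrite lee_fin.
- exact/measurable_EFinP.
apply: ge0_le_integral => //.
- by move=> x _; rewrite lee_fin mulr_ge0.
- by apply/measurable_EFinP; apply: measurable_funM.
- by apply: emeasurable_funM => //; exact/measurable_EFinP.
- by move=> x _; rewrite -EFinM lee_fin ler_wpM2r// Ub.
Qed.

Let ESS : (\int[P]_x (S x ^+ 2)%:E <= (s ^+ 2 + V)%:E)%E.
Proof.
rewrite (eq_integral (fun x => \sum_(n < N) \sum_(m < N)
    (alpha n * U n x * (alpha m * U m x))%:E)%E); last first.
  move=> x _; rewrite /S expr2 mulr_suml -sumEFin; apply: eq_bigr => n _.
  by rewrite mulr_sumr -sumEFin.
have mUU n m : measurable_fun setT (fun x => (alpha n * U n x * (alpha m * U m x))%:E).
  by apply/measurable_EFinP; apply: measurable_funM; apply: measurable_funM.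
have UU0 n m x : (0 <= (alpha n * U n x * (alpha m * U m x))%:E)%E.
  by rewrite lee_fin !mulr_ge0.
rewrite ge0_integral_sum//; last 2 first.
- by move=> n; apply: emeasurable_sum => m.
- by move=> n x _; apply: sume_ge0 => m _.
under eq_bigr do rewrite ge0_integral_sum//.
apply: (@le_trans _ _ (\sum_(n < N) \sum_(m < N)
  (alpha n * alpha m * p ^+ 2 + (val n == val m)%:R * (alpha n ^+ 2 * b n * p))%:E)%E).
  by apply: lee_sum => n _; apply: lee_sum => m _; exact: EUU_le.
under eq_bigr do rewrite sumEFin.
rewrite sumEFin lee_fin.
under eq_bigr do rewrite big_split /=.
rewrite big_split /= lerD//.
  rewrite /s exprMn [(\sum_(n < N) _) ^+ 2]expr2 mulr_suml mulr_sumr.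
  apply: ler_sum => n _; rewrite !mulr_sumr; apply: ler_sum => m _.
  by rewrite mulrC.
rewrite /V; apply: ler_sum => n _; rewrite (bigD1 n)//= eqxx mul1r big1 ?addr0//.
by move=> m mn; rewrite (_ : _ == _ = false) ?mul0r//; apply/negP => /eqP /val_inj nm; move:
  mn; rewrite nm eqxx.
Qed.

(** Pairwise uncorrelated terms suffice. The off-diagonal terms cancel against the squared mean; in
    a diagonal one, a factor [U n] is bounded by [b n] and the other is integrated to [p]. *)
Lemma second_moment_bound : (\int[P]_x ((S x - s) ^+ 2)%:E <= V%:E)%E.
Proof.
(* The expanded square is stated with the cross term moved to the left, so that only nonnegative
   functions are integrated. *)
have E : (\int[P]_x ((S x - s) ^+ 2)%:E + (2 * s)%:E * \int[P]_x (S x)%:E =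
    \int[P]_x (S x ^+ 2)%:E + (s ^+ 2)%:E)%E.
  have S0E x : [set: T] x -> (0 <= (S x)%:E)%E by rewrite lee_fin.
  have mSE : measurable_fun setT (fun x => (S x)%:E) by exact/measurable_EFinP.
  have ss0 : 0 <= 2 * s by rewrite mulr_ge0.
  have mS2 : measurable_fun setT (fun x => (S x ^+ 2)%:E).
    by apply/measurable_EFinP; apply: measurable_funX.
  have mSs : measurable_fun setT (fun x => ((S x - s) ^+ 2)%:E).
    by apply/measurable_EFinP; apply: measurable_funX; apply: measurable_funB.
  have msS : measurable_fun setT (fun x => (2 * s)%:E * (S x)%:E)%E.
    exact: emeasurable_funM.
  have -> : (s ^+ 2)%:E = (\int[P]_x (s ^+ 2)%:E)%E.
    rewrite integral_cst// -[LHS]mule1; congr (_ * _)%E; exact/esym/probability_setT.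
  rewrite -(ge0_integralZl_EFin P measurableT S0E mSE ss0).
  rewrite -[LHS]ge0_integralD//.
  - rewrite -[RHS]ge0_integralD//.
    + by apply: eq_integral => x _; rewrite -EFinM -!EFinD; congr EFin; ring.
    + by move=> x _; rewrite lee_fin sqr_ge0.
    + by move=> x _; rewrite lee_fin sqr_ge0.
  - by move=> x _; rewrite lee_fin sqr_ge0.
  - by move=> x _; rewrite -EFinM lee_fin mulr_ge0.
have fin : (\int[P]_x ((S x - s) ^+ 2)%:E)%E \is a fin_num.
  rewrite ge0_fin_numE; last by apply: integral_ge0 => x _; rewrite lee_fin sqr_ge0.
  apply: (@le_lt_trans _ _ (\int[P]_x (S x ^+ 2)%:E + (s ^+ 2)%:E)%E).
    by rewrite -E leeDl// ES -EFinM lee_fin mulr_ge0// mulr_ge0.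
  by apply: le_lt_trans (leeD2r _ ESS) _; rewrite -EFinD ltry.
have := leeD2r (s ^+ 2)%:E ESS; rewrite -E ES -(fineK fin) -!EFinM -!EFinD !lee_fin.
lra.
Qed.

End SecondMoment.

Lemma measurable_preimage_itv d (T : measurableType d) (R : realType)
    (f : T -> R) (i : interval R) : measurable_fun setT f ->
  measurable [set x | f x \in i].
Proof.
move=> mf; rewrite -[X in measurable X]setTI.
by apply: (mf measurableT [set` i]); exact: measurable_itv.
Qed.

Section SquareMeasure.
Context {R : realType}.

(* Named so that it carries its own sigma-finite structure. *)
Definition leb33 : set (heis R * heis R) -> \bar R := (leb3 \x leb3)%E.

Lemma leb33E (A B : set (heis R)) : measurable A -> measurable B ->
  leb33 (A `*` B) = (leb3 A * leb3 B)%E.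
Proof. exact: product_measure1E. Qed.

HB.instance Definition _ := Measure.on leb33.

Let leb33_sigma_finite : sigma_finite setT leb33.
Proof.
have /sigma_finiteP[F [TF ndF Foo]] := sigma_finiteT (@leb3 R).
exists (fun n => F n `*` F n).
  apply/esym; apply/seteqP; split => // -[x y] _.
  have : [set: heis R] x by []. have : [set: heis R] y by [].
  rewrite TF => -[n _ Fy] [m _ Fx]; exists (maxn n m) => //; split => /=.
  - by move: x Fx; exact/subsetPset/ndF/leq_maxr.
  - by move: y Fy; exact/subsetPset/ndF/leq_maxl.
move=> n; have [mF Fn] := Foo n; split; first exact: measurableX.
by rewrite leb33E// lte_mul_pinfty// ge0_fin_numE.
Qed.
HB.instance Definition _ :=
  Measure_isSigmaFinite.Build _ _ _ leb33 leb33_sigma_finite.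

End SquareMeasure.

Section RandomCores.
Context (R : realType) (W : set (heis R)) (lamW : R).
Hypothesis lamW0 : 0 < lamW.
Hypothesis leb3W : leb3 W = lamW%:E.
Hypothesis mW : measurable W.
Context (P : probability (seq_space (heis R)) R).
Hypothesis P_product : is_infinite_product (hlebesgue_on W) P.
Implicit Types (S A : set (heis R)) (n m : nat) (r : R * R).

Lemma hlebesgue_onE A : hlebesgue_on W A = ((lamW^-1)%:E * leb3 (A `&` W))%E.
Proof. by rewrite /hlebesgue_on -[hlebesgue W]/(leb3 W) leb3W. Qed.

Lemma hlebesgue_onT : hlebesgue_on W setT = 1%E.
Proof. by rewrite hlebesgue_onE setTI leb3W -EFinM mulVf// gt_eqF. Qed.

Lemma P_coord n S : measurable S ->
  P [set w : seq_space (heis R) | S (w n)] = hlebesgue_on W S.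
Proof.
move=> mS; pose B i := if i == n then S else setT.
have := P_product n.+1 (A := B); rewrite (_ : [set w | _] = [set w | S (w n)]).
  move=> ->; last by move=> i; rewrite /B; case: ifP.
  rewrite big_ord_recr /= /B eqxx big1 ?mul1e// => i _.
  by rewrite (ltn_eqF (ltn_ord i)) hlebesgue_onT.
apply/seteqP; split => w /=; first by move=> /(_ n (ltnSn n)); rewrite /B eqxx.
by move=> Sw i _; rewrite /B; case: eqP => [->|].
Qed.

Let P_coord2_lt n m S S' : (n < m)%N -> measurable S -> measurable S' ->
  P [set w : seq_space (heis R) | S (w n) /\ S' (w m)] =
  (hlebesgue_on W S * hlebesgue_on W S')%E.
Proof.
move=> nm mS mS'; pose B i := if i == n then S else if i == m then S' else setT.
have := P_product m.+1 (A := B); rewrite (_ : [set w | _] = [set w | S (w n) /\ S' (w m)]).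
  move=> ->; last by move=> i; rewrite /B; do 2 case: ifP => //.
  rewrite big_ord_recr /= {2}/B gtn_eqF// eqxx; congr (_ * _)%E.
  rewrite (bigD1 (Ordinal nm))//= {1}/B eqxx big1 ?mule1// => i.
  by rewrite -val_eqE /= /B => /negbTE ->; rewrite (ltn_eqF (ltn_ord i)) hlebesgue_onT.
apply/seteqP; split => w /=.
  move=> h; have := h n (ltnW nm); have := h m (ltnSn m); rewrite /B eqxx.
  by rewrite gtn_eqF// eqxx.
by move=> [Sw S'w] i _; rewrite /B; case: eqP => [->|_]//; case: eqP => [->|].
Qed.

Lemma P_coord2 n m S S' : n != m -> measurable S -> measurable S' ->
  P [set w : seq_space (heis R) | S (w n) /\ S' (w m)] =
  (hlebesgue_on W S * hlebesgue_on W S')%E.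
Proof.
rewrite neq_ltn => /orP[nm|mn] mS mS'; first exact: P_coord2_lt.
rewrite muleC -(P_coord2_lt mn mS' mS); congr (P _).
by apply/seteqP; split => w [].
Qed.

Lemma measurable_coord n :
  measurable_fun setT (fun w : seq_space (heis R) => (w n : heis R)).
Proof.
move=> _ Y mY; rewrite setTI; apply: sub_sigma_algebra.
by exists n, Y.
Qed.

Lemma measurable_core_rel r :
  measurable [set p : heis R * heis R | core p.1 r p.2].
Proof.
have -> : [set p : heis R * heis R | core p.1 r p.2] =
  [set p | p.2.1.1 - p.1.1.1 \in itvb false true (r.1 / 2) (3 * r.1 / 4)] `&`
  [set p | p.2.1.2 - p.1.1.2 \in itvb false true (- (r.1 / 2)) (r.1 / 2)] `&`
  [set p | p.2.2 - 2 * (p.1.1.1 * p.2.1.2 - p.1.1.2 * p.2.1.1) - p.1.2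
     \in itvb false true (- r.2 ^+ 2) (r.2 ^+ 2)].
  apply/seteqP; split => -[[[x y] z] [[x' y'] z']]; rewrite /core /sbox /shear /= !in_itv /=.
    by move=> [/andP[? ?] /andP[? ?] /andP[? ?]]; split; [split|]; apply/andP; split; lra.
  by move=> [[/andP[? ?] /andP[? ?]] /andP[? ?]]; split; apply/andP; split; lra.
have m11 : measurable_fun setT (fun p : heis R * heis R => p.1.1.1).
  exact: (measurableT_comp measurable_fst (measurableT_comp measurable_fst measurable_fst)).
have m12 : measurable_fun setT (fun p : heis R * heis R => p.1.1.2).
  exact: (measurableT_comp measurable_snd (measurableT_comp measurable_fst measurable_fst)).
have m13 : measurable_fun setT (fun p : heis R * heis R => p.1.2).
  exact: (measurableT_comp measurable_snd measurable_fst).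
have m21 : measurable_fun setT (fun p : heis R * heis R => p.2.1.1).
  exact: (measurableT_comp measurable_fst (measurableT_comp measurable_fst measurable_snd)).
have m22 : measurable_fun setT (fun p : heis R * heis R => p.2.1.2).
  exact: (measurableT_comp measurable_snd (measurableT_comp measurable_fst measurable_snd)).
have m23 : measurable_fun setT (fun p : heis R * heis R => p.2.2).
  exact: (measurableT_comp measurable_snd measurable_snd).
apply: measurableI; first apply: measurableI; apply: measurable_preimage_itv.
- exact: measurable_funB.
- exact: measurable_funB.
- do 2 apply: measurable_funB => //; apply: measurable_funM => //.
  by apply: measurable_funB; apply: measurable_funM.
Qed.

Definition hits n r A : set (seq_space (heis R) * heis R) :=
  [set p | core (p.1 n) r p.2 /\ A p.2].

Lemma measurable_hits n r A : measurable A -> measurable (hits n r A).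
Proof.
move=> mA; apply: measurableI.
  rewrite -[X in measurable X]setTI.
  have mf : measurable_fun setT
      (fun p : seq_space (heis R) * heis R => ((p.1 n : heis R), p.2)).
    apply: measurable_fun_pair; last exact: measurable_snd.
    exact: (measurableT_comp (measurable_coord n) measurable_fst).
  exact: (mf measurableT _ (measurable_core_rel r)).
rewrite -[X in measurable X]setTI.
exact: measurable_snd.
Qed.

Lemma xsection_hits n r A (w : seq_space (heis R)) :
  xsection (hits n r A) w = core (w n) r `&` A.
Proof. by apply/seteqP; split => a; rewrite /xsection /= inE /hits. Qed.

Lemma measurable_core_vol n r A : measurable A ->
  measurable_fun setT (fun w : seq_space (heis R) => leb3 (core (w n) r `&` A)).
Proof.
move=> mA; have := measurable_fun_xsection leb3 (measurable_hits n r mA).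
by congr (measurable_fun _ _); apply/funext => w /=; rewrite xsection_hits.
Qed.

(** Every centre that captures [a] lies in [W], so restricting the law to [W] removes nothing, and
    the value does not depend on [a]. *)
Lemma P_core n r a : 0 < r.1 -> 0 < r.2 -> [set p | core p r a] `<=` W ->
  P [set w : seq_space (heis R) | core (w n) r a] = (lamW^-1 * core_volume r)%:E.
Proof.
move=> r10 r20 sub; rewrite (P_coord n (measurable_coreC a r)).
by rewrite hlebesgue_onE (setIidl sub) leb3_coreC// -EFinM.
Qed.

Lemma integral_core_vol n r A : 0 < r.1 -> 0 < r.2 -> measurable A ->
  (forall a, A a -> [set p | core p r a] `<=` W) ->
  (\int[P]_w leb3 (core (w n) r `&` A) = (lamW^-1 * core_volume r)%:E * leb3 A)%E.
Proof.
move=> r10 r20 mA AW.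
have c0 : (0 <= (lamW^-1 * core_volume r)%:E)%E.
  by rewrite lee_fin mulr_ge0 ?invr_ge0 ?(ltW lamW0)// ltW ?core_volume_gt0.
have ZA (p : seq_space (heis R) * heis R) : hits n r A p -> A p.2 by case.
have Pa a : A a -> P (ysection (hits n r A) a) = (lamW^-1 * core_volume r)%:E.
  move=> Aa; rewrite -(P_core n r10 r20 (AW _ Aa)); congr (P _).
  by apply/seteqP; split => w; rewrite /ysection /= inE /hits /=; [case|].
transitivity (\int[P]_w leb3 (xsection (hits n r A) w))%E.
  by apply: eq_integral => w _; rewrite xsection_hits.
have := @integral_xsection_const _ _ _ _ _ P leb3 (hits n r A) A _ (measurable_hits n r mA) mA
  c0 ZA Pa.
by move=> ->.
Qed.

(** The product of the two volumes is the [leb33] measure of a product set of pairs of points. For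
    each pair the two hitting events concern different coordinates of [w] and are independent. *)
Lemma integral_core_vol2 n m r r' A : n != m ->
  0 < r.1 -> 0 < r.2 -> 0 < r'.1 -> 0 < r'.2 -> measurable A ->
  (forall a, A a -> [set p | core p r a] `<=` W) ->
  (forall a, A a -> [set p | core p r' a] `<=` W) ->
  (\int[P]_w (leb3 (core (w n) r `&` A) * leb3 (core (w m) r' `&` A)) =
   (lamW^-1 * core_volume r)%:E * (lamW^-1 * core_volume r')%:E * (leb3 A * leb3 A))%E.
Proof.
move=> nm r10 r20 r10' r20' mA AW AW'.
pose Z : set (seq_space (heis R) * (heis R * heis R)) :=
  [set p | hits n r A (p.1, p.2.1) /\ hits m r' A (p.1, p.2.2)].
have mZ : measurable Z.
  apply: measurableI; rewrite -[X in measurable X]setTI.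
    have mf : measurable_fun setT
        (fun p : seq_space (heis R) * (heis R * heis R) => (p.1, p.2.1)).
      apply: measurable_fun_pair; first exact: measurable_fst.
      exact: (measurableT_comp measurable_fst measurable_snd).
    exact: (mf measurableT _ (measurable_hits n r mA)).
  have mf : measurable_fun setT
      (fun p : seq_space (heis R) * (heis R * heis R) => (p.1, p.2.2)).
    apply: measurable_fun_pair; first exact: measurable_fst.
    exact: (measurableT_comp measurable_snd measurable_snd).
  exact: (mf measurableT _ (measurable_hits m r' mA)).
have mcA w s : measurable (core w s `&` A).
  by apply: measurableI => //; exact: measurable_core.
have c0 : (0 <= (lamW^-1 * core_volume r)%:E * (lamW^-1 * core_volume r')%:E)%E.
  by rewrite -EFinM lee_fin !mulr_ge0 ?invr_ge0 ?(ltW lamW0)// ltW ?core_volume_gt0.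
have ZA (p : seq_space (heis R) * (heis R * heis R)) : Z p -> (A `*` A) p.2.
  by move=> [[_ ?] [_ ?]].
have Pa a : (A `*` A) a -> P (ysection Z a) =
    ((lamW^-1 * core_volume r)%:E * (lamW^-1 * core_volume r')%:E)%E.
  case: a => [a a'] [/= Aa Aa'].
  rewrite -(P_core n r10 r20 (AW _ Aa)) -(P_core m r10' r20' (AW' _ Aa')).
  rewrite (P_coord n (measurable_coreC a r)) (P_coord m (measurable_coreC a' r')).
  rewrite -(P_coord2 nm (measurable_coreC a r) (measurable_coreC a' r')); congr (P _).
  apply/seteqP; split => w; rewrite /ysection /= inE /Z /hits /=.
    by move=> [[? _] [? _]].
  by move=> [].
have E2 : (leb33 (A `*` A) = leb3 A * leb3 A)%E by exact: leb33E.
transitivity (\int[P]_w leb33 (xsection Z w))%E; last first.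
  rewrite -E2; have := @integral_xsection_const _ _ _ _ _ P leb33 Z (A `*` A) _
    mZ (measurableX mA mA) c0 ZA Pa.
  by move=> ->.
apply: eq_integral => w _.
transitivity (leb33 ((core (w n) r `&` A) `*` (core (w m) r' `&` A))).
  by rewrite leb33E.
congr (leb33 _).
by apply/seteqP; split => a; rewrite /xsection /= inE /Z /hits /=.
Qed.

End RandomCores.

(** * Sums over countably many tiles *)

Section CountableSums.
Context {R : realType} {I : countType}.
Implicit Types (H : I -> \bar R) (s : seq I).

(** Turns a family over a countable type into a sequence, with 0 at the codes that stand for
    nothing. *)
Definition pickled H (i : nat) : \bar R :=
  if pickle_inv i is Some x then H x else 0%E.

Lemma pickled_ge0 H : (forall x, 0 <= H x)%E -> forall i, (0 <= pickled H i)%E.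
Proof. by move=> H0 i; rewrite /pickled; case: pickle_inv. Qed.

Lemma sum_pickled H n :
  (\sum_(0 <= i < n) pickled H i =
   \sum_(x <- pmap (@pickle_inv I) (iota 0 n)) H x)%E.
Proof.
rewrite /index_iota subn0; elim: (iota 0 n) => [|i l IH]; first by rewrite !big_nil.
rewrite big_cons IH /pickled /=; case: pickle_inv => [x|] /=; first by rewrite big_cons.
by rewrite add0e.
Qed.

Lemma uniq_pickled n : uniq (pmap (@pickle_inv I) (iota 0 n)).
Proof. by rewrite (pmap_uniq (@pickle_invK I))// iota_uniq. Qed.

Lemma sum_le_series_pickled H s : (forall x, 0 <= H x)%E -> uniq s ->
  (\sum_(x <- s) H x <= \sum_(0 <= i <oo) pickled H i)%E.
Proof.
move=> H0 us; have [n sn] : exists n, forall x, x \in s -> (pickle x < n)%N.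
  exists (\max_(x <- s) pickle x).+1 => x xs.
  by rewrite ltnS; exact: leq_bigmax_seq.
apply: le_trans (@nneseries_lim_ge _ _ xpredT _ n _); last first.
  by move=> i _ _; exact: pickled_ge0.
rewrite sum_pickled [leRHS](bigID (fun x => x \in s)) /=.
rewrite -[leLHS]adde0; apply: leeD; last by apply: sume_ge0 => x _; exact: H0.
suff pm : perm_eq s [seq x <- pmap (@pickle_inv I) (iota 0 n) | x \in s].
  by rewrite (perm_big _ pm) /= big_filter.
rewrite uniq_perm ?filter_uniq ?uniq_pickled// => x.
rewrite mem_filter mem_pmap; apply/idP/idP => [xs|/andP[]//].
rewrite xs /=; apply/mapP; exists (pickle x); last by rewrite pickleK_inv.
by rewrite mem_iota /= add0n sn.
Qed.

Lemma series_pickled_le H (C : \bar R) : (forall x, 0 <= H x)%E ->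
  (forall s, uniq s -> \sum_(x <- s) H x <= C)%E ->
  (\sum_(0 <= i <oo) pickled H i <= C)%E.
Proof.
move=> H0 h; apply: lime_le; first by apply: is_cvg_nneseries => i _ _; exact: pickled_ge0.
by apply: nearW => n; rewrite sum_pickled; exact/h/uniq_pickled.
Qed.

End CountableSums.

Section DyadicSums.
Context {R : realType}.
Implicit Types (A B : set (heis R)) (s : seq (nat * (int * int * int))).

Definition vol A : R := fine (leb3 A).

(** For $x > 0$, the sum of the geometric series $\sum_j 2^{-jx}$. *)
Definition geom (x : R) : R := (1 - 2 `^ (- x))^-1.

Lemma scale_powR (x : R) j : scale j `^ x = (2 `^ (- x)) ^+ j :> R.
Proof.
rewrite -powR_mulrn ?powR_ge0// -powRrM /scale.
have -> : (2 ^- j : R) = 2 `^ (- j%:R) by rewrite powR_invn.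
by rewrite -powRrM; congr (_ `^ _); ring.
Qed.

Lemma two_powRN_lt1 (x : R) : 0 < x -> 2 `^ (- x) < 1 :> R.
Proof.
move=> x0; rewrite powRN invf_lt1 ?powR_gt0//.
by have := @gt0_ltr_powR R x x0 1 2; rewrite powR1 !nnegrE; apply; rewrite ?ltr1n.
Qed.

Lemma geom_gt0 x : 0 < x -> 0 < geom x.
Proof. by move=> x0; rewrite invr_gt0 subr_gt0 two_powRN_lt1. Qed.

Lemma sum_scale_le (x : R) J : 0 < x -> \sum_(j < J) scale j `^ x <= geom x.
Proof.
move=> x0; have h := two_powRN_lt1 x0.
rewrite -[X in _ <= X]mul1r ler_pdivlMr ?subr_gt0//.
rewrite (eq_bigr (fun j : 'I_J => (2 `^ (- x)) ^+ j)); last by move=> j _; exact: scale_powR.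
rewrite -[1 - _]opprB mulrN mulrC -subrX1 opprB.
by rewrite lerBlDr lerDl exprn_ge0 ?powR_ge0.
Qed.

Lemma sum_vol_tiles A (rho : R) ks : measurable A -> (leb3 A < +oo)%E -> 0 < rho -> uniq ks ->
  \sum_(k <- ks) vol (A `&` htile rho k) <= vol A.
Proof.
move=> mA Aoo r0 uks; rewrite -lee_fin -sumEFin.
have fA : leb3 A \is a fin_num by rewrite ge0_fin_numE.
rewrite [leRHS]fineK//; apply: le_trans (sum_leb3_tiles mA r0 uks).
apply: lee_sum => k _; rewrite fineK// ge0_fin_numE//.
apply: le_lt_trans Aoo; apply: le_measure; rewrite ?inE//.
by apply: measurableI => //; exact: measurable_tile.
Qed.

(** Half-open tiles of one scale are disjoint and together contribute at most [vol A]; the positive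
    power of the scale then sums geometrically. *)
Lemma sum_dyadic_le (x : R) A s : measurable A -> (leb3 A < +oo)%E -> 0 < x -> uniq s ->
  \sum_(i <- s) scale i.1 `^ x * vol (A `&` htile (scale i.1) i.2) <= geom x * vol A.
Proof.
move=> mA Aoo x0 us.
pose J := (\max_(i <- s) i.1).+1.
have sJ i : i \in s -> (i.1 < J)%N by move=> xs; rewrite ltnS; exact: (leq_bigmax_seq i).
pose F (i : nat * (int * int * int)) := scale i.1 `^ x * vol (A `&` htile (scale i.1) i.2).
rewrite (eq_big_seq (fun i => \sum_(j < J) (i.1 == j :> nat)%:R * F i)); last first.
  move=> i /sJ iJ; rewrite (bigD1 (Ordinal iJ))//= eqxx mul1r big1 ?addr0// => j.
  by rewrite -val_eqE /= eq_sym => /negbTE ->; rewrite mul0r.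
rewrite exchange_big /=.
apply: (@le_trans _ _ (\sum_(j < J) scale j `^ x * vol A)).
  apply: ler_sum => j _.
  rewrite (eq_bigr (fun i => if i.1 == j :> nat then F i else 0)); last first.
    by move=> i _; case: eqP => _; rewrite ?mul1r ?mul0r.
  rewrite -big_mkcond -big_filter.
  pose ks := [seq i.2 | i <- s & i.1 == j :> nat].
  have uks : uniq ks.
    rewrite map_inj_in_uniq ?filter_uniq// => -[j1 k1] [j2 k2].
    by rewrite !mem_filter /= => /andP[/eqP -> _] /andP[/eqP -> _] ->.
  apply: le_trans (ler_wpM2l (powR_ge0 _ _) (sum_vol_tiles mA Aoo (scale_gt0 j) uks)).
  rewrite mulr_sumr /ks big_map !big_filter; apply: ler_sum => i /eqP ij.
  by rewrite /F ij.
rewrite -mulr_suml ler_wpM2r ?sum_scale_le//.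
by rewrite fine_ge0.
Qed.

End DyadicSums.

(** * Almost sure convergence of the block masses *)

Section Blocks.
Context (R : realType) (W : set (heis R)) (lamW : R).
Hypothesis lamW0 : 0 < lamW.
Hypothesis leb3W : leb3 W = lamW%:E.
Hypothesis mW : measurable W.
Context (P : probability (seq_space (heis R)) R).
Hypothesis P_product : is_infinite_product (hlebesgue_on W) P.
Context (r : nat -> R * R) (t : R).
Hypothesis r1_gt0 : forall n, 0 < (r n).1.
Hypothesis r2_gt0 : forall n, 0 < (r n).2.
Hypothesis t04 : 0 <= t <= 4.

Definition hit n (A : set (heis R)) (w : nat -> heis R) : R :=
  vol (core (w n) (r n) `&` A) / core_volume (r n).

Definition block_sum k L : R := \sum_(n < L) (k <= n)%N%:R * Phi t (r n).

(** For a positive [block_sum k L] these weights add up to [lamW]. A core gives [A] the mean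
    proportion [vol A / lamW] when no boundary effect occurs, so the block mass of [A] then has mean
    [vol A]. *)
Definition weight k L n : R := lamW * ((k <= n)%N%:R * Phi t (r n)) / block_sum k L.

(* The mass that the random density
   (vol W / K) sum_n Phi(r_n) 1_(core (w_n) (r_n)) / vol (core r_n) gives to A. *)
Definition block_mass k L A w : R := \sum_(n < L) weight k L n * hit n A w.

Let cv0 n : 0 < core_volume (r n).
Proof. exact: core_volume_gt0. Qed.

Let Phi0 n : 0 < Phi t (r n).
Proof. exact: Phi_gt0. Qed.

Lemma vol_ge0 (A : set (heis R)) : 0 <= vol A. Proof. exact: fine_ge0. Qed.

Lemma hit_ge0 n A w : 0 <= hit n A w.
Proof. by rewrite divr_ge0 ?vol_ge0// ltW. Qed.

Let fin_core n (A : set (heis R)) w : measurable A ->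
  leb3 (core (w n) (r n) `&` A) \is a fin_num.
Proof.
move=> mA; rewrite ge0_fin_numE//.
apply: (@le_lt_trans _ _ (leb3 (core (w n) (r n)))).
  by apply: le_measure; rewrite ?inE//; [apply: measurableI => //|]; exact: measurable_core.
by rewrite leb3_core// ltry.
Qed.

Lemma measurable_hit n A : measurable A ->
  measurable_fun setT (hit n A : seq_space (heis R) -> R).
Proof.
move=> mA; apply: measurable_funM; last exact: measurable_cst.
apply: (measurableT_comp (f := fine)); first exact: fine_measurable.
exact: measurable_core_vol.
Qed.

Lemma block_sum_ge0 k L : 0 <= block_sum k L.
Proof. by apply: sumr_ge0 => n _; rewrite mulr_ge0// ltW. Qed.

Lemma weight_ge0 k L n : 0 <= weight k L n.
Proof.
by rewrite divr_ge0 ?block_sum_ge0// mulr_ge0 ?(ltW lamW0)// mulr_ge0// ltW.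
Qed.

Lemma measurable_block_mass k L A : measurable A ->
  measurable_fun setT (block_mass k L A : seq_space (heis R) -> R).
Proof.
move=> mA; apply: measurable_sum => n; apply: measurable_funM => //.
exact: measurable_hit.
Qed.

(** A diagonal term carries [Phi] twice from the weight and once inverted from the Frostman constant
    [b]. The sum over the block is therefore proportional to [block_sum k L], against its square in
    the normalisation. *)
Lemma block_variance k L A rho T : 0 < block_sum k L -> 0 < rho ->
  measurable A -> A `<=` htile rho T ->
  (forall n a, A a -> [set p | core p (r n) a] `<=` W) ->
  (\int[P]_w ((block_mass k L A w - vol A) ^+ 2)%:E <=
   (64 * lamW * rho `^ t * vol A / block_sum k L)%:E)%E.
Proof.
move=> K0 rho0 mA AT AW.
have fA : leb3 A \is a fin_num.
  rewrite ge0_fin_numE//; apply: (@le_lt_trans _ _ (leb3 (htile rho T))).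
    by apply: le_measure; rewrite ?inE//; exact: measurable_tile.
  by rewrite leb3_tile ?(ltW rho0)// ltry.
pose p := vol A / lamW; pose b n := 64 * (rho `^ t / Phi t (r n)).
have cvn n : core_volume (r n) != 0 by rewrite gt_eqF.
have lamn : lamW != 0 by rewrite gt_eqF.
have Kn : block_sum k L != 0 by rewrite gt_eqF.
have Phin n : Phi t (r n) != 0 by rewrite gt_eqF.
have hitE n (w : nat -> heis R) : (hit n A w)%:E =
    (leb3 (core (w n) (r n) `&` A) * ((core_volume (r n))^-1)%:E)%E.
  by rewrite /hit EFinM fineK ?fin_core.
have m_core n : measurable_fun setT
    (fun w : seq_space (heis R) => leb3 (core (w n) (r n) `&` A)).
  exact: measurable_core_vol.
have H := @second_moment_bound _ _ R P (fun n w => hit n A w) (weight k L) b p L.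
have sE : p * \sum_(n < L) weight k L n = vol A.
  rewrite /weight -mulr_suml -mulr_sumr -/(block_sum k L) /p.
  by field; rewrite lamn Kn.
have VE : \sum_(n < L) weight k L n ^+ 2 * b n * p =
    64 * lamW * rho `^ t * vol A / block_sum k L.
  rewrite (eq_bigr (fun n : 'I_L => (k <= n)%N%:R * Phi t (r n) *
      (64 * lamW * rho `^ t * vol A / block_sum k L ^+ 2))); last first.
    move=> n _; rewrite /weight /b /p; case: (k <= n)%N; last by rewrite !(mul0r, mulr0, expr0n).
    by rewrite !mul1r; field; rewrite lamn Kn Phin.
  by rewrite -mulr_suml -/(block_sum k L); field.
rewrite -VE -[in X in (X <= _)%E]sE; apply: H.
- by move=> n; exact: measurable_hit.
- by move=> n w; exact: hit_ge0.
- by move=> n; exact: weight_ge0.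
- by rewrite divr_ge0 ?vol_ge0// ltW.
- move=> n w _; rewrite /hit /b ler_pdivrMr// -lee_fin fineK ?fin_core//.
  apply: le_trans (core_frostman (w n) T (r1_gt0 n) (r2_gt0 n) rho0 t04).
  apply: le_measure; rewrite ?inE//.
  + by apply: measurableI => //; exact: measurable_core.
  + exact: measurable_core_tile.
  + by move=> a [? ?]; split=> //; exact: AT.
- move=> n _; under eq_integral do rewrite hitE.
  rewrite ge0_integralZr//; last by rewrite lee_fin invr_ge0 ltW.
  rewrite (integral_core_vol lamW0 leb3W P_product)//; last by move=> a; exact: AW.
  rewrite -(fineK fA) -!EFinM /p; congr EFin; rewrite /vol.
  by field; rewrite cvn lamn.
- move=> n m _ _ nm.
  rewrite (eq_integral (fun w : seq_space (heis R) =>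
    (leb3 (core (w n) (r n) `&` A) * leb3 (core (w m) (r m) `&` A)) *
      ((core_volume (r n))^-1 * (core_volume (r m))^-1)%:E)%E); last first.
    move=> w _; rewrite EFinM !hitE EFinM.
    by rewrite muleACA.
  rewrite ge0_integralZr//; last 3 first.
  + exact: emeasurable_funM.
  + by move=> w _; rewrite mule_ge0.
  + by rewrite lee_fin mulr_ge0// invr_ge0 ltW.
  rewrite (integral_core_vol2 lamW0 leb3W P_product)//; try by move=> a; exact: AW.
  rewrite -(fineK fA) -!EFinM /p; congr EFin; rewrite /vol.
  by field; rewrite !cvn lamn.
Qed.

End Blocks.

Lemma ae_impl d (T : measurableType d) (R : realType)
    (mu : {measure set T -> \bar R}) (A B : T -> Prop) :
  (forall x, A x -> B x) -> {ae mu, forall x, A x} -> {ae mu, forall x, B x}.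
Proof. by move=> AB; apply: filterS. Qed.

(** The sum of the series is integrable, hence finite almost everywhere, and where it is finite its
    terms tend to 0. *)
Lemma ge0_summable_ae d (T : measurableType d) (R : realType)
    (mu : {measure set T -> \bar R}) (g : nat -> T -> \bar R) :
  (forall k, measurable_fun setT (g k)) -> (forall k x, 0 <= g k x)%E ->
  (\sum_(0 <= k <oo) \int[mu]_x g k x < +oo)%E ->
  {ae mu, forall x, forall e : R, 0 < e ->
     exists N, forall k, (N <= k)%N -> (g k x <= e%:E)%E}.
Proof.
move=> mg g0 goo.
pose f x := (\sum_(0 <= k <oo) g k x)%E.
have f0 x : (0 <= f x)%E by apply: nneseries_ge0 => k _ _.
have mf : measurable_fun setT f.
  by apply: ge0_emeasurable_sum.
have If : mu.-integrable setT f.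
  apply/integrableP; split => //.
  under eq_integral do rewrite gee0_abs//.
  by rewrite integral_nneseries.
apply: filterS (integrable_ae measurableT If) => x /(_ I) fx e e0.
have foo : (f x < +oo)%E by rewrite -ge0_fin_numE.
have := @nneseries_tail_cvg R (g ^~ x) xpredT foo (fun k _ => g0 k x).
move=> cv.
have : nbhs (0 : \bar R)%E [set y | (y < e%:E)%E].
  by apply: open_nbhs_nbhs; split; [exact: open_ereal_lt_ereal|rewrite /= lte_fin].
move=> /cv [N _ NP]; exists N => k Nk.
apply: le_trans (ltW (NP k Nk)).
rewrite (@nneseries_split _ (g ^~ x) k 1)//.
by rewrite addn1 big_nat1 leeDl// nneseries_ge0.
Qed.

Section AlmostSureConvergence.
Context (R : realType) (W : set (heis R)) (lamW : R).
Hypothesis lamW0 : 0 < lamW.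
Hypothesis leb3W : leb3 W = lamW%:E.
Hypothesis mW : measurable W.
Context (P : probability (seq_space (heis R)) R).
Hypothesis P_product : is_infinite_product (hlebesgue_on W) P.
Context (r : nat -> R * R) (q t : R) (L : nat -> nat).
Hypothesis r1_gt0 : forall n, 0 < (r n).1.
Hypothesis r2_gt0 : forall n, 0 < (r n).2.
Hypothesis q0 : 0 < q.
Hypothesis qt : q < t.
Hypothesis t4 : t <= 4.
Hypothesis LP : forall k, 2 ^+ k <= block_sum r t k (L k).

Let X k A (w : nat -> heis R) := block_mass lamW r t k (L k) A w.

(** For points of such a tile the restriction of the centres to [W] has no effect, so that block
    masses inside it are unbiased. *)
Definition good_tile (B : nat * (int * int * int)) :=
  forall n a, otile (scale B.1) B.2 a -> [set p | core p (r n) a] `<=` W.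

Definition deviation k (B : nat * (int * int * int)) (w : nat -> heis R)
    (i : nat * (int * int * int)) : R :=
  let A := otile (scale B.1) B.2 `&` htile (scale i.1) i.2 in
  scale i.1 `^ (- q) * (block_mass lamW r t k (L k) A w - vol A) ^+ 2.

Let dev_ge0 k B w i : (0 <= (deviation k B w i)%:E)%E.
Proof. by rewrite lee_fin mulr_ge0 ?powR_ge0 ?sqr_ge0. Qed.

Let mBT (B i : nat * (int * int * int)) :
  measurable (otile (scale B.1) B.2 `&` htile (scale i.1) i.2 : set (heis R)).
Proof. by apply: measurableI; exact: measurable_tile. Qed.

Let mdev k B i : measurable_fun setT
  (fun w : seq_space (heis R) => (deviation k B w i)%:E).
Proof.
apply/measurable_EFinP; apply: measurable_funM => //; apply: measurable_funX.
by apply: measurable_funB => //; exact: measurable_block_mass.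
Qed.

Let Edev k B i : good_tile B -> (\int[P]_w (deviation k B w i)%:E <=
  (64 * lamW * scale i.1 `^ (t - q) *
    vol (otile (scale B.1) B.2 `&` htile (scale i.1) i.2) / 2 ^+ k)%:E)%E.
Proof.
move=> gB; rewrite /deviation /=; set A := _ `&` _.
have K0 : 0 < block_sum r t k (L k) by apply: lt_le_trans (LP k); rewrite exprn_gt0.
have t04 : 0 <= t <= 4 by rewrite t4 andbT ltW// (lt_trans q0).
under eq_integral do rewrite EFinM.
rewrite ge0_integralZl_EFin ?powR_ge0//; last 2 first.
- by move=> w _; rewrite lee_fin sqr_ge0.
- apply/measurable_EFinP; apply: measurable_funX; apply: measurable_funB => //.
  by apply: measurable_block_mass => //; exact: mBT.
have AW n a : A a -> [set p | core p (r n) a] `<=` W by move=> [Ba _]; exact: gB.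
have AT : A `<=` htile (scale i.1) i.2 by move=> a [].
have h := @block_variance R W lamW lamW0 leb3W P P_product r t r1_gt0 r2_gt0 t04
  k (L k) A (scale i.1) i.2 K0 (scale_gt0 _) (mBT _ _) AT AW.
have s0 : (0 <= (scale i.1 `^ (- q))%:E)%E by rewrite lee_fin powR_ge0.
apply: (le_trans (lee_wpmul2l s0 h)).
rewrite -EFinM lee_fin powR_gt0D ?scale_gt0//.
rewrite [leRHS](_ : _ = (scale i.1 `^ (- q) * (64 * lamW * scale i.1 `^ t * vol A)) / 2 ^+ k);
  last by ring.
rewrite [leLHS]mulrA ler_wpM2l//.
  by rewrite !mulr_ge0 ?powR_ge0 ?vol_ge0 ?(ltW lamW0).
by rewrite lef_pV2 ?posrE ?exprn_gt0.
Qed.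

(** The expected total deviation of block [k] is of order [scale k]: the gap [t - q] makes the sum
    over tile sizes converge, and [LP] supplies the decay in [k]. *)
Lemma ae_deviation_tile B : good_tile B ->
  {ae P, forall w : nat -> heis R, forall e : R, 0 < e ->
    exists N, forall k, (N <= k)%N -> forall s, uniq s ->
      \sum_(i <- s) deviation k B w i <= e}.
Proof.
move=> gB.
pose g k (w : seq_space (heis R)) :=
  (\sum_(0 <= i <oo) pickled (fun i => (deviation k B w i)%:E) i)%E.
have mp k i : measurable_fun setT
    (fun w : seq_space (heis R) => pickled (fun i => (deviation k B w i)%:E) i).
  by rewrite /pickled; case: pickle_inv => [x|]; [exact: mdev|exact: measurable_cst].
have mg k : measurable_fun setT (g k).
  by apply: ge0_emeasurable_sum => // i w _ _; exact: pickled_ge0.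
have g0 k w : (0 <= g k w)%E by apply: nneseries_ge0 => i _ _; exact: pickled_ge0.
pose C := 64 * lamW * (geom (t - q) * vol (otile (scale B.1) B.2)).
have Eg k : (\int[P]_w g k w <= (C * scale k)%:E)%E.
  rewrite /g integral_nneseries//; last by move=> i w _; exact: pickled_ge0.
  have -> : (\sum_(0 <= i <oo) \int[P]_w pickled (fun i => (deviation k B w i)%:E) i =
    \sum_(0 <= i <oo) pickled (fun i => \int[P]_w (deviation k B w i)%:E) i)%E.
    apply: eq_eseriesr => i _; rewrite /pickled; case: pickle_inv => [//|].
    by rewrite integral0.
  apply: series_pickled_le => [i|s us].
    by apply: integral_ge0 => w _; exact: dev_ge0.
  apply: (@le_trans _ _ (\sum_(i <- s) (64 * lamW * scale k * (scale i.1 `^ (t - q) *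
    vol (otile (scale B.1) B.2 `&` htile (scale i.1) i.2)))%:E)%E).
    apply: lee_sum => i _; apply: (le_trans (Edev k i gB)).
    by rewrite lee_fin le_eqVlt; apply/orP; left; apply/eqP; rewrite /scale; ring.
  rewrite sumEFin -mulr_sumr lee_fin /C.
  have tq : 0 < t - q by rewrite subr_gt0.
  have mB : measurable (otile (scale B.1) B.2 : set (heis R)) by exact: measurable_tile.
  have Boo : (leb3 (otile (scale B.1) B.2 : set (heis R)) < +oo)%E.
    by rewrite leb3_tile ?ltry// ltW// scale_gt0.
  have c0 : 0 <= 64 * lamW * scale k by rewrite !mulr_ge0// ltW// scale_gt0.
  apply: (le_trans (ler_wpM2l c0 (sum_dyadic_le mB Boo tq us))).
  by rewrite le_eqVlt; apply/orP; left; apply/eqP; ring.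
have goo : (\sum_(0 <= k <oo) \int[P]_w g k w < +oo)%E.
  apply: (@le_lt_trans _ _ (C * geom 1)%:E); last exact: ltry.
  apply: lime_le.
    by apply: is_cvg_nneseries => k _ _; apply: integral_ge0.
  apply: nearW => n.
  apply: (@le_trans _ _ (\sum_(0 <= k < n) (C * scale k)%:E)%E).
    by apply: lee_sum.
  rewrite sumEFin lee_fin -mulr_sumr ler_wpM2l//.
    by rewrite /C !mulr_ge0 ?vol_ge0 ?(ltW lamW0)// ltW// geom_gt0// subr_gt0.
  rewrite big_mkord; apply: le_trans (sum_scale_le n ltr01).
  by apply: ler_sum => k _; rewrite powRr1// ltW// scale_gt0.
apply: filterS (ge0_summable_ae mg g0 goo) => w h e e0; have [N NP] := h e e0.
exists N => k Nk s us; rewrite -lee_fin; apply: le_trans (NP k Nk).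
rewrite -sumEFin; apply: sum_le_series_pickled => // i; exact: dev_ge0.
Qed.

(** The quantifier over [B] is inside: there are countably many tiles, and the refinements will
    choose theirs depending on [w]. *)
Lemma ae_deviation :
  {ae P, forall w : nat -> heis R, forall B, good_tile B -> forall e : R, 0 < e ->
    exists N, forall k, (N <= k)%N -> forall s, uniq s ->
      \sum_(i <- s) deviation k B w i <= e}.
Proof.
pose Q (i : nat) (w : seq_space (heis R)) :=
  forall B, pickle_inv i = Some B -> good_tile B -> forall e : R, 0 < e ->
    exists N, forall k, (N <= k)%N -> forall s, uniq s ->
      \sum_(i <- s) deviation k B w i <= e.
have : {ae P, forall w, forall i, Q i w}.
  apply: ae_foralln => i; rewrite /Q.
  case E : (pickle_inv i) => [B|]; last by apply: aeW => w B.
  have [gB|nB] := pselect (good_tile B); last by apply: aeW => w B' [<-].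
  by apply: (ae_impl _ (ae_deviation_tile gB)) => w h B' [<-] _; exact: h.
apply: ae_impl => w h B; apply: (h (pickle B)).
by rewrite pickleK_inv.
Qed.

End AlmostSureConvergence.

(** * Cantor-type refinement *)

Section WeightedSums.
Context {R : realType} {I : eqType}.
Implicit Types (c u : I -> R) (s : seq I).

Lemma cauchy_schwarz_seq c u s : (forall i, i \in s -> 0 <= c i) ->
  (\sum_(i <- s) c i * u i) ^+ 2 <=
  (\sum_(i <- s) c i) * (\sum_(i <- s) c i * u i ^+ 2).
Proof.
elim: s => [|i s IH] c0; first by rewrite !big_nil expr0n mul0r.
rewrite !big_cons.
have ci : 0 <= c i by apply: c0; rewrite mem_head.
have cs j : j \in s -> 0 <= c j by move=> js; apply: c0; rewrite inE js orbT.
have C0 : 0 <= \sum_(j <- s) c j by rewrite big_seq sumr_ge0.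
have V0 : 0 <= \sum_(j <- s) c j * u j ^+ 2.
  by rewrite big_seq sumr_ge0// => j js; rewrite mulr_ge0 ?sqr_ge0 ?cs.
have := IH cs; move: (\sum_(j <- s) c j * u j) (\sum_(j <- s) c j) (\sum_(j <- s) c j * u j ^+
  2) C0 V0.
move: (c i) (u i) ci => a x a0 U C V C0 V0 UCV; clear - a0 C0 V0 UCV.
(* Since [U ^+ 2 <= C * V], the square of the right-hand side is at least $4x^2CV$, the difference
   being the square of [V - C * x ^+ 2]. *)
have key : 2 * x * U <= V + C * x ^+ 2.
  have h0 : 0 <= V + C * x ^+ 2 by rewrite addr_ge0// mulr_ge0// sqr_ge0.
  apply: le_trans (ler_norm _) _; rewrite -(@ler_pXn2r _ 2)// ?nnegrE//.
  rewrite real_normK ?num_real//.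
  have : 0 <= (V - C * x ^+ 2) ^+ 2 by rewrite sqr_ge0.
  have : 0 <= x ^+ 2 * (C * V - U ^+ 2) by rewrite mulr_ge0 ?sqr_ge0// subr_ge0.
  rewrite -subr_ge0 => h1 h2; rewrite -subr_ge0.
  rewrite (_ : _ - _ = (V - C * x ^+ 2) ^+ 2 + 4 * (x ^+ 2 * (C * V - U ^+ 2))); last by ring.
  by rewrite addr_ge0// mulr_ge0.
have := ler_wpM2l a0 key; rewrite -subr_ge0 => h; rewrite -subr_ge0.
rewrite (_ : _ - _ = a * (V + C * x ^+ 2) - a * (2 * x * U) + (C * V - U ^+ 2)); last by ring.
by rewrite addr_ge0// subr_ge0.
Qed.

(** A small [d] keeps the factor of the main term close to 1, so that a refinement can increase the
    energy by arbitrarily little. *)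
Lemma sqr_add_le (a b d : R) : 0 < d ->
  (a + b) ^+ 2 <= (1 + d) * a ^+ 2 + (1 + d^-1) * b ^+ 2.
Proof.
move=> d0; rewrite -subr_ge0.
rewrite (_ : _ - _ = (d * a - b) ^+ 2 / d); last by field; rewrite gt_eqF.
by rewrite divr_ge0 ?sqr_ge0 ?ltW.
Qed.

End WeightedSums.

Section StepMeasures.
Context {R : realType}.
Local Notation dyad := (nat * (int * int * int))%type.
Implicit Types (A : set (heis R)) (B i : dyad) (mu : seq (R * dyad)).

(** Three versions of one tile: the open one carries a density, the half-open one tests masses
    without overlap, the closed one makes supports compact. *)
Definition oset B : set (heis R) := otile (scale B.1) B.2.
Definition hset B : set (heis R) := htile (scale B.1) B.2.
Definition cset B : set (heis R) := ctile (scale B.1) B.2.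

Lemma measurable_oset B : measurable (oset B). Proof. exact: measurable_tile. Qed.
Lemma measurable_hset B : measurable (hset B). Proof. exact: measurable_tile. Qed.

Lemma oset_fin B A : measurable A -> (leb3 (oset B `&` A) < +oo)%E.
Proof.
move=> mA; apply: (@le_lt_trans _ _ (leb3 (oset B))).
  by apply: le_measure; rewrite ?inE//; [apply: measurableI => //|]; exact: measurable_oset.
by rewrite leb3_tile ?ltry// ltW// scale_gt0.
Qed.

(* [mu] stands for the measure with density the sum of [c * 1_(oset B)] over its
   entries [(c, B)]. *)
Definition mass mu A : R := \sum_(x <- mu) x.1 * vol (oset x.2 `&` A).

Definition carrier mu : set (heis R) := \bigcup_(x in [set` mu]) cset x.2.

(** The sum of the densities, not of the masses; it measures how errors on single tiles
    accumulate. *)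
Definition coeffs mu : R := \sum_(x <- mu) x.1.

Definition energy_le (q E : R) mu := forall s : seq dyad, uniq s ->
  \sum_(i <- s) scale i.1 `^ (- q) * mass mu (hset i) ^+ 2 <= E.

Lemma vol_le (A A' : set (heis R)) : measurable A -> measurable A' -> A `<=` A' ->
  (leb3 A' < +oo)%E -> vol A <= vol A'.
Proof.
move=> mA mA' AA' oo; have h : (leb3 A <= leb3 A')%E by apply: le_measure; rewrite ?inE.
by rewrite fine_le// ge0_fin_numE//; exact: le_lt_trans oo.
Qed.

Lemma mass_ge0 mu A : (forall x, x \in mu -> 0 <= x.1) -> 0 <= mass mu A.
Proof. by move=> c0; rewrite /mass big_seq sumr_ge0// => x xm; rewrite mulr_ge0 ?c0 ?vol_ge0. Qed.

(** Lebesgue measure gives a tile of size $\rho$ at most $\rho^4$. Absorbing one of the two factors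
    of the squared mass into the weight leaves the exponent [4 - q], which is positive. *)
Lemma tile_energy B (q : R) : q < 4 ->
  energy_le q (geom (4 - q) * vol (oset B)) [:: (1, B)].
Proof.
move=> q4 s us; have q40 : 0 < 4 - q by rewrite subr_gt0.
have oo : (leb3 (oset B) < +oo)%E by rewrite leb3_tile ?ltry// ltW// scale_gt0.
apply: le_trans (sum_dyadic_le (measurable_oset B) oo q40 us).
apply: ler_sum => i _; rewrite /mass big_seq1 mul1r expr2 mulrA.
have mBi : measurable (oset B `&` hset i).
  by apply: measurableI; [exact: measurable_oset|exact: measurable_hset].
have v : vol (oset B `&` hset i) <= scale i.1 ^+ 4.
  have e : vol (hset i) = scale i.1 ^+ 4 by rewrite /vol leb3_tile ?(ltW (scale_gt0 _)).
  rewrite -e; apply: vol_le => //; first exact: measurable_hset.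
  by rewrite leb3_tile ?ltry// ltW// scale_gt0.
rewrite ler_wpM2r ?vol_ge0//; apply: (le_trans (ler_wpM2l (powR_ge0 _ _) v)).
rewrite -(powR_mulrn 4) ?(ltW (scale_gt0 _))// -powR_gt0D ?scale_gt0//.
by rewrite addrC.
Qed.

End StepMeasures.

Section Refinement.
Context {R : realType} (lamW : R) (r : nat -> R * R) (q t : R) (L : nat -> nat).
Local Notation dyad := (nat * (int * int * int))%type.
Context (w : nat -> heis R).
Hypothesis lamW0 : 0 < lamW.
Hypothesis r1_gt0 : forall n, 0 < (r n).1.
Hypothesis r2_gt0 : forall n, 0 < (r n).2.
Hypothesis q0 : 0 < q.
Implicit Types (A : set (heis R)) (B i : dyad) (mu : seq (R * dyad)).

(** Lebesgue measure on each [oset] is replaced by the density of block [k]. The result lives on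
    cores intersected with tiles, so it must still be approximated by tiles. *)
Definition spread mu k A : R :=
  \sum_(x <- mu) x.1 * block_mass lamW r t k (L k) (oset x.2 `&` A) w.

(** The spread is [mass] plus an error [dv]. Cauchy-Schwarz with the coefficients of [mu] as weights
    bounds the error; it costs one factor [coeffs mu], and the sum over the entries costs the
    other. *)
Lemma spread_energy mu k (eta E d : R) : (forall x, x \in mu -> 0 <= x.1) ->
  0 < d -> energy_le q E mu ->
  (forall x, x \in mu -> forall s, uniq s ->
     \sum_(i <- s) deviation lamW r q t L k x.2 w i <= eta) ->
  forall s, uniq s -> \sum_(i <- s) scale i.1 `^ (- q) * spread mu k (hset i) ^+ 2 <=
    (1 + d) * E + (1 + d^-1) * (coeffs mu ^+ 2 * eta).
Proof.
move=> c0 d0 muE dev s us.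
pose dv i := \sum_(x <- mu) x.1 *
  (block_mass lamW r t k (L k) (oset x.2 `&` hset i) w - vol (oset x.2 `&` hset i)).
have spE i : spread mu k (hset i) = mass mu (hset i) + dv i.
  rewrite /spread /mass /dv -big_split /=; apply: eq_bigr => x _; ring.
have C0 : 0 <= coeffs mu by rewrite /coeffs big_seq sumr_ge0.
apply: (@le_trans _ _ (\sum_(i <- s) ((1 + d) * (scale i.1 `^ (- q) * mass mu (hset i) ^+ 2)
   + (1 + d^-1) * (scale i.1 `^ (- q) * dv i ^+ 2)))).
  apply: ler_sum => i _; rewrite spE.
  apply: (le_trans (ler_wpM2l (powR_ge0 _ _) (sqr_add_le _ _ d0))).
  by rewrite mulrDr !mulrA ![_ `^ _ * (1 + _)]mulrC.
rewrite big_split /= -!mulr_sumr lerD//.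
  by rewrite ler_wpM2l ?muE// addr_ge0// ltW.
rewrite ler_wpM2l ?addr_ge0 ?invr_ge0 ?(ltW d0)//.
apply: (@le_trans _ _ (\sum_(i <- s) coeffs mu * \sum_(x <- mu) x.1 * deviation lamW r q t L k
  x.2 w i)).
  apply: ler_sum => i _.
  apply: (le_trans (ler_wpM2l (powR_ge0 _ _) (cauchy_schwarz_seq _ c0))).
  rewrite mulrCA ler_wpM2l// mulr_sumr; apply: ler_sum => x _.
  by rewrite mulrCA /deviation.
rewrite -mulr_sumr expr2 -mulrA ler_wpM2l// exchange_big /=.
rewrite /coeffs mulr_suml big_seq [leRHS]big_seq; apply: ler_sum => x xmu.
by rewrite -mulr_sumr ler_wpM2l ?c0// dev.
Qed.

(** The deviation of each entry is tested on its own tile: there [hset] contains all of [oset], and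
    the weight, a negative power of a scale at most 1, is at least 1. *)
Lemma spread_total mu k (th : R) : (forall x, x \in mu -> 0 <= x.1) -> 0 <= th ->
  (forall x, x \in mu -> forall s, uniq s ->
     \sum_(i <- s) deviation lamW r q t L k x.2 w i <= th ^+ 2) ->
  mass mu setT - coeffs mu * th <= spread mu k setT.
Proof.
move=> c0 th0 dev; rewrite /mass /coeffs /spread mulr_suml -sumrB.
rewrite big_seq [leRHS]big_seq; apply: ler_sum => x xmu.
rewrite -mulrBr ler_wpM2l ?c0// !setIT.
have := dev x xmu [:: x.2] isT; rewrite big_seq1 /deviation.
rewrite (_ : _ `&` _ = oset x.2); last by apply/setIidl/otile_htile.
set u := block_mass _ _ _ _ _ _ _ => h.
have h2 : (u - vol (oset x.2)) ^+ 2 <= th ^+ 2.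
  apply: le_trans h; rewrite ler_peMl ?sqr_ge0//.
  rewrite powRN invf_ge1 ?powR_gt0 ?scale_gt0//.
  by rewrite -(powRr0 (scale x.2.1)) ger_powR ?scale_gt0 ?scale_le1// ltW.
have : `|u - vol (oset x.2)| <= th.
  by rewrite -(@ler_pXn2r _ 2)// ?nnegrE// real_normK ?num_real.
rewrite ler_norml => /andP[]; lra.
Qed.

End Refinement.

Section InnerMeasure.
Context {R : realType}.
Local Notation dyad := (nat * (int * int * int))%type.
Implicit Types (A S : set (heis R)) (mu : seq (R * dyad)).

Lemma mass_cat mu mu' A : mass (mu ++ mu') A = mass mu A + mass mu' A.
Proof. by rewrite /mass big_cat. Qed.

Lemma inner_measure1 (c : R) S (eps : R) : 0 <= c -> 0 < eps ->
  open (S : set (R * R * R)%type) -> measurable S -> (leb3 S < +oo)%E ->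
  exists mu, [/\ forall x, x \in mu -> 0 <= x.1,
    forall x, x \in mu -> cset x.2 `<=` S,
    forall A, measurable A -> mass mu A <= c * vol (S `&` A) &
    c * vol S - eps <= mass mu setT].
Proof.
move=> c0 eps0 oS mS Soo.
have c1 : 0 < c + 1 by rewrite ltr_wpDl.
have e0 : 0 < eps / (c + 1) by rewrite divr_gt0.
have [m [s [us sS sV]]] := open_inner_tiles oS mS Soo e0.
exists [seq (c, (m, k)) | k <- s]; split.
- by move=> x /mapP[k _ ->].
- by move=> x /mapP[k ks ->]; exact: sS.
- move=> A mA; rewrite /mass big_map /= -mulr_sumr ler_wpM2l//.
  have mSA : measurable (S `&` A) by exact: measurableI.
  have SAoo : (leb3 (S `&` A) < +oo)%E.
    by apply: le_lt_trans Soo; apply: le_measure; rewrite ?inE.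
  apply: le_trans (sum_vol_tiles mSA SAoo (scale_gt0 m) us).
  rewrite big_seq [leRHS]big_seq; apply: ler_sum => k ks; apply: vol_le.
  + by apply: measurableI => //; exact: measurable_oset.
  + by apply: measurableI => //; exact: measurable_tile.
  + move=> a [oa Aa]; have ha := otile_htile oa.
    by split=> //; split=> //; apply: (sS _ ks); exact: htile_ctile.
  + by apply: le_lt_trans SAoo; apply: le_measure; rewrite ?inE//; apply: measurableI => //;
    exact: measurable_tile.
rewrite /mass big_map /= -mulr_sumr.
rewrite (eq_bigr (fun=> scale m ^+ 4)); last first.
  by move=> k _; rewrite setIT /vol leb3_tile// ltW// scale_gt0.
have := ler_wpM2l c0 sV; apply: le_trans.
rewrite mulrBr lerD2l lerN2 mulrCA ger_pMr// ler_pdivrMr// mul1r.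
by rewrite lerDl.
Qed.

(** The approximation is from below: masses of sets can only decrease, so no energy is gained, while
    the total drops by at most [eps]. Closed tiles inside the open sets [S i] keep the new carrier
    inside them. *)
Lemma inner_measure (I : eqType) (l : seq I) (c : I -> R) (S : I -> set (heis R))
    (eps : R) :
  (forall i, 0 <= c i) -> 0 < eps ->
  (forall i, open (S i : set (R * R * R)%type)) ->
  (forall i, measurable (S i)) -> (forall i, leb3 (S i) < +oo)%E ->
  exists mu, [/\ forall x, x \in mu -> 0 <= x.1,
    forall x, x \in mu -> exists2 i, i \in l & cset x.2 `<=` S i,
    forall A, measurable A -> mass mu A <= \sum_(i <- l) c i * vol (S i `&` A) &
    \sum_(i <- l) c i * vol (S i) - eps <= mass mu setT].
Proof.
move=> c0 + oS mS Soo; elim: l eps => [|i l IH] eps eps0.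
  exists [::]; split => // [A _|]; first by rewrite /mass !big_nil.
  by rewrite /mass !big_nil sub0r oppr_le0 ltW.
have e20 : 0 < eps / 2 by rewrite divr_gt0.
have [mu1 [h1 s1 m1 t1]] := inner_measure1 (c0 i) e20 (oS i) (mS i) (Soo i).
have [mu2 [h2 s2 m2 t2]] := IH _ e20.
exists (mu1 ++ mu2); split.
- by move=> x; rewrite mem_cat => /orP[]; [exact: h1|exact: h2].
- move=> x; rewrite mem_cat => /orP[/s1 h|/s2 [j jl h]].
    by exists i => //; rewrite mem_head.
  by exists j => //; rewrite inE jl orbT.
- by move=> A mA; rewrite mass_cat big_cons lerD// ?m1// m2.
- by rewrite mass_cat big_cons; lra.
Qed.

End InnerMeasure.

Section Step.
Context {R : realType} (W : set (heis R)) (lamW : R) (r : nat -> R * R) (q t : R).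
Context (L : nat -> nat) (w : nat -> heis R).
Local Notation dyad := (nat * (int * int * int))%type.
Hypothesis lamW0 : 0 < lamW.
Hypothesis r1_gt0 : forall n, 0 < (r n).1.
Hypothesis r2_gt0 : forall n, 0 < (r n).2.
Hypothesis q0 : 0 < q.
Hypothesis conv : forall B, good_tile W r B -> forall e : R, 0 < e ->
    exists N, forall k, (N <= k)%N -> forall s, uniq s ->
      \sum_(i <- s) deviation lamW r q t L k B w i <= e.
Implicit Types (A : set (heis R)) (B : dyad) (mu : seq (R * dyad)).

Lemma refine_spread mu k (eps : R) : (forall x, x \in mu -> 0 <= x.1) -> 0 < eps ->
  exists mu', [/\ forall x, x \in mu' -> 0 <= x.1,
    forall x, x \in mu' -> exists2 y, y \in mu & cset x.2 `<=` (oset y.2 : set (heis R)),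
    forall x, x \in mu' -> exists2 n, (k <= n)%N & cset x.2 `<=` core (w n) (r n),
    forall A, measurable A -> mass mu' A <= spread lamW r t L w mu k A &
    spread lamW r t L w mu k setT - eps <= mass mu' setT].
Proof.
move=> c0 eps0.
pose l := [seq (x, n) | x <- mu, n <- [seq n <- iota 0 (L k) | (k <= n)%N]].
(* The absolute value makes [c] nonnegative at every index, as [inner_measure] asks; on the entries
   of [mu] it changes nothing. *)
pose c (i : R * dyad * nat) : R :=
  `|i.1.1| * weight lamW r t k (L k) i.2 / core_volume (r i.2).
pose S (i : R * dyad * nat) := core (w i.2) (r i.2) `&` oset i.1.2.
have c_ge0 i : 0 <= c i.
  apply: divr_ge0; last exact/ltW/core_volume_gt0.
  by apply: mulr_ge0 => //; exact: weight_ge0.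
have oS i : open (S i : set (R * R * R)%type) by apply: openI; exact: open_sbox.
have mS i : measurable (S i) by apply: measurableI; [exact: measurable_core|exact: measurable_oset].
have Soo i : (leb3 (S i) < +oo)%E.
  by rewrite /S setIC; apply: oset_fin; exact: measurable_core.
have spE A : spread lamW r t L w mu k A = \sum_(i <- l) c i * vol (S i `&` A).
  rewrite /l big_allpairs_dep /= /spread big_seq [RHS]big_seq; apply: eq_bigr => x xmu.
  rewrite big_filter /block_mass mulr_sumr -(big_mkord xpredT
    (fun n => x.1 * (weight lamW r t k (L k) n * hit r n (oset x.2 `&` A) w))).
  rewrite /index_iota subn0 [RHS]big_mkcond /=; apply: eq_bigr => n _.
  case: ifPn => [kn|kn]; rewrite /c /S /hit /=.
    by rewrite ger0_norm ?c0// setIA; ring.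
  by rewrite /weight (negbTE kn) !mul0r mulr0 !mul0r mulr0.
have [mu' [h1 h2 h3 h4]] := inner_measure l c_ge0 eps0 oS mS Soo.
exists mu'; split => //.
- move=> x /h2 [i /allpairsPdep [y [n [ymu nl ->]]] sub].
  by exists y => // a /sub [].
- move=> x /h2 [i /allpairsPdep [y [n [ymu nl ->]]] sub].
  by exists n => [|a /sub []//]; move: nl; rewrite mem_filter => /andP[].
- by move=> A mA; rewrite spE h3.
- by rewrite spE; under eq_bigr do rewrite setIT.
Qed.

Context (B0 : dyad) (m0 E : R).
Hypothesis gB0 : good_tile W r B0.

(** Both inequalities are strict: the distances to [m0] and to [E] are what the next refinement may
    spend from. *)
Definition valid mu := [/\ forall x, x \in mu -> 0 <= x.1,
  forall x, x \in mu -> oset x.2 `<=` (oset B0 : set (heis R)),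
  m0 < mass mu setT &
  exists2 E', E' < E & energy_le q E' mu].

Lemma good_sub B : oset B `<=` (oset B0 : set (heis R)) -> good_tile W r B.
Proof. by move=> BB n a /BB; exact: gB0. Qed.

Lemma conv_seq mu (e : R) : valid mu -> 0 < e -> exists N, forall k, (N <= k)%N ->
  forall x, x \in mu -> forall s, uniq s ->
     \sum_(i <- s) deviation lamW r q t L k x.2 w i <= e.
Proof.
move=> [_ + _ _] e0; elim: mu => [_|x mu IH sub]; first by exists 0%N.
have [N1 h1] : exists N, forall k, (N <= k)%N -> forall y, y \in mu ->
    forall s, uniq s -> \sum_(i <- s) deviation lamW r q t L k y.2 w i <= e.
  by apply: IH => y ymu; apply: sub; rewrite inE ymu orbT.
have [N2 h2] := conv (good_sub (sub x (mem_head _ _))) e0.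
exists (maxn N1 N2) => k; rewrite geq_max => /andP[k1 k2] y.
by rewrite inE => /orP[/eqP ->|ymu]; [exact: h2|exact: h1].
Qed.

Lemma valid_step mu N0 : valid mu -> exists mu', [/\ valid mu',
  carrier mu' `<=` (carrier mu : set (heis R)) &
  carrier mu' `<=` \bigcup_(n in [set n | (N0 <= n)%N]) core (w n) (r n)].
Proof.
move=> vmu; have [c0 sub m0mu [E' E'E muE]] := vmu.
have E'0 : 0 <= E' by have := muE [::] isT; rewrite big_nil.
have C0 : 0 <= coeffs mu by rewrite /coeffs big_seq sumr_ge0.
pose gap := E - E'; have gap0 : 0 < gap by rewrite subr_gt0.
(* Each of [d * E'] and the deviation term will take at most a quarter of [gap]; each of the
   deviation of the total mass and the tile approximation at most a quarter of [slack]. Adding 1 to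
   [E'] and to [coeffs mu] keeps the denominators positive. *)
pose d := gap / (4 * (E' + 1)).
have E1 : 0 < E' + 1 by rewrite ltr_wpDl.
have d0 : 0 < d by rewrite divr_gt0// mulr_gt0.
pose slack := mass mu setT - m0; have slack0 : 0 < slack by rewrite subr_gt0.
pose C1 := coeffs mu + 1; have C10 : 0 < C1 by rewrite ltr_wpDl.
have dd0 : 0 < 1 + d^-1 by rewrite addr_gt0// invr_gt0.
pose th := Num.min (slack / (4 * C1)) (Num.min 1 (gap / (4 * (1 + d^-1) * C1 ^+ 2))).
have th0 : 0 < th.
  by rewrite !lt_min ltr01 !divr_gt0// ?mulr_gt0// exprn_gt0.
have th20 : 0 < th ^+ 2 by rewrite exprn_gt0.
have [N NP] := conv_seq vmu th20.
pose k := maxn N N0.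
have dev : forall x, x \in mu -> forall s, uniq s ->
     \sum_(i <- s) deviation lamW r q t L k x.2 w i <= th ^+ 2.
  by apply: NP; exact: leq_maxl.
have spT := spread_total q0 c0 (ltW th0) dev.
have spE := spread_energy c0 d0 muE dev.
have e0 : 0 < slack / 4 by rewrite divr_gt0.
have [mu' [h1 h2 h3 h4 h5]] := refine_spread k c0 e0.
have Cth : coeffs mu * th <= slack / 4.
  apply: (@le_trans _ _ (C1 * (slack / (4 * C1)))).
    by rewrite ler_pM ?(ltW th0)// ?lerDl// /th ge_min lexx.
  by rewrite le_eqVlt; apply/orP; left; apply/eqP; field; rewrite gt_eqF.
exists mu'; split; last 2 first.
- move=> a [x xmu' ax]; have [y ymu xy] := h2 x xmu'.
  by exists y => //; apply: htile_ctile; apply: otile_htile; exact: xy.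
- move=> a [x xmu' ax]; have [n kn xn] := h3 x xmu'.
  by exists n => /=; [exact: leq_trans (leq_maxr _ _) kn|exact: xn].
split => //.
- move=> x /h2 [y ymu xy] a ax; apply: (sub y ymu); apply: xy.
  by apply: htile_ctile; exact: otile_htile.
- by apply: lt_le_trans h5; rewrite /slack in Cth *; lra.
exists (E' + gap / 2); first by rewrite /gap; lra.
move=> s us.
apply: (@le_trans _ _ (\sum_(i <- s) scale i.1 `^ (- q) * spread lamW r t L w mu k (hset i) ^+ 2)).
  apply: ler_sum => i _; rewrite ler_wpM2l ?powR_ge0//.
  have a0 := mass_ge0 (hset i) h1.
  have b := h4 (hset i) (measurable_hset i).
  by rewrite ler_pXn2r ?nnegrE// (le_trans a0).
apply: (le_trans (spE s us)).
have e1 : d * E' <= gap / 4.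
  rewrite /d mulrAC ler_pdivrMr ?mulr_gt0//.
  rewrite (_ : gap / 4 * (4 * (E' + 1)) = gap * E' + gap); last by field.
  by rewrite lerDl ltW.
have e2 : (1 + d^-1) * (coeffs mu ^+ 2 * th ^+ 2) <= gap / 4.
  have t1 : th ^+ 2 <= gap / (4 * (1 + d^-1) * C1 ^+ 2).
    apply: (@le_trans _ _ th); last by rewrite /th !ge_min lexx !orbT.
    by rewrite expr2 ger_pMl// /th !ge_min lexx orbT.
  have t2 : coeffs mu ^+ 2 <= C1 ^+ 2.
    by rewrite ler_pXn2r ?nnegrE ?(ltW C10)// lerDl.
  apply: (@le_trans _ _ ((1 + d^-1) * (C1 ^+ 2 * (gap / (4 * (1 + d^-1) * C1 ^+ 2))))).
    by rewrite ler_pM2l// ler_pM ?sqr_ge0.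
  rewrite le_eqVlt; apply/orP; left; apply/eqP.
  by move: (1 + d^-1) dd0 => D D0; field; rewrite !gt_eqF.
by lra.
Qed.

End Step.

(** If no stage had a finite subcover, points of [K n] outside the first [n] sets [V i] would have a
    cluster point, which lies in every [K n] and in no [V i]. *)
Lemma nested_compact_cover (T : topologicalType) (K V : nat -> set T) :
  compact (K 0%N) -> (forall n, closed (K n)) -> (forall n, K n.+1 `<=` K n) ->
  (forall n, open (V n)) -> \bigcap_n K n `<=` \bigcup_n V n ->
  exists n N, K n `<=` \bigcup_(i in [set i | (i < N)%N]) V i.
Proof.
move=> cK clK K_dec oV KV; apply: contrapT => nh.
pose G N := \bigcup_(i in [set i | (i < N)%N]) V i.
have oG N : open (G N) by apply: bigcup_open => i _; exact: oV.
have /choice [y yP] n : exists y, K n y /\ ~ G n y.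
  apply: contrapT => h; apply: nh; exists n, n => a Ka.
  by apply: contrapT => nG; apply: h; exists a.
have K_le m n : (m <= n)%N -> K n `<=` K m.
  elim: n => [|n IH]; first by rewrite leqn0 => /eqP ->.
  rewrite leq_eqVlt => /orP[/eqP -> //|]; rewrite ltnS => /IH h a /K_dec; exact: h.
have G_le m n : (m <= n)%N -> G m `<=` G n.
  by move=> mn a [i /= im Va]; exists i => //=; exact: leq_trans mn.
have FK0 : (y @ \oo) (K 0%N).
  by exists 0%N => // n _; apply: (K_le 0%N n) => //; case: (yP n).
have [x [K0x clx]] := cK (y @ \oo) (fmap_proper_filter _ _) FK0.
pose C n := K n `&` ~` G n.
have Cx n : C n x.
  have clC : closed (C n) by apply: closedI => //; exact: open_closedC.
  apply: clC => B nB; apply: clx => //.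
  exists n => // m /= nm; have [Ky Gy] := yP m; split; first exact: K_le nm _ _.
  by move=> Gn; apply: Gy; exact: G_le nm _ _.
have [i _ Vx] := KV x (fun n _ => (Cx n).1).
by have [_] := Cx i.+1; apply; exists i => /=.
Qed.

Arguments near_tiles : simpl never.

(** * The lower bound *)

Section FiniteCover.
Context {R : realType}.
Local Notation dyad := (nat * (int * int * int))%type.
Implicit Types (A : set (heis R)) (mu : seq (R * dyad)).

Lemma vol_cover A (s : seq dyad) : measurable A -> (leb3 A < +oo)%E ->
  (forall a, A a -> exists2 i, i \in s & hset i a) ->
  vol A <= \sum_(i <- s) vol (A `&` hset i).
Proof.
elim: s A => [|i s IH] A mA Aoo As.
  have -> : A = set0 by apply/seteqP; split => // a /As [].
  by rewrite big_nil /vol measure0.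
have fin (B : set (heis R)) : measurable B -> B `<=` A -> (leb3 B < +oo)%E.
  by move=> mB BA; apply: le_lt_trans Aoo; apply: le_measure; rewrite ?inE.
have mAi j : measurable (A `&` hset j).
  by apply: measurableI => //; exact: measurable_hset.
have mD : measurable (A `\` hset i) by apply: measurableD => //; exact: measurable_hset.
have DA : A `\` hset i `<=` A by move=> a [].
rewrite big_cons.
have -> : vol A = vol (A `&` hset i) + vol (A `\` hset i).
  rewrite /vol (measureDI leb3 mA (measurable_hset i)) addeC fineD//.
    by rewrite ge0_fin_numE// fin// => a [].
  by rewrite ge0_fin_numE// fin.
rewrite lerD2l; apply: le_trans (IH _ mD (fin _ mD DA) _) _.
  move=> a [Aa nh]; have [j] := As a Aa.
  by rewrite inE => /orP[/eqP -> //|js] ha; exists j.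
apply: ler_sum => j _; apply: vol_le => //.
- by apply: measurableI => //; exact: measurable_hset.
- by move=> a [[]].
- by apply: fin => // a [].
Qed.

(** Each box is exchanged for the 207 tiles of its size that it can meet, with duplicates removed
    because the energy bound concerns distinct tiles. Cauchy-Schwarz uses the weights [scale i.1] to
    the power [q]. The option type allows empty sets in the cover. *)
Lemma energy_cover mu (q E eta : R) (D : nat -> option (heis R * nat)) N :
  (forall x, x \in mu -> 0 <= x.1) -> energy_le q E mu ->
  carrier mu `<=` \bigcup_(i in [set i | (i < N)%N])
    (if D i is Some p then hbox p.1 (scale p.2) else set0) ->
  \sum_(i < N) (if D i is Some p then scale p.2 `^ q else 0) <= eta ->
  mass mu setT ^+ 2 <= 207%:R * eta * E.
Proof.
move=> c0 muE cov Deta.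
pose f i : seq dyad := if D i is Some p then
   [seq (p.2, k) | k <- near_tiles (scale p.2) p.1] else [::].
pose l := flatten [seq f i | i <- iota 0 N].
pose s := undup l.
have us : uniq s by exact: undup_uniq.
have scov a : carrier mu a -> exists2 i, i \in s & hset i a.
  move=> /cov [i /= iN]; case Di : (D i) => [[u j]|//] /= ha.
  exists (j, tile_index (scale j) a); last exact/htile_index/scale_gt0.
  rewrite mem_undup; apply/flattenP; exists (f i).
    by apply: map_f; rewrite mem_iota.
  rewrite /f Di; apply/mapP; exists (tile_index (scale j) a); last by [].
  exact: hbox_near_tiles (scale_gt0 j) ha.
have E0 : 0 <= E by have := muE [::] isT; rewrite big_nil.
have h1 : mass mu setT <= \sum_(i <- s) mass mu (hset i).
  rewrite /mass exchange_big /= big_seq [leRHS]big_seq; apply: ler_sum => x xmu.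
  rewrite -mulr_sumr ler_wpM2l ?c0// setIT; apply: vol_cover.
  - exact: measurable_oset.
  - by rewrite leb3_tile ?ltry// ltW// scale_gt0.
  - move=> a ax; apply: scov; exists x => //.
    by apply: htile_ctile; exact: otile_htile.
have h2 : \sum_(i <- s) scale i.1 `^ q <= 207%:R * eta.
  apply: (@le_trans _ _ (\sum_(i <- l) scale i.1 `^ q)).
    rewrite /s; elim: (l) => [|i l' IH] //=; case: ifP => _; rewrite !big_cons.
      by rewrite ler_wpDl ?powR_ge0.
    by rewrite lerD2l.
  apply: le_trans (ler_wpM2l (ler0n _ 207) Deta).
  rewrite /l big_flatten /= big_map -(big_mkord xpredT
    (fun i => if D i is Some p then scale p.2 `^ q else 0)) /index_iota subn0 mulr_sumr.
  apply: ler_sum => i _; rewrite /f; case: (D i) => [p|]; last by rewrite big_nil mulr0.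
  rewrite big_map (eq_bigr (fun=> scale p.2 `^ q))//.
  by rewrite big_const_seq count_predT size_near_tiles iter_addr_0 mulr_natl.
have m0 := mass_ge0 setT c0.
apply: (@le_trans _ _ ((\sum_(i <- s) mass mu (hset i)) ^+ 2)).
  by rewrite ler_pXn2r// nnegrE (le_trans m0).
have sq (i : dyad) : 0 < scale i.1 `^ q :> R by rewrite powR_gt0// scale_gt0.
rewrite (eq_bigr (fun i => scale i.1 `^ q * (mass mu (hset i) / scale i.1 `^ q))); last first.
  by move=> i _; rewrite mulrC divfK// gt_eqF.
apply: le_trans (cauchy_schwarz_seq _ _) _; first by move=> i _; exact: ltW.
have e2 : \sum_(i <- s) scale i.1 `^ q * (mass mu (hset i) / scale i.1 `^ q) ^+ 2 <= E.
  apply: le_trans (muE s us); apply: ler_sum => i _.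
  rewrite powRN le_eqVlt; apply/orP; left; apply/eqP; field.
  by rewrite gt_eqF.
apply: ler_pM => //; first by rewrite sumr_ge0// => i _; exact: ltW.
by rewrite sumr_ge0// => i _; rewrite mulr_ge0 ?sqr_ge0// ltW.
Qed.

End FiniteCover.

Section GaugeScale.
Context {R : realType}.
Implicit Types (U : set (heis R)) (s q : R).

Lemma scale_powR_small q (e : R) : 0 < q -> 0 < e -> exists j, scale j `^ q <= e.
Proof.
move=> q0 e0; have [M MP] := scale_small (powR_gt0 q^-1 e0).
exists M; have h := MP M (leqnn M).
have := @ge0_ler_powR R q (ltW q0) (scale M) (e `^ q^-1).
rewrite !nnegrE (ltW (scale_gt0 _)) powR_ge0 -powRrM mulVf ?gt_eqF// powRr1 ?(ltW e0)//.
by move=> /(_ isT isT (ltW h)).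
Qed.

Lemma scale_above (D : R) : 0 < D < 1 -> exists j, D < scale j <= 2 * D.
Proof.
move=> /andP[D0 D1].
have ex : exists m, scale m <= D :> R.
  by have [M MP] := scale_small D0; exists M; exact/ltW/MP.
case: (ex_minnP ex) => -[|m] mD min.
  by move: mD; rewrite /scale expr0 invr1 leNgt D1.
exists m; apply/andP; split.
  by rewrite ltNge; apply/negP => /min; rewrite ltnn.
rewrite (_ : scale m = 2 * scale m.+1) ?ler_pM2l//.
by rewrite /scale exprS invfM mulrA divff ?mul1r// pnatr_eq0.
Qed.

Lemma diameter_ge U u v : U u -> U v -> ((hdist u v)%:E <= diameter hdist U)%E.
Proof.
move=> Uu Uv; rewrite /diameter le_max; apply/orP; right.
by apply: ereal_sup_ubound; exists (u, v).
Qed.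

(** The scale is strictly above the diameter [D], because [hbox] is open, and at most [2 * D],
    whence the power of 2; then [D < 1] allows passing from exponent [q] to [s]. For diameter 0
    there is no such scale, and [e] pays for a small box. *)
Lemma gauge_scale U s q (e delta : R) : 0 <= s -> s <= q -> 0 < q -> 0 < e -> delta < 1 ->
  U !=set0 -> (diameter hdist U <= delta%:E)%E -> exists p : heis R * nat,
  U `<=` hbox p.1 (scale p.2) /\
  ((scale p.2 `^ q)%:E <= (2 `^ q)%:E * hausdorff_gauge hdist s U + e%:E)%E.
Proof.
move=> s0 sq q0 e0 d1 [u Uu] dU.
have dge0 : (0 <= diameter hdist U)%E by rewrite /diameter le_max lexx.
have [D DE] : exists D : R, diameter hdist U = D%:E.
  exists (fine (diameter hdist U)); rewrite fineK// ge0_fin_numE//.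
  by apply: le_lt_trans dU _; exact: ltry.
have gE : hausdorff_gauge hdist s U = (D `^ s)%:E.
  rewrite /hausdorff_gauge DE poweR_EFin ifF//.
  by apply/negbTE/set0P; exists u.
rewrite gE -EFinM -EFinD.
move: dge0 dU; rewrite DE !lee_fin => D0 Dd.
have hU j : D < scale j -> U `<=` hbox u (scale j).
  move=> Dj v Uv; apply: hdist_hbox; apply: le_lt_trans Dj.
  by rewrite -lee_fin -DE; exact: diameter_ge.
have D1 : D < 1 by exact: le_lt_trans d1.
move: D0; rewrite le_eqVlt => /orP[/eqP D0|D0].
  have [j je] := scale_powR_small q0 e0; exists (u, j); split => /=.
    by apply: hU; rewrite -D0 scale_gt0.
  by rewrite lee_fin; apply: (le_trans je); rewrite lerDr mulr_ge0 ?powR_ge0.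
have [j /andP[Dj jD]] : exists j, D < scale j <= 2 * D by apply: scale_above; rewrite D0.
exists (u, j); split => /=; first exact: hU.
rewrite lee_fin; apply: (@le_trans _ _ (2 `^ q * D `^ s)); last by rewrite lerDl ltW.
apply: (@le_trans _ _ ((2 * D) `^ q)).
  by apply: (ge0_ler_powR (ltW q0)); rewrite ?nnegrE ?(ltW (scale_gt0 _)) ?mulr_ge0// ltW.
rewrite powRM ?(ltW D0)// ler_pM2l ?powR_gt0//.
by apply: ger_powR => //; rewrite D0 ltW.
Qed.

End GaugeScale.

Section LowerBound.
Context {R : realType} (W : set (heis R)) (lamW : R) (r r' : nat -> R * R) (q t : R).
Context (L : nat -> nat) (w : nat -> heis R) (B0 : nat * (int * int * int)).
Local Notation dyad := (nat * (int * int * int))%type.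
Hypothesis lamW0 : 0 < lamW.
Hypothesis r1_gt0 : forall n, 0 < (r n).1.
Hypothesis r2_gt0 : forall n, 0 < (r n).2.
Hypothesis q04 : 0 < q < 4.
Hypothesis conv : forall B, good_tile W r B -> forall e : R, 0 < e ->
    exists N, forall k, (N <= k)%N -> forall s, uniq s ->
      \sum_(i <- s) deviation lamW r q t L k B w i <= e.
Hypothesis gB0 : good_tile W r B0.
Hypothesis core_rect : forall n, core (w n) (r n) `<=` hrectangle (w n) (r' n).

Let vB0 : 0 < vol (oset B0 : set (heis R)).
Proof. by rewrite /vol leb3_tile ?(ltW (scale_gt0 _))//= exprn_gt0// scale_gt0. Qed.

(** Half of the initial mass and one unit above the initial energy bound leave the room that all
    refinements share. *)
Let m0 := vol (oset B0 : set (heis R)) / 2.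
Let E := geom (4 - q) * vol (oset B0 : set (heis R)) + 1.

Let q0 : 0 < q. Proof. by case/andP: q04. Qed.
Let q4 : q < 4. Proof. by case/andP: q04. Qed.

Let m00 : 0 < m0. Proof. by rewrite divr_gt0. Qed.
Let E0 : 0 < E.
Proof. by rewrite ltr_wpDl// mulr_ge0 ?(ltW vB0)// ltW// geom_gt0// subr_gt0. Qed.

Local Notation good_mu := (valid q B0 m0 E).

Let valid0 : good_mu [:: (1, B0)].
Proof.
split.
- by move=> x; rewrite inE => /eqP ->.
- by move=> x; rewrite inE => /eqP ->.
- by rewrite /mass big_seq1 mul1r setIT /m0 ltr_pdivrMr// ltr_pMr// ltr1n.
- exists (geom (4 - q) * vol (oset B0 : set (heis R))); first by rewrite /E ltrDl.
  exact: tile_energy.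
Qed.

Let step (n : nat) (x : {mu : seq (R * dyad) | good_mu mu}) :
  {y : {mu : seq (R * dyad) | good_mu mu} |
    carrier (sval y) `<=` (carrier (sval x) : set (heis R)) /\
    carrier (sval y) `<=` \bigcup_(m in [set m | (n <= m)%N]) core (w m) (r m)}.
Proof.
apply: cid; case: x => mu vmu.
have [mu' [v' h1 h2]] := valid_step lamW0 r1_gt0 r2_gt0 q0 conv gB0 n vmu.
by exists (exist _ mu' v').
Qed.

Let Fixpoint st n : {mu : seq (R * dyad) | good_mu mu} :=
  if n is n'.+1 then sval (step n' (st n')) else exist _ _ valid0.

Let K n : set (heis R) := carrier (sval (st n)).

Let K_dec n : K n.+1 `<=` K n.
Proof. by rewrite /K /=; case: (svalP (step n (st n))). Qed.

Let K_core n : K n.+1 `<=` \bigcup_(m in [set m | (n <= m)%N]) core (w m) (r m).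
Proof. by rewrite /K /=; case: (svalP (step n (st n))). Qed.

Let carrier_cons (x : R * dyad) mu :
  carrier (x :: mu) = cset x.2 `|` carrier mu :> set (heis R).
Proof.
rewrite /carrier (_ : [set` (x :: mu)] = [set x] `|` [set` mu]).
  by rewrite bigcup_setU bigcup_set1.
apply/seteqP; split => y /=; rewrite inE.
  by move=> /orP[/eqP|]; [left|right].
by move=> [->|->]; rewrite ?eqxx ?orbT.
Qed.

Let carrier_nil : carrier [::] = set0 :> set (heis R).
Proof. by apply/seteqP; split => // a []. Qed.

Let compact_carrier (mu : seq (R * dyad)) : compact (carrier mu : set (R * R * R)%type).
Proof.
elim: mu => [|x mu IH]; first by rewrite carrier_nil; exact: compact0.
by rewrite carrier_cons; apply: compactU => //; exact: compact_ctile.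
Qed.

Let closed_carrier (mu : seq (R * dyad)) : closed (carrier mu : set (R * R * R)%type).
Proof.
elim: mu => [|x mu IH]; first by rewrite carrier_nil; exact: closed0.
by rewrite carrier_cons; apply: closedU => //; exact: closed_sbox.
Qed.

Let K_limsup : \bigcap_n K n `<=` limsup_rectangles r' w.
Proof.
move=> a Ka n _; have [m /= nm cm] := K_core (Ka n.+1 I).
by exists m => //; exact: core_rect.
Qed.

Lemma limsup_hausdorff_measure_neq0 s : 0 <= s <= q ->
  hausdorff_measure hdist s (limsup_rectangles r' w) <> 0%E.
Proof.
move=> /andP[s0 sq] H0.
(* [e] is such that $207\,(2^q + 2)\,e\,E = m_0^2$. The summand 2 bounds the sum of the errors
   [scale i] made when the sets of the cover are replaced by boxes. *)
pose c := 207%:R * (2 `^ q + 2) * E.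
have c0 : 0 < c by rewrite !mulr_gt0// addr_gt0// powR_gt0.
pose e := m0 ^+ 2 / c.
have e0 : 0 < e by rewrite divr_gt0// exprn_gt0.
have [U [UF dU] Ue] : exists2 U : nat -> set (heis R),
    limsup_rectangles r' w `<=` \bigcup_i U i /\
      (forall i, (diameter hdist (U i) <= (2^-1)%:E)%E) &
    (\sum_(0 <= i <oo) hausdorff_gauge hdist s (U i) < e%:E)%E.
  have : (hausdorff_content hdist 2^-1 s (limsup_rectangles r' w) < e%:E)%E.
    apply: (@le_lt_trans _ _ 0%E); last by rewrite lte_fin.
    have h2 : 0 < 2^-1 :> R by rewrite invr_gt0.
    by rewrite -H0; apply: ereal_sup_ubound; exists 2^-1.
  by move=> /ereal_inf_lt [_ [U hU <-] ltU]; exists U.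
have /choice [D DP] i : exists D : option (heis R * nat),
    U i `<=` (if D is Some p then hbox p.1 (scale p.2) else set0) /\
    ((if D is Some p then scale p.2 `^ q else 0)%:E <=
     (2 `^ q)%:E * hausdorff_gauge hdist s (U i) + (e * scale i)%:E)%E.
  have [->|/set0P U0] := eqVneq (U i) set0.
    exists None; split => //; rewrite /hausdorff_gauge eqxx mule0 add0e lee_fin.
    by rewrite mulr_ge0 ?(ltW e0)// ltW// scale_gt0.
  have es : 0 < e * scale i by rewrite mulr_gt0// scale_gt0.
  have d1 : 2^-1 < 1 :> R by rewrite invf_lt1// ltr1n.
  have [p [Up ep]] := gauge_scale s0 sq q0 es d1 U0 (dU i).
  by exists (Some p).
pose V i : set (heis R) := if D i is Some p then hbox p.1 (scale p.2) else set0.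
have oV i : open (V i : set (R * R * R)%type).
  rewrite /V; case: (D i) => [p|]; [exact: open_sbox|exact: open0].
have KV : \bigcap_n K n `<=` \bigcup_i V i.
  by move=> a /K_limsup /UF [i _ Ua]; exists i => //; exact: (DP i).1.
have [n [N KN]] := @nested_compact_cover (R * R * R)%type K V
  (@compact_carrier _) (fun n => @closed_carrier _) K_dec oV KV.
have [mu_ge0 _ mu_m0 [E' E'E muE]] := svalP (st n).
have g0 i : (0 <= hausdorff_gauge hdist s (U i))%E.
  by rewrite /hausdorff_gauge; case: ifP => // _; exact: poweR_ge0.
have eta : \sum_(i < N) (if D i is Some p then scale p.2 `^ q else 0) <= (2 `^ q + 2) * e.
  rewrite -lee_fin -sumEFin.
  apply: (@le_trans _ _ (\sum_(i < N) ((2 `^ q)%:E * hausdorff_gauge hdist s (U i) + (e * scale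
    i)%:E))%E).
    by apply: lee_sum => i _; exact: (DP i).2.
  rewrite big_split /= -ge0_sume_distrr//.
  rewrite mulrDl EFinD leeD//.
    rewrite EFinM lee_wpmul2l ?lee_fin ?powR_ge0//.
    apply: le_trans (ltW Ue).
    rewrite -(big_mkord xpredT (fun i => hausdorff_gauge hdist s (U i))).
    exact: nneseries_lim_ge.
  rewrite sumEFin lee_fin -mulr_sumr mulrC ler_wpM2r ?(ltW e0)//.
  have := sum_scale_le N (@ltr01 R); rewrite /geom powRN powRr1//.
  rewrite (_ : (1 - 2^-1)^-1 = 2 :> R); last by field.
  by apply: le_trans; apply: ler_sum => i _; rewrite powRr1// ltW// scale_gt0.
have := energy_cover mu_ge0 muE KN eta.
rewrite leNgt => /negP; apply.
have E'0 : 0 <= E' by have := muE [::] isT; rewrite big_nil.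
apply: (@le_lt_trans _ _ (m0 ^+ 2)).
  have -> : m0 ^+ 2 = 207%:R * ((2 `^ q + 2) * e) * E.
    rewrite /e -{1}(divfK (lt0r_neq0 c0) (m0 ^+ 2)) /c; ring.
  apply: ler_wpM2l; last exact: ltW.
  by apply: mulr_ge0 => //; apply: mulr_ge0 (ltW e0); rewrite addr_ge0 ?powR_ge0.
by rewrite ltr_pXn2r// nnegrE ltW// (lt_trans m00).
Qed.

End LowerBound.

Arguments irange : simpl never.

(** * The upper bound *)

Section Covering.
Context {R : realType}.
Implicit Types (p u v : heis R) (r : R * R) (rho : R) (k : int * int * int).

Lemma hnorm4_left p u v :
  hnorm4 (hmul (hinv p) u) (hmul (hinv p) v) = hnorm4 u v.
Proof.
by case: p u v => [[x y] z] [[x1 y1] z1] [[x2 y2] z2]; rewrite /hnorm4 /=; ring.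
Qed.

(** Translating the centre of the rectangle to the origin keeps the slopes of the tiles of order
    [r.1], so that the number of tiles does not depend on [p]. *)
Definition ltile p rho k : set (heis R) := [set u | ctile rho k (hmul (hinv p) u)].

Lemma ltile_diam p rho k u v : 0 <= rho -> ltile p rho k u -> ltile p rho k v ->
  hdist u v <= 3 * rho.
Proof.
move=> r0 pu pv; rewrite hdist_leE ?mulr_ge0// -(hnorm4_left p) -hdist_leE ?mulr_ge0//.
exact: ctile_diam pu pv.
Qed.

Definition cover_indices r rho : seq (int * int * int) :=
  let A := (Num.truncn (r.1 / rho)).+1 in
  let C := (Num.truncn (r.2 ^+ 2 / rho ^+ 2 + 4 * (r.1 / rho))).+1 in
  [seq (ab.1, ab.2, c) | ab <- [seq (a, b) | a <- irange A, b <- irange A], c <- irange C].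

(** With $U = r_1/\rho$ and $V = r_2^2/\rho^2$ this is $(2U+3)^2(2V+8U+3)$. The term $8U$ counts the
    extra heights caused by freezing the slopes at the corners. *)
Definition cover_bound r rho : R :=
  (2 * (r.1 / rho) + 3) ^+ 2 * (2 * (r.2 ^+ 2 / rho ^+ 2) + 8 * (r.1 / rho) + 3).

Lemma size_cover_indices r rho : 0 < rho -> 0 <= r.1 ->
  (size (cover_indices r rho))%:R <= cover_bound r rho.
Proof.
move=> rho0 r10; rewrite /cover_indices !size_allpairs !size_irange.
have u0 : 0 <= r.1 / rho by rewrite divr_ge0// ltW.
have v0 : 0 <= r.2 ^+ 2 / rho ^+ 2 + 4 * (r.1 / rho).
  by apply: addr_ge0; [rewrite divr_ge0 ?sqr_ge0|rewrite mulr_ge0].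
have tr (x : R) : 0 <= x -> (2 * (Num.truncn x).+1 + 1)%:R <= 2 * x + 3.
  move=> x0; have := truncn_le x; rewrite x0 => h.
  by rewrite natrD natrM -addn1 natrD; lra.
rewrite !natrM /cover_bound expr2.
have h1 := tr _ u0; have h2 := tr _ v0.
apply: ler_pM => //; first by apply: ler_pM.
by apply: (le_trans h2); lra.
Qed.

Lemma hrectangle_ltile p r rho u : 0 < rho -> 0 <= r.1 -> hrectangle p r u ->
  exists2 k, k \in cover_indices r rho & ltile p rho k u.
Proof.
move=> rho0 r10 Ru; set v := hmul (hinv p) u.
exists (tile_index rho v); last exact/htile_ctile/htile_index.
have r2 : 0 < rho ^+ 2 by rewrite exprn_gt0.
have rn0 : rho != 0 by rewrite gt_eqF.
have [vx vy vz] : [/\ `|v.1.1| <= r.1, `|v.1.2| <= r.1 & `|v.2| <= r.2 ^+ 2].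
  have sq (s1 s2 : R) : s1 ^+ 2 + s2 ^+ 2 <= r.1 ^+ 2 -> `|s1| <= r.1.
    move=> h; rewrite -(@ler_pXn2r _ 2)// ?nnegrE// real_normK ?num_real//.
    by apply: le_trans h; rewrite lerDl sqr_ge0.
  rewrite /v; case: p u Ru {v} => [[x y] z] [[x' y'] z'] [h1 h2] /=; split.
  - by apply: (sq _ (y' - y)); rewrite (_ : - x + x' = x' - x)// addrC.
  - by apply: (sq _ (x' - x)); rewrite (_ : - y + y' = y' - y) 1?addrC.
  - by move: h2; congr (`|_| <= _); ring.
rewrite /cover_indices /tile_index; move: v vx vy vz => [[x y] z]; cbn [fst snd] => vx vy vz.
set a := Num.floor (x / rho); set b := Num.floor (y / rho).
set c := Num.floor (shear _ _ (x, y, z) / _).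
pose X := x / rho; pose Y := y / rho; pose Z := z / rho ^+ 2.
have xE : x = X * rho by rewrite /X divfK.
have yE : y = Y * rho by rewrite /Y divfK.
have zE : z = Z * rho ^+ 2 by rewrite /Z divfK ?expf_neq0.
have ha : a%:~R <= X < (a + 1)%:~R by exact: floor_itv.
have hb : b%:~R <= Y < (b + 1)%:~R by exact: floor_itv.
have hc : c%:~R <= Z - 2 * (a%:~R * Y - b%:~R * X) < (c + 1)%:~R.
  rewrite (_ : Z - _ = shear (a%:~R * rho) (b%:~R * rho) (x, y, z) / rho ^+ 2).
    exact: floor_itv.
  by rewrite /shear /= xE yE zE; field.
pose U := r.1 / rho; pose V := r.2 ^+ 2 / rho ^+ 2.
have XU : `|X| <= U by rewrite /X /U normrM [`|rho^-1|]ger0_norm ?invr_ge0 ?(ltW rho0)//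
  ler_pM2r ?invr_gt0.
have YU : `|Y| <= U by rewrite /Y /U normrM [`|rho^-1|]ger0_norm ?invr_ge0 ?(ltW rho0)//
  ler_pM2r ?invr_gt0.
have ZV : `|Z| <= V.
  by rewrite /Z /V normrM [`|(rho ^+ 2)^-1|]ger0_norm ?invr_ge0 ?(ltW r2)// ler_pM2r ?invr_gt0.
have U0 : 0 <= U by rewrite divr_ge0// ltW.
have V0 : 0 <= V by rewrite divr_ge0 ?sqr_ge0.
have rng (i : int) (s T : R) : 0 <= T -> i%:~R <= s < (i + 1)%:~R -> `|s| <= T ->
    i \in irange (Num.truncn T).+1.
  move=> T0 /andP[h1 h2]; rewrite ler_norml => /andP[h3 h4].
  have tT := truncnS_gt T.
  apply: mem_irange; rewrite -!(ltr_int R) rmorphN /=.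
  have e : (Num.truncn T).+2%:~R = (Num.truncn T).+1%:R + 1 :> R.
    by rewrite -pmulrn -[LHS]natr1.

  move: h2; rewrite intrD e => h2; apply/andP; split; lra.
apply/allpairsPdep; exists (a, b), c; split; last by [].
  by apply/allpairsPdep; exists a, b; split => //; [exact: rng XU|exact: rng YU].
apply: rng hc _; first by apply: addr_ge0 V0 (mulr_ge0 (ler0n _ 4) U0).
pose th := X - a%:~R; pose ph := Y - b%:~R.
have th01 : 0 <= th <= 1.
  by move: ha; rewrite intrD /th => /andP[? ?]; apply/andP; split; lra.
have ph01 : 0 <= ph <= 1.
  by move: hb; rewrite intrD /ph => /andP[? ?]; apply/andP; split; lra.
(* Only the fractional parts of [X] and [Y] remain as slopes, so the shear changes the height by at
   most [4 * U]. *)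
have -> : Z - 2 * (a%:~R * Y - b%:~R * X) = Z - 2 * (ph * X - th * Y).
  by rewrite /th /ph; ring.
have m01 (s S : R) : 0 <= s <= 1 -> `|S| <= U -> `|s * S| <= U.
  move=> /andP[s0 s1] h; rewrite normrM (ger0_norm s0).
  by apply: le_trans h; rewrite ler_piMl.
have := m01 _ _ ph01 XU; have := m01 _ _ th01 YU; move: ZV.
rewrite -/U -/V; move: (ph * X) (th * Y) => g h; clear.
by rewrite !ler_norml => /andP[? ?] /andP[? ?] /andP[? ?]; apply/andP; split; lra.
Qed.

(* [rho] is [r2], [r1], [r1] or [r2^2 / r1], one value per case of [Phi]. *)
Lemma optimal_scale t r : 0 < r.1 -> 0 < r.2 -> exists rho,
  [/\ 0 < rho, cover_bound r rho * rho `^ t <= 325%:R * Phi t r & rho `^ t <= Phi t r].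
Proof.
case: r => r1 r2 /= r10 r20.
have n1 : r1 != 0 by rewrite gt_eqF.
have n2 : r2 != 0 by rewrite gt_eqF.
(* $325 = 5^2 \cdot 13$ is the bound for ratios at most 1. In the other two cases the power of
   [rho], divided by [Phi], compensates the larger number of tiles and the same constant serves. *)
have cb (U V : R) : 0 <= U -> 0 <= V -> V <= 1 -> U <= 1 ->
    (2 * U + 3) ^+ 2 * (2 * V + 8 * U + 3) <= 325%:R.
  move=> U0 V0 V1 U1; apply: (@le_trans _ _ (5 ^+ 2 * 13)); last by rewrite -natrX -natrM ler_nat.
  by apply: ler_pM; rewrite ?sqr_ge0 ?addr_ge0 ?mulr_ge0// ?ler_pXn2r ?nnegrE ?addr_ge0
    ?mulr_ge0//; lra.
have P0 := @Phi_gt0 R t (r1, r2) r10 r20.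
suff [rho [rho0 h1 h2]] : exists rho, [/\ 0 < rho,
    cover_bound (r1, r2) rho * (rho `^ t / Phi t (r1, r2)) <= 325%:R &
    rho `^ t / Phi t (r1, r2) <= 1].
  exists rho; split => //; last by move: h2; rewrite ler_pdivrMr// mul1r.
  by move: h1; rewrite mulrA ler_pdivrMr.
have ratio := fun rho => @Phi_ratio R t (r1, r2) rho r10 r20.
rewrite /cover_bound /=; case: (leP r1 r2) ratio => /= r12 ratio.
  have [t2|t2] := leP t 2.
    exists r2; split => //; rewrite ratio// t2 (divff n2) powR1 ?mulr1 ?(divff (expf_neq0 2 n2))//.
    by apply: cb => //; [rewrite divr_ge0 ?ltW|rewrite ler_pdivrMr// mul1r].
  have V1 : (r1 / r2) ^+ 2 <= 1.
    by rewrite -[leRHS](expr1n _ 2) ler_pXn2r ?nnegrE ?divr_ge0 ?(ltW r10) ?(ltW r20)//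
      ler_pdivrMr// mul1r.
  exists r1; rewrite ratio// (leNgt t 2) t2 /= (divff n1) powR1.
  split => //; last by rewrite mulr1.
  rewrite [leLHS](_ : _ = 50%:R + 275%:R * (r1 / r2) ^+ 2); last by field; rewrite n1 n2.
  by lra.
have u1 : 1 <= r1 ^+ 2 / r2 ^+ 2.
  by rewrite ler_pdivlMr ?exprn_gt0// mul1r ler_pXn2r ?nnegrE ?(ltW r10) ?(ltW r20) ?(ltW r12).
have [t3|t3] := leP t 3.
  exists r1; split => //; rewrite ratio// t3 (divff n1) powR1 ?[leLHS]mulr1//.
  apply: cb => //; first by rewrite divr_ge0 ?sqr_ge0.
  by rewrite ler_pdivrMr ?exprn_gt0// mul1r ler_pXn2r ?nnegrE ?(ltW r10) ?(ltW r20) ?(ltW r12).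
have rho0 : 0 < r2 ^+ 2 / r1 by rewrite divr_gt0 ?exprn_gt0.
exists (r2 ^+ 2 / r1); split => //; rewrite ratio// (leNgt t 3) t3 /=.
  rewrite divfK// (divff (expf_neq0 2 n2)) powR1 mulr1.
  pose u := r1 ^+ 2 / r2 ^+ 2.
  have u0 : 0 < u by rewrite divr_gt0 ?exprn_gt0.
  rewrite [leLHS](_ : _ = (2 * u + 3) ^+ 2 * (2 * u + 8 * u + 3) / u ^+ 3); last first.
    by rewrite /u; field; rewrite n1 n2.
  rewrite ler_pdivrMr ?exprn_gt0//.
  apply: (@le_trans _ _ ((5 * u) ^+ 2 * (13 * u))).
    have u2 : 1 <= u by [].
    by apply: ler_pM; rewrite ?sqr_ge0// ?ler_pXn2r// ?nnegrE; lra.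
  by rewrite le_eqVlt; apply/orP; left; apply/eqP; ring.
rewrite divfK// (divff (expf_neq0 2 n2)) powR1 mulr1.
rewrite -[leRHS](expr1n _ 3) ler_pXn2r ?nnegrE ?divr_ge0 ?sqr_ge0 ?(ltW r10)//.
rewrite ler_pdivrMr// mul1r ler_pdivrMr// -expr2.
by rewrite ler_pXn2r ?nnegrE ?(ltW r10) ?(ltW r20) ?(ltW r12).
Qed.

End Covering.

Lemma grid_sum_le (R : realType) (N : nat -> nat) (c : nat -> R) (l : seq (nat * nat)) :
  (forall n, 0 <= c n) -> uniq l -> exists J,
  \sum_(x <- l) (if (x.2 < N x.1)%N then c x.1 else 0) <= \sum_(n < J) (N n)%:R * c n.
Proof.
move=> c0 ul; pose J := (\max_(x <- l) x.1).+1; exists J.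
have lJ x : x \in l -> (x.1 < J)%N by move=> xl; rewrite ltnS; exact: (leq_bigmax_seq x).
pose F (x : nat * nat) := if (x.2 < N x.1)%N then c x.1 else 0.
rewrite (eq_big_seq (fun x : nat * nat => \sum_(n < J) (x.1 == n :> nat)%:R * F x)); last first.
  move=> x /lJ xJ; rewrite (bigD1 (Ordinal xJ))//= eqxx mul1r big1 ?addr0// => n.
  by rewrite -val_eqE /= eq_sym => /negbTE ->; rewrite mul0r.
rewrite exchange_big /=; apply: ler_sum => n _.
rewrite (eq_bigr (fun x : nat * nat =>
    if (x.1 == n :> nat) && (x.2 < N n)%N then c n else 0)); last first.
  move=> x _; case: eqP => [xn|_] /=; last by rewrite mul0r.
  by rewrite mul1r /F xn.
rewrite -big_mkcond -big_filter big_const_seq count_predT iter_addr_0 -[leLHS]mulr_natl.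
rewrite ler_wpM2r// ler_nat.
pose js := [seq x.2 | x <- l & (x.1 == n :> nat) && (x.2 < N n)%N].
suff : (size js <= size (iota 0 (N n)))%N by rewrite size_map size_iota.
apply: uniq_leq_size.
  rewrite map_inj_in_uniq ?filter_uniq// => -[a b] [a' b'].
  by rewrite !mem_filter /= => /andP[/andP[/eqP -> _] _] /andP[/andP[/eqP -> _] _] ->.
by move=> j /mapP[x]; rewrite mem_filter mem_iota => /andP[/andP[_ h] _] ->.
Qed.

Section ContentBound.
Context {R : realType}.
Implicit Types (A : set (heis R)) (rho s : R).

Lemma diameter_le A rho : 0 <= rho ->
  (forall u v, A u -> A v -> hdist u v <= rho) -> (diameter hdist A <= rho%:E)%E.
Proof.
move=> r0 h; rewrite /diameter ge_max lee_fin r0 /=.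
by apply: ge_ereal_sup => _ [[u v] [/= Au Av] <-]; rewrite lee_fin h.
Qed.

Lemma diameter_ge0 A : (0 <= diameter hdist A)%E.
Proof. by rewrite /diameter le_max lexx. Qed.

Lemma gauge_ge0 s A : (0 <= hausdorff_gauge hdist s A)%E.
Proof. by rewrite /hausdorff_gauge; case: ifP => // _; exact: poweR_ge0. Qed.

Lemma gauge_le A rho s : 0 <= s -> (diameter hdist A <= rho%:E)%E ->
  (hausdorff_gauge hdist s A <= (rho `^ s)%:E)%E.
Proof.
move=> s0 dA; rewrite /hausdorff_gauge; case: ifP => _; first by rewrite lee_fin powR_ge0.
have := diameter_ge0 A; move: dA; case: (diameter hdist A) => [D| |]//.
rewrite !lee_fin => Dr D0.
by apply: ge0_ler_powR => //; rewrite nnegrE// (le_trans D0).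
Qed.

Lemma content_ge0 (delta s : R) A : (0 <= hausdorff_content hdist delta s A)%E.
Proof.
apply: le_ereal_inf_tmp => _ [U _ <-]; apply: nneseries_ge0 => i _ _; exact: gauge_ge0.
Qed.

(** Tile [j] of rectangle [n] is placed at the code of [(n, j)]; all other indices get the empty
    set, whose gauge is 0 even for [s = 0]. The factor 3 is that of [ltile_diam]. *)
Lemma content_le A (p : nat -> heis R) (r : nat -> R * R) (rho : nat -> R) (delta s C : R) :
  0 <= s -> (forall n, 0 < rho n) -> (forall n, 3 * rho n <= delta) ->
  (forall n, 0 <= (r n).1) -> A `<=` \bigcup_n hrectangle (p n) (r n) ->
  (forall J, \sum_(n < J) cover_bound (r n) (rho n) * (3 * rho n) `^ s <= C) ->
  (hausdorff_content hdist delta s A <= C%:E)%E.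
Proof.
move=> s0 rho0 rhod r10 Ap sumC.
pose ks n := cover_indices (r n) (rho n).
pose G (x : nat * nat) : set (heis R) := if (x.2 < size (ks x.1))%N
  then ltile (p x.1) (rho x.1) (nth (0, 0, 0) (ks x.1) x.2) else set0.
have dG x : (diameter hdist (G x) <= (3 * rho x.1)%:E)%E.
  have r3 : 0 <= 3 * rho x.1 by rewrite mulr_ge0// ltW.
  apply: diameter_le => // u v; rewrite /G; case: ifP => // _.
  by apply: ltile_diam; exact: ltW.
pose U i : set (heis R) := if pickle_inv i is Some x then G x else set0.
have gU i : hausdorff_gauge hdist s (U i) = pickled (fun x => hausdorff_gauge hdist s (G x)) i.
  by rewrite /U /pickled; case: pickle_inv => //; rewrite /hausdorff_gauge eqxx.
apply: (@le_trans _ _ (\sum_(0 <= i <oo) hausdorff_gauge hdist s (U i))%E).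
  apply: ereal_inf_lbound; exists U => //; split.
    move=> a /Ap [n _ Ra].
    have [k kn ka] := hrectangle_ltile (rho0 n) (r10 n) Ra.
    have kj : (index k (ks n) < size (ks n))%N by rewrite index_mem.
    exists (pickle (n, index k (ks n))); first exact: I.
    by rewrite /U pickleK_inv /G kj nth_index.
  move=> i; rewrite /U; case: pickle_inv => [x|].
    by apply: le_trans (dG x) _; rewrite lee_fin.
  apply: diameter_le => //; apply: le_trans (rhod 0%N).
  by rewrite mulr_ge0// ltW.
rewrite (eq_eseriesr (g := pickled (fun x => hausdorff_gauge hdist s (G x)))); last first.
  by move=> i _; exact: gU.
apply: series_pickled_le => [x|l ul]; first exact: gauge_ge0.
apply: (@le_trans _ _ (\sum_(x <- l) (if (x.2 < size (ks x.1))%N then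
    (3 * rho x.1) `^ s else 0)%:E)%E).
  apply: lee_sum => x _; case: ifPn => h; first exact: gauge_le (dG x).
  by rewrite /G (negbTE h) /hausdorff_gauge eqxx.
rewrite sumEFin lee_fin.
have [J] := @grid_sum_le R (fun n => size (ks n)) (fun n => (3 * rho n) `^ s) l
  (fun n => powR_ge0 _ _) ul.
move=> h; apply: le_trans (sumC J); apply: (le_trans h).
apply: ler_sum => n _; rewrite ler_wpM2r ?powR_ge0//.
exact: size_cover_indices.
Qed.

Lemma hausdorff_measure_eq0 s A :
  (forall delta e : R, 0 < delta -> 0 < e -> (hausdorff_content hdist delta s A <= e%:E)%E) ->
  hausdorff_measure hdist s A = 0%E.
Proof.
move=> h; apply/eqP; rewrite eq_le; apply/andP; split.
  apply: ge_ereal_sup => _ [delta /= d0 <-].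
  by apply/lee_addgt0Pr => e e0; rewrite add0e; exact: h.
apply: (@le_trans _ _ (hausdorff_content hdist 1 s A)); first exact: content_ge0.
by apply: ereal_sup_ubound; exists 1; [exact: ltr01|].
Qed.

End ContentBound.

Section UpperBound.
Context {R : realType} (r : nat -> R * R) (w : nat -> heis R).
Hypothesis r1_gt0 : forall n, 0 < (r n).1.
Hypothesis r2_gt0 : forall n, 0 < (r n).2.

Lemma limsup_tail N : limsup_rectangles r w `<=`
  \bigcup_n hrectangle (w (n + N)%N) (r (n + N)%N).
Proof.
move=> a /(_ N I) [m /= Nm Rm]; exists (m - N)%N => //.
by rewrite subnK.
Qed.

Lemma limsup_hausdorff_measure_eq0 t : 0 <= t ->
  (\sum_(0 <= n <oo) (Phi t (r n))%:E < +oo)%E ->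
  hausdorff_measure hdist t (limsup_rectangles r w) = 0%E.
Proof.
move=> t0 sumPhi; apply: hausdorff_measure_eq0 => delta e d0 e0.
have P0 n : 0 < Phi t (r n) by exact: Phi_gt0.
pose D := (delta / 3) `^ t.
have D0 : 0 < D by rewrite powR_gt0// divr_gt0.
pose c := 325%:R * 3 `^ t.
have c0 : 0 < c by rewrite mulr_gt0// powR_gt0.
(* The bound [D / 2] forces [rho n <= delta / 3], because [rho n] to the power [t] is at most [Phi];
   the bound [e / c] controls the total cost. *)
pose eps := Num.min (D / 2) (e / c).
have eps0 : 0 < eps by rewrite lt_min !divr_gt0.
have [N NP] : exists N, (\sum_(N <= n <oo) (Phi t (r n))%:E < eps%:E)%E.
  have cv := nneseries_tail_cvg sumPhi (fun n _ => ltW (P0 n)).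
  have nb : nbhs (0 : \bar R)%E [set y | (y < eps%:E)%E].
    by apply: open_nbhs_nbhs; split; [exact: open_ereal_lt_ereal|rewrite /= lte_fin].
  by have [N _ NP] := cv _ nb; exists N; exact: (NP N (leqnn N)).
have tailJ J : \sum_(n < J) Phi t (r (n + N)%N) <= eps.
  rewrite -lee_fin; apply: le_trans (ltW NP).
  apply: le_trans (@nneseries_lim_ge _ _ xpredT _ (N + J) _); last first.
    by move=> n _ _; rewrite lee_fin ltW.
  have -> : (\sum_(N <= n < N + J) (Phi t (r n))%:E = \sum_(n < J) (Phi t (r (n + N)%N))%:E)%E.
    by rewrite -{1}(add0n N) big_addn addKn big_mkord.
  by rewrite sumEFin.
have PhiN n : Phi t (r (n + N)%N) <= eps.
  apply: le_trans (tailJ n.+1); rewrite big_ord_recr /= lerDr sumr_ge0// => i _.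
  exact: ltW.
have /choice [rho rhoP] n := optimal_scale t (r1_gt0 (n + N)) (r2_gt0 (n + N)).
apply: (@content_le _ _ (fun n => w (n + N)%N) (fun n => r (n + N)%N) rho) => //.
- by move=> n; case: (rhoP n).
- move=> n; have [rho0 _ rt] := rhoP n.
  rewrite mulrC -ler_pdivlMr// leNgt; apply/negP => lt.
  have : D <= rho n `^ t.
    by apply: ge0_ler_powR => //; rewrite ?nnegrE ?divr_ge0 ?(ltW d0) ?(ltW lt) ?(ltW rho0).
  apply/negP; rewrite -ltNge; apply: (le_lt_trans rt); apply: le_lt_trans (PhiN n) _.
  by apply: (@le_lt_trans _ _ (D / 2)); [rewrite /eps ge_min lexx|rewrite ltr_pdivrMr//
    ltr_pMr// ltr1n].
- by move=> n; exact: ltW.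
- exact: limsup_tail.
move=> J; apply: (@le_trans _ _ (\sum_(n < J) c * Phi t (r (n + N)%N))).
  apply: ler_sum => n _; have [rho0 h _] := rhoP n.
  rewrite powRM ?(ltW rho0)// mulrCA.
  rewrite [leRHS](_ : _ = 3 `^ t * (325%:R * Phi t (r (n + N)%N))); last by rewrite /c; ring.
  by rewrite ler_pM2l ?powR_gt0.
rewrite -mulr_sumr; apply: (@le_trans _ _ (c * eps)); first by rewrite ler_pM2l.
by rewrite mulrC -ler_pdivlMr// /eps ge_min lexx orbT.
Qed.

(** A single rectangle needs $O(\rho^{-4})$ tiles of size $\rho \le 1$, at a cost of order
    $\rho^{s-4}$. A separate tiny size for each [n] makes the total as small as desired. *)
Lemma limsup_hausdorff_measure_gt4 s : 4 < s ->
  hausdorff_measure hdist s (limsup_rectangles r w) = 0%E.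
Proof.
move=> s4; apply: hausdorff_measure_eq0 => delta e d0 e0.
have s40 : 0 < s - 4 by rewrite subr_gt0.
have d3 : 0 < delta / 3 by rewrite divr_gt0.
pose K n := (2 * (r n).1 + 3) ^+ 2 * (2 * (r n).2 ^+ 2 + 8 * (r n).1 + 3) * 3 `^ s.
have K0 n : 0 < K n.
  have a1 := r1_gt0 n; have a2 : 0 < (r n).2 ^+ 2 by rewrite exprn_gt0.
  by rewrite /K !mulr_gt0 ?powR_gt0 ?exprn_gt0//; lra.
pose f n := Num.min ((delta / 3) `^ (s - 4)) (e / 2 * scale n / K n).
have f0 n : 0 < f n.
  by rewrite lt_min powR_gt0//= divr_gt0// mulr_gt0 ?scale_gt0// divr_gt0.
have /choice [j jP] n := scale_powR_small s40 (f0 n).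
apply: (@content_le _ _ w r (fun n => scale (j n))) => //.
- lra.
- by move=> n; exact: scale_gt0.
- move=> n; rewrite mulrC -ler_pdivlMr// leNgt; apply/negP => lt.
  have := gt0_ltr_powR s40 _ _ lt; rewrite !nnegrE (ltW d3) (ltW (scale_gt0 _)) => /(_ isT isT).
  apply/negP; rewrite -leNgt; apply: (le_trans (jP n)).
  by rewrite /f ge_min lexx.
- by move=> n; exact: ltW.
- by move=> a /(@limsup_tail 0) [n _]; rewrite addn0 => ?; exists n.
move=> J; apply: (@le_trans _ _ (\sum_(n < J) e / 2 * scale n)); last first.
  have := sum_scale_le J (@ltr01 R); rewrite /geom powRN powRr1//.
  rewrite (_ : (1 - 2^-1)^-1 = 2 :> R); last by field.
  rewrite (eq_bigr (fun n : 'I_J => scale n)); last first.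
    by move=> n _; rewrite powRr1// ltW// scale_gt0.
  move=> h; rewrite -mulr_sumr; apply: le_trans (ler_wpM2l _ h) _.
    by rewrite divr_ge0 ?ltW.
  by rewrite divfK.
apply: ler_sum => n _.
apply: (@le_trans _ _ (K n * scale (j n) `^ (s - 4))); last first.
  rewrite mulrC -ler_pdivlMr//; apply: (le_trans (jP n)).
  by rewrite /f ge_min lexx orbT.
set rho := scale (j n).
have rho0 : 0 < rho by exact: scale_gt0.
have rho1 : rho <= 1 by exact: scale_le1.
have rn : rho != 0 by rewrite gt_eqF.
rewrite powRM ?(ltW rho0)// (powR_splitn 4 s rho0) /K.
have P1 : 0 < 3 `^ s * rho `^ (s - 4) by rewrite mulr_gt0 ?powR_gt0.
rewrite [leLHS](_ : _ = (cover_bound (r n) rho * rho ^+ 4) * (3 `^ s * rho `^ (s - 4))); last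
  by ring.
rewrite [leRHS](_ : _ = ((2 * (r n).1 + 3) ^+ 2 * (2 * (r n).2 ^+ 2 + 8 * (r n).1 + 3)) * (3 `^
  s * rho `^ (s - 4))); last by ring.
rewrite ler_pM2r// /cover_bound.
have a1 := r1_gt0 n; have a2 : 0 < (r n).2 ^+ 2 by rewrite exprn_gt0.
rewrite [leLHS](_ : _ = (2 * (r n).1 + 3 * rho) ^+ 2 *
  (2 * (r n).2 ^+ 2 + 8 * (r n).1 * rho + 3 * rho ^+ 2)); last by field.
have rr : rho ^+ 2 <= 1 by rewrite expr_le1// ltW.
have ar : (r n).1 * rho <= (r n).1 by rewrite ger_pMr.
have r20 : 0 <= rho ^+ 2 by rewrite sqr_ge0.
have ar0 : 0 <= (r n).1 * rho by rewrite mulr_ge0 ?ltW.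
apply: ler_pM; rewrite ?sqr_ge0// ?ler_pXn2r// ?nnegrE; lra.
Qed.

End UpperBound.

(** * Heisenberg and Euclidean topology, existence of good tiles *)

Section Topology.
Context {R : realType}.
Implicit Types (A W : set (heis R)).

Lemma hbox_hdist (u v : heis R) (e : R) : 0 < e -> hbox u (e / 2) v -> hdist u v < e.
Proof.
move=> e0; have e20 : 0 < e / 2 by rewrite divr_gt0.
move=> /(hboxE _ _ e20) [hx hy hz]; rewrite hdist_ltE// /hnorm4.
have sq (x y : R) : 0 < y -> `|x| < y -> x ^+ 2 <= y ^+ 2.
  by move=> y0 xy; rewrite -[leLHS]real_normK ?num_real// ler_pXn2r ?nnegrE ?(ltW y0)// ltW.
have h1 := sq _ _ e20 hx; have h2 := sq _ _ e20 hy.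
have h3 := sq _ _ (exprn_gt0 2 e20) hz.
have h4 : ((v.1.1 - u.1.1) ^+ 2 + (v.1.2 - u.1.2) ^+ 2) ^+ 2 <= (2 * (e / 2) ^+ 2) ^+ 2.
  rewrite ler_pXn2r ?nnegrE ?addr_ge0 ?sqr_ge0//; first by lra.
  by rewrite mulr_ge0 ?sqr_ge0.
apply: (le_lt_trans (lerD h4 h3)).
rewrite (_ : _ + _ = 5 / 16 * e ^+ 4); last by field.
have : 0 < e ^+ 4 by rewrite exprn_gt0.
lra.
Qed.

Lemma hbox_center (u : heis R) (e : R) : 0 < e -> hbox u e u.
Proof.
move=> e0; apply/(hboxE _ _ e0); split; rewrite ?subrr ?normr0//.
by rewrite [_ * u.1.1]mulrC subrr mulr0 subr0 normr0 exprn_gt0.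
Qed.

Lemma dist_open_open W : dist_open hdist W -> open (W : set (R * R * R)%type).
Proof.
move=> oW; rewrite openE => x Wx; have [e e0 eW] := oW x Wx.
apply: (@filterS _ _ _ (hbox x (e / 2))).
  by move=> y hy; apply: eW; exact: hbox_hdist.
apply: open_nbhs_nbhs; split; first exact: open_sbox.
by apply: hbox_center; rewrite divr_gt0.
Qed.

(** The sigma-algebra is the product one, so the open set is written as the countable union of the
    half-open dyadic tiles whose closures it contains. *)
Lemma open_measurable3 A : open (A : set (R * R * R)%type) -> measurable A.
Proof.
move=> oA.
pose F i : set (heis R) := if pickle_inv i is Some x then
  (if `[<ctile (scale x.1) x.2 `<=` A>] then htile (scale x.1) x.2 else set0) else set0.
suff -> : A = \bigcup_i F i.
  apply: bigcupT_measurable => i; rewrite /F; case: pickle_inv => [x|//].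
  by case: ifP => // _; exact: measurable_tile.
apply/seteqP; split => [x Ax|x [i _]]; last first.
  rewrite /F; case: pickle_inv => [y|//].
  by case: ifP => // /asboolP h /htile_ctile /h.
have [M MP] := open_ctile oA Ax.
exists (pickle (M, tile_index (scale M) x)); first exact: I.
rewrite /F pickleK_inv ifT; first exact: htile_index (scale_gt0 M).
exact/asboolP/MP.
Qed.

Lemma dist_bounded_leb3 W : W !=set0 -> measurable W -> dist_bounded hdist W ->
  (leb3 W < +oo)%E.
Proof.
move=> [x Wx] mW [M MP].
have M0 : 0 <= M by apply: le_trans (MP x x Wx Wx); exact: hdist_ge0.
apply: (@le_lt_trans _ _ (leb3 (hbox x (M + 1)))).
  apply: le_measure; rewrite ?inE//; first exact: measurable_sbox.
  move=> y Wy; apply: hdist_hbox; apply: (le_lt_trans (MP x y Wx Wy)); lra.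
have h2 : 0 <= (M + 1) ^+ 2 by rewrite sqr_ge0.
by rewrite leb3_sbox; [rewrite ltry|lra..].
Qed.

Lemma open_leb3_gt0 W : W !=set0 -> dist_open hdist W -> (0 < leb3 W)%E.
Proof.
move=> [x Wx] oW; have [e e0 eW] := oW x Wx.
have e20 : 0 < e / 2 by rewrite divr_gt0.
have e22 : 0 < (e / 2) ^+ 2 by rewrite exprn_gt0.
apply: (@lt_le_trans _ _ (leb3 (hbox x (e / 2)))).
  rewrite leb3_sbox; [rewrite lte_fin|lra..].
  by rewrite !pmulr_rgt0//; lra.
apply: le_measure; rewrite ?inE; first exact: measurable_sbox.
  by apply: open_measurable3; exact: dist_open_open.
by move=> y hy; apply: eW; exact: hbox_hdist.
Qed.

Lemma hrectangle_scale (p : heis R) (r : R * R) (c : R) : 0 < c <= 1 ->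
  0 < r.1 -> 0 < r.2 -> hrectangle p (c * r.1, c * r.2) `<=` hrectangle p r.
Proof.
move=> /andP[c0 c1] r10 r20; case: p => [[x y] z] [[x' y'] z'] /= [h1 h2]; split.
  apply: (le_trans h1); rewrite ler_pXn2r// ?nnegrE ?mulr_ge0// ?(ltW r10)// ?(ltW c0)//.
  by rewrite ger_pMl.
apply: (le_trans h2); rewrite ler_pXn2r// ?nnegrE ?mulr_ge0// ?(ltW r20)// ?(ltW c0)//.
by rewrite ger_pMl.
Qed.

(** A small rectangle can reach a neighbourhood of [x] only from a nearby centre. The factor
    [1 + 2 * (...)] accounts for the height, which the slope at a point near [x] changes in
    proportion to its coordinates. *)
Lemma hrectangle_near (p a x : heis R) (r : R * R) (d e : R) :
  0 < e -> 0 <= d -> d <= 1 -> d * (1 + 2 * (`|x.1.1| + `|x.1.2| + e)) <= e / 4 ->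
  0 <= r.1 <= d -> 0 <= r.2 <= d -> hrectangle p r a ->
  `|a.1.1 - x.1.1| < e / 2 -> `|a.1.2 - x.1.2| < e / 2 -> `|a.2 - x.2| < e / 2 ->
  [/\ `|p.1.1 - x.1.1| < e, `|p.1.2 - x.1.2| < e & `|p.2 - x.2| < e].
Proof.
case: p a x r => [[px py] pz] [[ax ay] az] [[x y] z] [r1 r2] /= e0 d0 d1.
set K := 1 + _ => dK /andP[r10 r1d] /andP[r20 r2d] [h1 h2] hx hy hz.
have sq (s t : R) : s ^+ 2 + t ^+ 2 <= r1 ^+ 2 -> `|s| <= d.
  move=> h; apply: le_trans r1d; rewrite -(@ler_pXn2r _ 2)// ?nnegrE// real_normK ?num_real//.
  by apply: le_trans h; rewrite lerDl sqr_ge0.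
have dx : `|ax - px| <= d by exact: sq h1.
have dy : `|ay - py| <= d by apply: (sq _ (ax - px)); rewrite addrC.
have K1 : 1 <= K by rewrite lerDl mulr_ge0// !addr_ge0// ltW.
have de : d <= e / 4 by apply: le_trans dK; rewrite ler_peMr.
have r2d2 : r2 ^+ 2 <= d.
  apply: (@le_trans _ _ (d ^+ 2)); first by rewrite ler_pXn2r// ?nnegrE.
  by rewrite expr2 ler_piMr.
have bx : `|ax| <= `|x| + e.
  have := ler_normD x (ax - x); rewrite addrC subrK; lra.
have by_ : `|ay| <= `|y| + e.
  have := ler_normD y (ay - y); rewrite addrC subrK; lra.
split.
- have := ler_normB (ax - x) (ax - px); rewrite (_ : _ - _ = px - x); last by ring.
  lra.
- have := ler_normB (ay - y) (ay - py); rewrite (_ : _ - _ = py - y); last by ring.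
  lra.
have m1 : `|(ax - px) * ay| <= d * (`|y| + e) by rewrite normrM ler_pM.
have m2 : `|(ay - py) * ax| <= d * (`|x| + e) by rewrite normrM ler_pM.
have h3 : `|az - pz - 2 * (px * ay - py * ax)| <= d by exact: le_trans r2d2.
have e1 : `|2 * ((ax - px) * ay - (ay - py) * ax)| <= 2 * (d * (`|y| + e) + d * (`|x| + e)).
  rewrite normrM ger0_norm// ler_pM2l//; apply: (le_trans (ler_normB _ _)).
  exact: lerD.
have -> : pz - z = (az - z) - (az - pz - 2 * (px * ay - py * ax)) +
    2 * ((ax - px) * ay - (ay - py) * ax) by ring.
apply: (le_lt_trans (ler_normD _ _)).
have e2 := ler_normB (az - z) (az - pz - 2 * (px * ay - py * ax)).
apply: (@le_lt_trans _ _ (`|az - z| + d + 2 * (d * (`|y| + e) + d * (`|x| + e)))).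
  by apply: lerD => //; lra.
have e3 : d + 2 * (d * (`|y| + e) + d * (`|x| + e)) <= 2 * (d * K).
  have a0 : 0 <= d * `|x| by rewrite mulr_ge0.
  have b0 : 0 <= d * `|y| by rewrite mulr_ge0.
  by rewrite /K; lra.
by lra.
Qed.

(** As the radii are bounded by [M], one factor [c] brings all of them below the size [d] required
    by [hrectangle_near]; a small enough tile around a point of [W] is then good. *)
Lemma exists_good_tile W (r : nat -> R * R) : W !=set0 ->
  open (W : set (R * R * R)%type) ->
  (forall n, 0 < (r n).1 /\ 0 < (r n).2) ->
  (exists M : R, forall n, (r n).1 <= M /\ (r n).2 <= M) ->
  exists c, 0 < c <= 1 /\
    exists B, good_tile W (fun n => (c * (r n).1, c * (r n).2)) B.
Proof.
move=> [x Wx] oW r_pos [M MP].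
have /nbhs_ballP [e /= e0 eW] := open_nbhs_nbhs (conj oW Wx).
have M0 : 0 < M by apply: lt_le_trans (MP 0%N).1; case: (r_pos 0%N).
pose K := 1 + 2 * (`|x.1.1| + `|x.1.2| + e).
have K1 : 1 <= K by rewrite lerDl mulr_ge0// !addr_ge0// ltW.
have K0 : 0 < K by apply: lt_le_trans K1.
pose d := Num.min 1 (e / (4 * K)).
have d0 : 0 < d by rewrite lt_min ltr01 divr_gt0// mulr_gt0.
have d1 : d <= 1 by rewrite ge_min lexx.
have dK : d * K <= e / 4.
  have : d <= e / (4 * K) by rewrite ge_min lexx orbT.
  by rewrite ler_pdivlMr ?mulr_gt0// => h; lra.
pose c := Num.min 1 (d / M).
have c0 : 0 < c by rewrite lt_min ltr01 divr_gt0.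
have c1 : c <= 1 by rewrite ge_min lexx.
have cM : c * M <= d by rewrite -ler_pdivlMr// ge_min lexx orbT.
exists c; split; first by rewrite c0.
have e20 : 0 < e / 2 by rewrite divr_gt0.
have [D D0 DP] := ctile_sub_ball x e20.
have [m /(_ m (leqnn m)) mP] := scale_small D0.
exists (m, tile_index (scale m) x) => n a /otile_htile/htile_ctile aT p /core_hrectangle Rp.
have sD : 0 < (scale m : R) < D by rewrite scale_gt0 mP.
have [a1 a2 a3] := DP _ _ _ sD (htile_ctile (htile_index x (scale_gt0 m))) aT.
apply: eW; case: (r_pos n) => r10 r20; case: (MP n) => rM1 rM2.
have cr1 : c * (r n).1 <= d by apply: le_trans cM; rewrite ler_pM2l.
have cr2 : c * (r n).2 <= d by apply: le_trans cM; rewrite ler_pM2l.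
have [] := @hrectangle_near p a x (c * (r n).1, c * (r n).2) d e e0 (ltW d0) d1 dK _ _ Rp a1 a2 a3.
- by rewrite /= mulr_ge0 ?(ltW c0) ?(ltW r10).
- by rewrite /= mulr_ge0 ?(ltW c0) ?(ltW r20).
by move=> h1 h2 h3; split; [split|]; rewrite /= /ball /= distrC.
Qed.

End Topology.

(** * The dimension formula from the two bounds *)

Section Assembly.
Context {R : realType}.

(** Neither dropping the first [k] terms nor the factor [c] to the power [t] affects divergence. *)
Lemma block_sum_unbounded (r : nat -> R * R) (t c : R) (k : nat) (M : R) :
  (forall n, 0 < (r n).1 /\ 0 < (r n).2) -> 0 < c ->
  ~ (\sum_(0 <= n <oo) (Phi t (r n))%:E < +oo)%E ->
  exists L, M <= block_sum (fun n => (c * (r n).1, c * (r n).2)) t k L.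
Proof.
move=> r_pos c0 divergent; apply/not_existsP => bounded; apply: divergent.
have Phi0 n : 0 <= Phi t (r n) by apply: ltW; apply: Phi_gt0; case: (r_pos n).
have ct : 0 < c `^ t by rewrite powR_gt0.
apply: (@le_lt_trans _ _ (\sum_(i < k) Phi t (r i) + M / c `^ t)%:E); last exact: ltry.
apply: lime_le.
  by apply: is_cvg_nneseries => n _ _; rewrite lee_fin.
apply: nearW => n; rewrite sumEFin lee_fin big_mkord.
apply: (@le_trans _ _ (\sum_(i < k + n) Phi t (r i))).
  by rewrite addnC big_split_ord/= lerDl sumr_ge0.
rewrite big_split_ord/= lerD2l ler_pdivlMr// mulr_suml.
have /negP := bounded (k + n)%N; rewrite -ltNge => /ltW bM; apply: le_trans bM.
rewrite /block_sum big_split_ord/= [X in _ <= X + _]big1 ?add0r => [|i _]; last first.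
  by rewrite leqNgt ltn_ord mul0r.
apply: ler_sum => i _; case: (r_pos (k + i)%N) => r1 r2.
by rewrite leq_addr mul1r (Phi_scale _ c0 r1 r2) mulrC.
Qed.

Lemma ae_hausdorff_measure_neq0 (W : set (heis R))
    (P : probability (seq_space (heis R)) R) (r : nat -> R * R) (q t : R) :
  W !=set0 -> dist_bounded hdist W -> dist_open hdist W ->
  is_infinite_product (hlebesgue_on W) P ->
  (forall n, 0 < (r n).1 /\ 0 < (r n).2) ->
  (exists M : R, forall n, (r n).1 <= M /\ (r n).2 <= M) ->
  0 < q -> q < t -> t <= 4 ->
  ~ (\sum_(0 <= n <oo) (Phi t (r n))%:E < +oo)%E ->
  {ae P, forall w : nat -> heis R, forall s, 0 <= s <= q ->
    hausdorff_measure hdist s (limsup_rectangles r w) <> 0%E}.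
Proof.
move=> W0 bW oW P_product r_pos r_bounded q0 qt t4 divergent.
have oW' := dist_open_open oW; have mW := open_measurable3 oW'.
have Wgt0 := open_leb3_gt0 W0 oW; have Wfin := dist_bounded_leb3 W0 mW bW.
have leb3W : leb3 W = (fine (leb3 W))%:E.
  by rewrite fineK// ge0_fin_numE// ltW.
have lamW0 : 0 < fine (leb3 W) by rewrite -lte_fin -leb3W.
have [c [c01 [B0 gB0]]] := exists_good_tile W0 oW' r_pos r_bounded.
have c0 : 0 < c by case/andP: c01.
pose rc n := (c * (r n).1, c * (r n).2).
have r1 n : 0 < (rc n).1 by rewrite mulr_gt0//; case: (r_pos n).
have r2 n : 0 < (rc n).2 by rewrite mulr_gt0//; case: (r_pos n).
have [L LP] := choice (fun k => block_sum_unbounded k (2 ^+ k) r_pos c0 divergent).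
have := ae_deviation lamW0 leb3W P_product r1 r2 q0 qt t4 LP.
apply: ae_impl => w conv s sq.
apply: (limsup_hausdorff_measure_neq0 lamW0 r1 r2 _ conv gB0 _ sq).
  by rewrite q0 (lt_le_trans qt).
move=> n p /core_hrectangle; case: (r_pos n) => r10 r20.
exact: hrectangle_scale.
Qed.

Lemma hausdorff_dim_le (r : nat -> R * R) (w : nat -> heis R) :
  (forall n, 0 < (r n).1 /\ 0 < (r n).2) ->
  (hausdorff_dim hdist (limsup_rectangles r w) <=
    mine (ereal_inf [set t%:E | t in
            [set t : R | (0 <= t <= 4)%R /\
                         (\sum_(0 <= n <oo) (Phi t (r n))%:E < +oo)%E]])
         4%:E)%E.
Proof.
move=> r_pos.
have r1 n : 0 < (r n).1 by case: (r_pos n).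
have r2 n : 0 < (r n).2 by case: (r_pos n).
rewrite le_min; apply/andP; split.
  apply: le_ereal_inf_tmp => _ [t [/andP[t0 _] sumPhi] <-].
  by apply: ereal_inf_lbound; exists t => //; split=> //; exact: limsup_hausdorff_measure_eq0.
apply/lee_addgt0Pr => e e0; apply: ereal_inf_lbound; exists (4 + e) => //; split.
  by rewrite addr_ge0// ltW.
by apply: limsup_hausdorff_measure_gt4 => //; rewrite ltrDl.
Qed.

End Assembly.

Theorem theorem1p1 (R : realType) (W : set (heis R))
    (W_nonempty : W !=set0)
    (W_bounded : dist_bounded hdist W)
    (W_open : dist_open hdist W)
    (P : probability (seq_space (heis R)) R)
    (P_product : is_infinite_product (hlebesgue_on W) P)
    (r : nat -> R * R)
    (r_pos : forall n, 0 < (r n).1 /\ 0 < (r n).2)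
    (r_bounded : exists M : R, forall n, (r n).1 <= M /\ (r n).2 <= M) :
  {ae P, forall w : nat -> heis R,
    hausdorff_dim hdist (limsup_rectangles r w) =
    mine (ereal_inf [set t%:E | t in
            [set t : R | 0 <= t <= 4 /\
                         (\sum_(0 <= n <oo) (Phi t (r n))%:E < +oo)%E]])
         4%:E}.
Proof.
set S := [set t : R | _]; set T0 := mine _ _.
have T0_fin : exists2 t0 : R, T0 = t0%:E & t0 <= 4.
  have : (0 <= T0)%E.
    rewrite le_min lee_fin ler0n andbT.
    by apply: le_ereal_inf_tmp => _ [t [/andP[t0 _] _] <-]; rewrite lee_fin.
  have : (T0 <= 4%:E)%E by rewrite ge_min lexx orbT.
  by case: T0 => [t0||]//; rewrite lee_fin; exists t0.
have [t0 T0E t04] := T0_fin.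
(* Countably many exponents [q m < t m < t0], with [q m] tending to [t0], give one null set outside
   which every exponent below [t0] is excluded. The series diverges at [t m], since [t0] is at most
   the infimum. *)
pose q (m : nat) := t0 - 2 / m.+1%:R; pose t (m : nat) := t0 - 1 / m.+1%:R.
have qt m : q m < t m by rewrite ltrD2l ltrN2 ltr_pM2r ?invr_gt0// ltr1n.
have tt0 m : t m < t0 by rewrite gtrDl oppr_lt0 divr_gt0.
have lower : {ae P, forall w : nat -> heis R, forall m, 0 < q m -> forall s,
    0 <= s <= q m -> hausdorff_measure hdist s (limsup_rectangles r w) <> 0%E}.
  apply: ae_foralln => m; have [q0|q0] := ltP 0 (q m); last first.
    by apply: aeW.
  have t4 : t m <= 4 by apply: le_trans t04; exact: ltW.
  have divergent : ~ (\sum_(0 <= n <oo) (Phi (t m) (r n))%:E < +oo)%E.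
    move=> sumPhi; have := tt0 m; rewrite ltNge => /negP; apply.
    rewrite -lee_fin -T0E ge_min; apply/orP; left; apply: ereal_inf_lbound.
    by exists (t m) => //; split=> //; rewrite t4 (ltW (lt_trans q0 (qt m))).
  have := ae_hausdorff_measure_neq0 W_nonempty W_bounded W_open P_product r_pos
    r_bounded q0 (qt m) t4 divergent.
  by apply: ae_impl => w h _.
apply: ae_impl lower => w lower; apply/eqP; rewrite eq_le hausdorff_dim_le//=.
apply: le_ereal_inf_tmp => _ [s [s0 Hs] <-]; rewrite -/T0 T0E lee_fin leNgt.
apply/negP => st0; have d0 : 0 < (t0 - s) / 2 by rewrite divr_gt0// subr_gt0.
have [m mP] : exists m : nat, 1 / m.+1%:R < (t0 - s) / 2.
  have [m _ mP] := near_infty_natSinv_lt (PosNum d0).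
  by exists m; rewrite div1r; apply: mP => /=.
have sq : s < q m.
  have : 2 / m.+1%:R < t0 - s.
    by rewrite -[ltRHS](@divfK _ 2)// -[2 in ltLHS]mul1r mulrAC ltr_pM2r.
  by rewrite /q ltrBrDl -ltrBrDr.
by apply: (lower m _ s _ Hs); rewrite ?s0 ?(ltW sq)// (le_lt_trans s0).
Qed.
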